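(* Let $F$ be a nonabelian free group of finite rank and let $\hat Y$ be any (finite, oriented) combinatorial fatgraph. There is a constant $C(\hat Y,F)>1$ such that, if $Y$ is a random fatgraph over $F$ obtained by labeling the edges of $\hat Y$ by words of length $n$, then with probability $1-O(C(\hat Y,F)^{-n})$ as $n\to\infty$ the surface $S(Y)$ is extremal for $\partial S(Y)$ and is certified by the extremal quasimorphism $\overline H_Y$; that is, $$\mathrm{scl}(\partial S(Y))=\frac{-\chi(S(Y))}{2}=\frac{\overline H_Y(\partial S(Y))}{2D(\overline H_Y)}.$$
   Context: Stable commutator length: for a group $G$ and $g\in[G,G]$, $\mathrm{cl}(g)$ is the least number of commutators whose product is $g$; for $g_1,\dots,g_m\in G$ with product in $[G,G]$, $\mathrm{cl}(\sum g_i)$ is the minimum of $\mathrm{cl}(\prod_i h_ig_ih_i^{-1})$ over $h_i\in G$, and $\mathrm{scl}(\sum g_i)=\lim_{n}\mathrm{cl}(\sum g_i^n)/n$. Fatgraphs: a fatgraph is a finite graph with all vertices of valence at least $3$ together with a cyclic ordering of the edges incident to each vertex. It thickens to a compact surface $S(\cdot)$ deformation retracting to it; fatgraphs are assumed oriented, i.e. $S(\cdot)$ is oriented. $\partial S$ is decomposed into arcs, each mapping isomorphically to an edge of the graph; the two arcs mapping to the same edge are called paired. A fatgraph $Y$ over $F$ (free group with a fixed free generating set) is an oriented fatgraph in which each arc of $\partial S(Y)$ is labeled by a nontrivial reduced word, paired arcs having inverse labels, such that the cyclic words read around the components of $\partial S(Y)$ are cyclically reduced. $\partial S(Y)$ also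 denotes the chain which is the formal sum of these cyclic words; functions on conjugacy classes are extended additively to it. $|v|$ is the valence of a vertex $v$. Random labelings: for given $n$, $Y$ is chosen uniformly from the finite set of fatgraphs over $F$ obtained by labeling every edge of $\hat Y$ by a reduced word of length $n$ (subject to $\partial S(Y)$ being cyclically reduced). Quasimorphisms: a quasimorphism is $\phi:F\to\mathbb R$ for which there is a least $D(\phi)\ge 0$ (the defect) with $|\phi(gh)-\phi(g)-\phi(h)|\le D(\phi)$ for all $g,h$; its homogenization is $\overline\phi(g)=\lim_{n}\phi(g^n)/n$, which is a class function. Definition of $H_Y$: for a reduced word $w$, $C_w(v)$ is the number of (possibly overlapping) copies of $w$ as a subword of the reduced word $v$. For a reduced word $x$, parameterize $x$ proportionally to arclength by $[-1,1]$ and let $x[-t,t]$ be the smallest subword containing the interval from $x(-t)$ to $x(t)$. Fix a sufficiently small $\epsilon>0$ (of order $1/\max_v|v|$) and define the stack function $S_x=\frac1{1-\epsilon}\int_\epsilon^1 C_{x[-t,t]}\,dt$. Let $N$ be such that every edge of $Y$ has label length at least $2N$ (for labels of length $n$, take $N=\lfloor n/2\rfloor$). For each vertex $v$ let $x_0(v),\dots,x_{|v|-1}(v)$ be the oriented arcs of length $N$ (words) ending at $v$ along the edges incident to $v$, indexed mod $|v|$ compatibly with the cyclic order at $v$ so that $\partial S(Y)$ passes from $x_i(v)$ to the inverse of $x_{i+1}(v)$; let $X_i(v)=x_i(v)^{-1}$. Then $$H_Y=\sum_v\ \sum_{\{i,i+k\}}\Big(3-\frac{6k}{|v|}\Big)\big(S_{x_i(v)X_{i+k}(v)}-S_{x_{i+k}(v)X_i(v)}\big),$$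 where the inner sum is over unordered pairs of distinct indices mod $|v|$, written $i,i+k$ with $1\le k\le |v|-1$ (the summand does not depend on the order in which the pair is written), and words $x_iX_j$ are taken in reduced form. *)

(* Defs.v *)
From HB Require Import structures.
From mathcomp Require Import all_boot all_order all_algebra.
From mathcomp Require Import all_classical all_reals all_analysis.

Set Implicit Arguments.
Unset Strict Implicit.
Unset Printing Implicit Defensive.

Import Order.TTheory GRing.Theory Num.Theory.
Import numFieldNormedType.Exports.

Local Open Scope classical_set_scope.
Local Open Scope ring_scope.

(* [(i, true)] is the [i]-th free generator and [(i, false)] its inverse. *)
Definition letter (r : nat) : finType := ('I_r * bool)%type.

Definition letterV (r : nat) (a : letter r) : letter r := (a.1, ~~ a.2).

Definition no_cancel (r : nat) : rel (letter r) :=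
  fun a b => b != letterV a.

Definition reduced (r : nat) (s : seq (letter r)) : bool :=
  sorted (@no_cancel r) s.

(* [cycle] also tests the pair (last letter, first letter). *)
Definition cyc_reduced (r : nat) (s : seq (letter r)) : bool :=
  cycle (@no_cancel r) s.

Definition push (r : nat) (a : letter r) (s : seq (letter r)) :=
  if s is b :: s' then if b == letterV a then s' else a :: s else [:: a].

Definition reduce (r : nat) (s : seq (letter r)) : seq (letter r) :=
  foldr (@push r) [::] s.

Definition wordV (r : nat) (s : seq (letter r)) : seq (letter r) :=
  rev (map (@letterV r) s).

Section FreeGroupTheory.
Variable r : nat.
Implicit Types (a b : letter r) (s t : seq (letter r)).

Lemma letterVK : involutive (@letterV r).
Proof. by case=> i b; rewrite /letterV /= negbK. Qed.

Lemma push_reduced a s : reduced s -> reduced (push a s).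
Proof.
case: s => //= b s; case: eqP => [_|/eqP ab] bs; first exact: path_sorted bs.
by rewrite /reduced /= bs andbT.
Qed.

Lemma foldr_push_reduced s t : reduced t -> reduced (foldr (@push r) t s).
Proof. by move=> rt; elim: s => //= a s; apply: push_reduced. Qed.

Lemma reduce_reduced s : reduced (reduce s).
Proof. exact: foldr_push_reduced. Qed.

Lemma reduce_id s : reduced s -> reduce s = s.
Proof.
elim: s => //= a s IHs as_; rewrite IHs; last exact: path_sorted as_.
by case: s as_ {IHs} => //= b s /andP[/negbTE-> _].
Qed.

Lemma pushVK a s : reduced s -> push (letterV a) (push a s) = s.
Proof.
case: s => [|b s] /=; first by rewrite letterVK eqxx.
case: eqP => [->|_] /=; last by rewrite letterVK eqxx.
by case: s => //= c s /andP[/negbTE-> _].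
Qed.

Lemma pushKV a s : reduced s -> push a (push (letterV a) s) = s.
Proof. by rewrite -{1}(letterVK a); apply: pushVK. Qed.

Lemma foldr_push_reduce s t :
  reduced t -> foldr (@push r) t (reduce s) = foldr (@push r) t s.
Proof.
move=> rt; elim: s => //= a s <-; case: (reduce s) => //= b u.
case: eqP => // ->; rewrite pushKV //; exact: foldr_push_reduced.
Qed.

Lemma foldr_push_wordVK s t :
  reduced t -> foldr (@push r) t (wordV s ++ s) = t.
Proof.
rewrite /wordV => rt; elim: s => //= a s IHs.
rewrite rev_cons cat_rcons foldr_cat /= pushVK ?foldr_push_reduced //.
by rewrite -foldr_cat.
Qed.

Lemma wordV_reduced s : reduced s -> reduced (wordV s).
Proof.
rewrite /wordV /reduced rev_sorted sorted_map => rs.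
rewrite (eq_sorted (e' := @no_cancel r)) // => a b.
by rewrite /= /no_cancel letterVK eq_sym.
Qed.

End FreeGroupTheory.

Record freegrp (r : nat) :=
  FreeGrp { word :> seq (letter r); _ : reduced word }.

HB.instance Definition _ (r : nat) := [isSub for @word r].
HB.instance Definition _ (r : nat) := [Choice of freegrp r by <:].

Definition freegrp_of (r : nat) (s : seq (letter r)) : freegrp r :=
  FreeGrp (reduce_reduced s).

Section FreeGroup.
Variable r : nat.
Implicit Types x y z : freegrp r.

Definition freegrp_one : freegrp r := freegrp_of [::].
Definition freegrp_mul x y : freegrp r := freegrp_of (x ++ y).
Definition freegrp_inv x : freegrp r := freegrp_of (wordV x).

Lemma freegrp_mulA : associative freegrp_mul.
Proof.
have redD s t : reduce (s ++ t) = foldr (@push r) (reduce t) s.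
  exact: foldr_cat.
move=> x y z; apply: val_inj; rewrite /= !redD.
rewrite (@reduce_id _ (foldr _ _ _)) ?foldr_push_reduced ?reduce_reduced //.
by rewrite -[foldr _ (reduce y) x]redD foldr_push_reduce ?reduce_reduced ?foldr_cat.
Qed.

Lemma freegrp_mul1 : left_id freegrp_one freegrp_mul.
Proof. by move=> [x rx]; apply: val_inj; rewrite /= reduce_id. Qed.

Lemma freegrp_mulr1 : right_id freegrp_one freegrp_mul.
Proof. by move=> [x rx]; apply: val_inj; rewrite /= cats0 reduce_id. Qed.

Lemma freegrp_mulV : left_inverse freegrp_one freegrp_inv freegrp_mul.
Proof.
move=> [x rx]; apply: val_inj; rewrite /= (reduce_id (wordV_reduced rx)).
by rewrite /reduce foldr_push_wordVK.
Qed.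

Lemma freegrp_mulrV : right_inverse freegrp_one freegrp_inv freegrp_mul.
Proof.
move=> x; set y := freegrp_inv x.
rewrite -[LHS]freegrp_mul1 -(freegrp_mulV y) -freegrp_mulA.
by rewrite (freegrp_mulA y x y) (freegrp_mulV x) freegrp_mul1.
Qed.

End FreeGroup.

HB.instance Definition _ (r : nat) :=
  isGroup.Build (freegrp r) (@freegrp_mulA r) (@freegrp_mul1 r)
    (@freegrp_mulr1 r) (@freegrp_mulV r) (@freegrp_mulrV r).

Section Scl.
Variables (R : realType) (G : groupType).

(* Infima of sets of naturals in the extended reals: a nonempty set attains its
   infimum, and the empty set (elements outside [G,G]) gives [+oo]. *)
Definition cl (g : G) : \bar R :=
  ereal_inf [set (k%:R)%:E | k in
    [set k : nat | exists a b : 'I_k -> G,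
                     g = (\prod_(i < k) [~ a i, b i])%g]].

Definition cl_chain (gs : seq G) : \bar R :=
  ereal_inf [set cl (\prod_(i < size gs) (h i * nth 1 gs i * (h i)^-1))%g |
              h in [set: 'I_(size gs) -> G]].

Definition scl (gs : seq G) : \bar R :=
  limn (fun n : nat =>
    (cl_chain [seq (g ^+ n)%g | g <- gs] * ((n%:R)^-1)%:E)%E).

Definition defect_bound (phi : G -> R) : set R :=
  [set D : R | 0 <= D /\
     forall g h : G, `|phi (g * h)%g - phi g - phi h| <= D].

Definition quasimorphism (phi : G -> R) : Prop := defect_bound phi !=set0.

Definition defect (phi : G -> R) : R := inf (defect_bound phi).

Definition homogenization (phi : G -> R) (g : G) : R :=
  limn (fun n : nat => phi (g ^+ n)%g / n%:R).

Definition on_chain (phi : G -> R) (gs : seq G) : R := \sum_(g <- gs) phi g.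

End Scl.

(* A dart is an oriented edge; [edge_rev] reverses it.  [vertex_rot] sends a
   dart to the next one, in the cyclic order, among the darts ending at the
   same vertex.  Vertices are thus the [vertex_rot]-orbits and edges the
   [edge_rev]-orbits. *)
Record fatgraph := Fatgraph {
  dart :> finType;
  edge_rev : dart -> dart;
  vertex_rot : dart -> dart;
  edge_revK : involutive edge_rev;
  edge_rev_neq : forall d, edge_rev d != d;
  vertex_rot_inj : injective vertex_rot;
  valence_ge3 : forall d, (3 <= fingraph.order vertex_rot d)%N }.

Arguments edge_rev {f} _.
Arguments vertex_rot {f} _.

Definition valence (Y : fatgraph) (d : Y) : nat := fingraph.order vertex_rot d.

Definition max_valence (Y : fatgraph) : nat := (\max_(d : Y) valence d)%N.

(* The arcs of the oriented boundary of [S(Y)] correspond to the darts, paired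
   arcs being exchanged by [edge_rev].  The arc along [d] runs into the end vertex
   of [d] and leaves it backwards along the next dart [vertex_rot d], so boundary
   components are the orbits of [bnext]. *)
Definition bnext (Y : fatgraph) (d : Y) : Y := edge_rev (vertex_rot d).

(* [S(Y)] deformation retracts to the graph. *)
Definition euler_char (Y : fatgraph) : int :=
  (fcard (@vertex_rot Y) (dart Y))%:Z - (fcard (@edge_rev Y) (dart Y))%:Z.

Definition fatgraph_over (r : nat) (Y : fatgraph) (l : Y -> freegrp r) : bool :=
  [&& [forall d, l d != 1%g],
      [forall d, l (edge_rev d) == (l d)^-1%g] &
      [forall d, cyc_reduced
         (flatten [seq word (l e) | e <- orbit (@bnext Y) d])]].

Definition boundary (r : nat) (Y : fatgraph) (l : Y -> freegrp r) :
    seq (freegrp r) :=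
  [seq (\prod_(e <- orbit (@bnext Y) d) l e)%g | d <- enum (froots (@bnext Y))].

Definition reduced_word (r n : nat) : finType :=
  {w : n.-tuple (letter r) | reduced w}.

Definition word_label (r n : nat) (Y : fatgraph)
    (l : {ffun Y -> reduced_word r n}) : Y -> freegrp r :=
  fun d => FreeGrp (valP (l d)).

Definition labelings (Y : fatgraph) (r n : nat) :
    {set {ffun Y -> reduced_word r n}} :=
  [set l | fatgraph_over (word_label l)].

Definition labeling_prob (R : realType) (Y : fatgraph) (r n : nat)
    (E : (Y -> freegrp r) -> Prop) : R :=
  #|[set l in labelings Y r n | `[< E (word_label l) >]]|%:R
    / #|labelings Y r n|%:R.

Section VertexQuasimorphism.
Variables (R : realType) (r : nat).

Definition copies (w v : seq (letter r)) : nat :=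
  (\sum_(i < size v) prefix w (drop i v))%N.

(* In the parameterization of [x] by [-1,1], the letter of index [j] occupies
   the interval [-1 + 2 j / L, -1 + 2 (j + 1) / L], with [L] the length of
   [x]. *)
Definition central_subword (x : seq (letter r)) (t : R) : seq (letter r) :=
  let first := Num.truncn ((1 - t) / 2 * (size x)%:R) in
  let last := `|Num.ceil ((1 + t) / 2 * (size x)%:R)|%N in
  drop first (take last x).

Definition stack (eps : R) (x v : freegrp r) : R :=
  (1 - eps)^-1 *
  (\int[@lebesgue_measure R]_(t in `[eps, 1]) (copies (central_subword x t) v)%:R).

Variables (Y : fatgraph) (l : Y -> freegrp r) (N : nat) (eps : R).

Definition end_arc (d : Y) : freegrp r :=
  freegrp_of (drop (size (word (l d)) - N) (word (l d))).

(* Contribution of the end vertex of [d]; the unordered pairs of distinct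
   indices are written [{i, i + k}] with [i < j = i + k < |v|]. *)
Definition vertex_term (d : Y) (g : freegrp r) : R :=
  let x i := end_arc (iter i vertex_rot d) in
  \sum_(j < valence d) \sum_(i < j)
    (3 - 6 * (j - i)%:R / (valence d)%:R) *
    (stack eps (x i * (x j)^-1)%g g - stack eps (x j * (x i)^-1)%g g).

Definition H_Y (g : freegrp r) : R :=
  \sum_(d in froots (@vertex_rot Y)) vertex_term d g.

End VertexQuasimorphism.

Section Extremality.
Variables (R : realType) (r : nat) (Y : fatgraph) (l : Y -> freegrp r).

Definition extremal_surface : Prop :=
  scl R (boundary l) = (- (euler_char Y)%:~R / 2)%:E.

Definition certified_by (phi : freegrp r -> R) : Prop :=
  quasimorphism phi /\
  scl R (boundary l) =
    (on_chain (homogenization phi) (boundary l) /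
       (2 * defect (homogenization phi)))%:E.

End Extremality.

(* Main.v *)
(* For the lower bound on [scl] one uses the easy half of Bavard duality, for the
   upper bound the surface itself: contracting and deleting edges of the fatgraph
   writes the n-th powers of the boundary words as a product of
   [- n * chi / 2 + O(1)] commutators.  What remains is that [H_Y] has defect at most
   3 and that its homogenization takes the value [- 6 chi] on the boundary.  If no
   subword of length [L], much smaller than [n], occurs twice in the labels and their
   inverses, then the failure of additivity of [H_Y] at a product [u v] is a sum of
   stack weights over the turns of the fatgraph that are read across the junction.
   For a tripod these can all be read at a single vertex, where the coefficients
   [3 - 6 k / |v|] add up to [3] or [-3] around a triple of darts; along the
   boundary every corner is fully read and contributes [3 - 6 / |v|].
   Labelings with a repeated subword are rare: such a labeling is determined after
   forgetting the [L] letters of one of the two copies, while a coloring of the darts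
   shows that a positive proportion of all labels give cyclically reduced
   boundaries. *)
Require Import Defs.
From mathcomp Require Import all_boot all_order all_fingroup all_algebra.
From mathcomp Require Import all_classical all_reals all_analysis measurable_realfun.
From mathcomp Require Import zify ring lra.

Set Implicit Arguments.
Unset Strict Implicit.
Unset Printing Implicit Defensive.

Import Order.TTheory GRing.Theory Num.Theory.
Import numFieldNormedType.Exports.

Local Open Scope classical_set_scope.
Local Open Scope ring_scope.

(** * Commutator length of chains *)

(** The obstacle is that edges at one vertex may begin with the same letters. The reduced turn from
    one to another then loses [s < L] letters on each side of its middle: its center is [s] letters
    away from the vertex and its half-length is [N - s]. Three turns at a vertex are thus neither
    concentric nor equally long, and their stacks do not match exactly. The mismatch is a factor of
    at most [1 + L / (N - L)] in the distribution of the stack weights. It is absorbed by a gap in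
    the coefficients: each is bounded by [3 - 6 / V], with [V] the maximal valence, while only the
    sum over a tripod reaches [3]. Hence [L] must be a small fraction of [n], depending on [V]. The
    truncation at [eps] keeps every subword of a stack longer than several [L], so that its letters
    determine its place in the fatgraph. Homogenizing doubles the defect bound [3] to [6], and
    [6 m / (2 * 6) = m / 2] for [m = - chi]. That the defect is not smaller than [6] comes for free:
    otherwise the lower bound on [scl] would exceed the upper bound given by the surface. *)

Section CommutatorLength.
Variable G : groupType.
Implicit Types (x y z g h : G) (gs : seq G) (k m n : nat).

Local Open Scope group_scope.

Let gsimp := (@conjgE G, @commgEl G, @invgM G, @invgK G, @mulgA G, @mulgK G,
  @mulgVK G, @mulVg G, @mulgV G, @mul1g G, @mulg1 G, @invg1 G).

Definition prodcomm k g :=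
  exists2 s : seq (G * G), size s = k & g = \prod_(p <- s) [~ p.1, p.2].

Lemma prodcomm0 : prodcomm 0 1.
Proof. by exists [::]; rewrite ?big_nil. Qed.

Lemma prodcommM k m x y : prodcomm k x -> prodcomm m y -> prodcomm (k + m) (x * y).
Proof.
case=> s <- -> [t <- ->]; exists (s ++ t); first by rewrite size_cat.
by rewrite big_cat.
Qed.

Lemma prodcomm1 x y : prodcomm 1 [~ x, y].
Proof. by exists [:: (x, y)]; rewrite ?big_seq1. Qed.

Lemma prodcommJ k x h : prodcomm k x -> prodcomm k (x ^ h).
Proof.
case=> s <- ->; exists [seq (p.1 ^ h, p.2 ^ h) | p <- s]; first by rewrite size_map.
by rewrite conjg_prod big_map; apply: eq_bigr => p _; rewrite conjRg.
Qed.

Lemma prodcomm_conj_div x h : prodcomm 1 (x * (x^-1) ^ h).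
Proof.
have ->: x * (x^-1) ^ h = [~ x^-1, h] by rewrite !gsimp.
exact: prodcomm1.
Qed.

Lemma prodcomm_conjV x h : prodcomm 1 (x^-1 * x ^ h).
Proof. by rewrite -commgEl; apply: prodcomm1. Qed.

(* The two families [x^-n (xy)^n y^-n] and [x^-n (yx)^n y^-n] satisfy
   [A (n+1) = B n], and [B (n+1)] is conjugate to a commutator times [A n]. *)
Lemma prodcomm_expM n x y :
  prodcomm n./2 (x ^- n * (x * y) ^+ n * y ^- n) /\
  prodcomm n.+1./2 (x ^- n * (y * x) ^+ n * y ^- n).
Proof.
have AB j : x ^- j.+1 * (x * y) ^+ j.+1 * y ^- j.+1 =
            x ^- j * (y * x) ^+ j * y ^- j.
  have -> : (x * y) ^+ j.+1 = x * (y * x) ^+ j * y.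
    elim: j => [|j IHj]; first by rewrite !expg0 expg1 !gsimp.
    by rewrite expgS IHj [in RHS]expgS !gsimp.
  by rewrite (expgS x) (expgSr y) !gsimp.
elim: n => [|n [IHA IHB]].
  by rewrite /= !expg0 !gsimp; split; apply: prodcomm0.
split; first by rewrite AB.
have -> : n.+2./2 = n./2.+1 by [].
set A := x ^- n * (x * y) ^+ n * y ^- n in IHA.
pose q := y ^- n * x ^- n.
pose u := x * y^-1.
have -> : x ^- n.+1 * (y * x) ^+ n.+1 * y ^- n.+1 =
  ((((u ^ q) * ((u^-1) ^ x)) ^ q^-1) * (A ^ (y ^+ n))) ^ (x * y ^- n.+1).
  have -> : (y * x) ^+ n.+1 = y * (x * y) ^+ n * x.
    elim: n {IHA IHB A q} => [|j IHj]; first by rewrite !expg0 expg1 !gsimp.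
    by rewrite expgS IHj [in RHS]expgS !gsimp.
  by rewrite /A /q /u (expgS x) (expgSr y) !gsimp.
apply: prodcommJ; rewrite -add1n; apply: prodcommM; apply: prodcommJ => //.
rewrite -[u^-1](conjgK q) -conjgM conjVg.
exact: prodcomm_conj_div.
Qed.

Fixpoint conjprod gs g : Prop :=
  if gs is x :: gs' then exists h g', conjprod gs' g' /\ g = x ^ h * g'
  else g = 1.

Lemma conjprod_cat gs1 gs2 g1 g2 :
  conjprod gs1 g1 -> conjprod gs2 g2 -> conjprod (gs1 ++ gs2) (g1 * g2).
Proof.
elim: gs1 g1 => [|x gs1 IH] g1 /=; first by move=> -> c2; rewrite mul1g.
case=> h [g' [cg' ->]] c2; exists h, (g' * g2).
by rewrite -mulgA; split; last by []; apply: IH.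
Qed.

Lemma conjprod_catP gs1 gs2 g : conjprod (gs1 ++ gs2) g ->
  exists g1 g2, [/\ conjprod gs1 g1, conjprod gs2 g2 & g = g1 * g2].
Proof.
elim: gs1 g => [|x gs1 IH] g /=; first by exists 1, g; rewrite mul1g.
case=> h [g' [/IH[g1 [g2 [c1 c2 ->]]] ->]].
by exists (x ^ h * g1), g2; split; rewrite ?mulgA //; exists h, g1.
Qed.

(** Carrying a factor past [g1] conjugates it by [g1], and the conjugators are free; so the order of
    a chain does not matter. *)
Lemma conjprod_perm gs1 gs2 g :
  perm_eq gs1 gs2 -> conjprod gs1 g -> conjprod gs2 g.
Proof.
elim: gs1 gs2 g => [|x gs1 IH] gs2 g.
  by rewrite perm_sym; move/seq.perm_nilP=> -> c.
move=> pe /= [h [g' [cg' ->]]].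
have x2 : x \in gs2 by rewrite -(perm_mem pe) mem_head.
case/path.splitPr: x2 pe => p1 p2 pe.
have {}pe : perm_eq gs1 (p1 ++ p2).
  by rewrite -(perm_cons x) (perm_trans pe) // perm_catC /= perm_cons perm_catC.
have [g1 [g2 [c1 c2 ->]]] := conjprod_catP (IH _ _ pe cg').
have -> : x ^ h * (g1 * g2) = g1 * (x ^ (h * g1) * g2) by rewrite !gsimp.
apply: conjprod_cat => //=; by exists (h * g1), g2.
Qed.

(* [ccl k gs] says that [cl_chain gs <= k]. *)
Definition ccl k gs := exists2 g, conjprod gs g & prodcomm k g.

Lemma ccl0 : ccl 0 [::].
Proof. by exists 1 => //; apply: prodcomm0. Qed.

Lemma ccl_perm k gs1 gs2 : perm_eq gs1 gs2 -> ccl k gs1 -> ccl k gs2.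
Proof. by move=> pe [g cg pg]; exists g => //; apply: conjprod_perm cg. Qed.

Lemma ccl_conj k x h gs : ccl k (x :: gs) -> ccl k (x ^ h :: gs).
Proof.
case=> g [u [g' [cg' ->]]] pg; exists (x ^ u * g') => //.
by exists (h^-1 * u), g'; split; rewrite // -conjgM mulVKg.
Qed.

Lemma ccl_split k x y gs : ccl k (x * y :: gs) -> ccl k (x :: y :: gs).
Proof.
case=> g [u [g' [cg' ->]]] pg; exists ((x * y) ^ u * g') => //.
exists u, (y ^ u * g'); split; first by exists u, g'.
by rewrite conjMg -mulgA.
Qed.

(** Merging needs equal conjugators, and replacing [y ^ v] by [y ^ u] costs one commutator.
    Splitting is free, since both pieces may keep the same conjugator. *)
Lemma ccl_merge k x y gs : ccl k (x :: y :: gs) -> ccl k.+1 (x * y :: gs).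
Proof.
case=> g [u [_ [[v [g' [cg' ->]]] ->]]] pg.
exists ((x * y) ^ u * g'); first by exists u, g'.
have -> : (x * y) ^ u * g' =
   (x ^ u * (y ^ v * g')) * (((y ^ v)^-1 * (y ^ v) ^ (v^-1 * u)) ^ g')^-1^-1.
  by rewrite !gsimp.
rewrite -addn1; apply: prodcommM => //; rewrite invgK; apply: prodcommJ.
exact: prodcomm_conjV.
Qed.

Lemma ccl_one k gs : ccl k (1 :: gs) <-> ccl k gs.
Proof.
split=> [[g [u [g' [cg' ->]]]]|[g cg pg]].
  by rewrite conj1g mul1g => pg; exists g'.
by exists g => //; exists 1, g; rewrite conj1g mul1g.
Qed.

Lemma ccl_inv k x gs : ccl k gs -> ccl k (x :: x^-1 :: gs).
Proof. by move=> c; apply: ccl_split; rewrite mulgV; apply/ccl_one. Qed.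

Lemma ccl_mulr k j x z gs : prodcomm j z -> ccl k (x :: gs) -> ccl (k + j) (x * z :: gs).
Proof.
move=> pz [g [u [g' [cg' ->]]]] pg; exists ((x * z) ^ u * g').
  by exists u, g'.
have -> : (x * z) ^ u * g' = (x ^ u * g') * (z ^ (u * g')) by rewrite !gsimp.
by apply: prodcommM => //; apply: prodcommJ.
Qed.

(** Here [(x * y) ^+ n = x ^+ n * A * y ^+ n] with [A] from [prodcomm_expM]; its [n / 2] commutators
    are the half unit of [scl] that a pair of pants costs. *)
Lemma ccl_expM k n x y gs :
  ccl k ((x * y) ^+ n :: gs) -> ccl (k + n./2) (x ^+ n :: y ^+ n :: gs).
Proof.
case: (prodcomm_expM n x y) => [pA _] c.
set A := x ^- n * _ * _ in pA.
have [s sz eA] : prodcomm n./2 (A ^ (y ^+ n)) by apply: prodcommJ.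
have pA' : prodcomm n./2 (A ^ (y ^+ n))^-1.
  exists (rev [seq (p.2, p.1) | p <- s]); first by rewrite size_rev size_map.
  rewrite eA -{1}(revK s) -prodgV -map_rev big_map.
  by apply: eq_bigr => p _; rewrite invgR.
apply: ccl_split.
have -> : x ^+ n * y ^+ n = (x * y) ^+ n * (A ^ (y ^+ n))^-1.
  by rewrite /A !gsimp.
exact: ccl_mulr.
Qed.

Lemma ccl_expM_merge k n x y gs :
  ccl k (x ^+ n :: y ^+ n :: gs) -> ccl (k + n./2).+1 ((x * y) ^+ n :: gs).
Proof.
case: (prodcomm_expM n x y) => [pA _] c.
set A := x ^- n * _ * _ in pA.
have -> : (x * y) ^+ n = x ^+ n * y ^+ n * (A ^ (y ^+ n)).
  by rewrite /A !gsimp.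
rewrite -addSn; apply: ccl_mulr; [exact: prodcommJ | exact: ccl_merge].
Qed.

(* [chi_bound gs m] gives [scl gs <= m / 2], with a bounded error term at every
   power. *)
Definition chi_bound gs m := exists K, forall n, exists2 k,
  ccl k [seq g ^+ n | g <- gs] & (k.*2 <= n * m + K)%N.

Lemma chi_bound0 : chi_bound [::] 0.
Proof. by exists 0%N => n; exists 0%N => //; apply: ccl0. Qed.

Lemma chi_bound_perm gs1 gs2 m :
  perm_eq gs1 gs2 -> chi_bound gs1 m -> chi_bound gs2 m.
Proof.
move=> pe [K b]; exists K => n; have [k ck kb] := b n; exists k => //.
by apply: ccl_perm ck; apply: perm_map.
Qed.

Lemma chi_bound_conj x h gs m :
  chi_bound (x :: gs) m -> chi_bound (x ^ h :: gs) m.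
Proof.
move=> [K b]; exists K => n; have [k ck kb] := b n; exists k => //=.
by rewrite -conjXg; apply: ccl_conj.
Qed.

Lemma chi_bound_one gs m : chi_bound (1 :: gs) m <-> chi_bound gs m.
Proof.
by split=> [[K b]|[K b]]; exists K => n; have [k ck kb] := b n; exists k => //;
   move: ck; rewrite /= expg1n ccl_one.
Qed.

Lemma chi_bound_inv x gs m : chi_bound gs m -> chi_bound (x :: x^-1 :: gs) m.
Proof.
move=> [K b]; exists K => n; have [k ck kb] := b n; exists k => //=.
by rewrite expVgn; apply: ccl_inv.
Qed.

Lemma chi_bound_split x y gs m :
  chi_bound (x * y :: gs) m -> chi_bound (x :: y :: gs) m.+1.
Proof.
move=> [K b]; exists K => n; have [k ck kb] := b n; exists (k + n./2)%N.
  exact: ccl_expM.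
by rewrite doubleD mulnS; lia.
Qed.

Lemma chi_bound_merge x y gs m :
  chi_bound (x :: y :: gs) m -> chi_bound (x * y :: gs) m.+1.
Proof.
(* The one extra commutator of a merge does not depend on [n]; it enters doubled. *)
move=> [K b]; exists K.+2 => n; have [k ck kb] := b n.
exists (k + n./2).+1; first exact: ccl_expM_merge.
by rewrite doubleS doubleD mulnS; lia.
Qed.

End CommutatorLength.

(** * Moves on fatgraphs *)

Lemma fpath_agree (T : eqType) (f g : T -> T) a X :
  path (frel f) a X -> (forall x, x \in a :: X -> f x \in X -> g x = f x) ->
  path (frel g) a X.
Proof.
elim: X a => //= b X IH a /andP[/eqP fab pX] agr.
have -> : g a == b by rewrite agr ?fab ?mem_head.
apply: IH => // x xX fx; apply: agr; rewrite inE ?xX ?fx orbT //.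
Qed.

(** Rotating [w] so that [d] comes first reduces the claim to dropping the head of a cycle. *)
Lemma fcycle_skip (T : eqType) (f g : T -> T) d w :
  uniq w -> fcycle f w ->
  (forall x, x \in w -> x != d -> g x = if f x == d then f d else f x) ->
  fcycle g [seq x <- w | x != d].
Proof.
move=> uw cw agr; have [dw|dw] := boolP (d \in w); last first.
  have -> : [seq x <- w | x != d] = w.
    by apply/all_filterP/allP => x xw; apply: contraNneq dw => <-.
  case: w uw cw agr dw => //= a w uw cw agr dw.
  apply: fpath_agree cw _ => x xw fxw; rewrite agr ?ifN //.
  - by apply: contraNneq dw => <-; move: fxw; rewrite mem_rcons.
  - by move: xw; rewrite inE mem_rcons orbA orbb.
  - by apply: contraNneq dw => <-; move: xw; rewrite inE mem_rcons orbA orbb.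
case/rot_to: dw => i X wX.
(* This is the rotation of the filtered word that starts where [d] was. *)
rewrite -(@rot_cycle (count (fun x => x != d) (take i w)) T).
have -> : rot (count (fun x => x != d) (take i w)) [seq x <- w | x != d] =
          [seq x <- rot i w | x != d].
  by rewrite -{2}(cat_take_drop i w) /rot !filter_cat -size_filter
       drop_size_cat ?take_size_cat.
have {}cw : fcycle f (d :: X) by rewrite -wX rot_cycle.
have {}uw : uniq (d :: X) by rewrite -wX rot_uniq.
have {}agr x : x \in d :: X -> x != d -> g x = if f x == d then f d else f x.
  by rewrite -wX mem_rot; apply: agr.
rewrite wX /= eqxx /=; case/andP: uw => dX uX.
have -> : [seq x <- X | x != d] = X.
  by apply/all_filterP/allP => x xw; apply: contraNneq dX => <-.
case: X dX uX cw agr {wX} => //= a X daX uX /andP[/eqP fd].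
rewrite rcons_path => /andP[pX /eqP fl] agr; rewrite rcons_path.
have xd x : x \in a :: X -> x != d by apply: contraTneq => ->.
apply/andP; split.
  apply: fpath_agree pX _ => x xX fx; rewrite agr ?xd ?ifN //.
    by apply: xd; rewrite inE fx orbT.
  by rewrite inE xX orbT.
rewrite /= agr ?fl ?eqxx ?fd ?inE ?mem_last ?orbT //.
  by move: (mem_last a X); rewrite inE => ->; rewrite orbT.
by apply: xd; apply: mem_last.
Qed.

Section Skip.
Variable T : finType.
Implicit Types (s : {perm T}) (x y d : T).

(** Takes [d] out of its cycle: its predecessor is sent to [s d], and [d] becomes a fixed point. *)
Definition skip s d : {perm T} := (s * tperm d (s d))%g.

Lemma skipE s d x :
  skip s d x = if x == d then d else if s x == d then s d else s x.
Proof.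
rewrite /skip permM; have [->|xd] := eqVneq x d; first by rewrite tpermR.
have [->|sxd] := eqVneq (s x) d; first by rewrite tpermL.
by rewrite tpermD // eq_sym // (inj_eq perm_inj).
Qed.

Lemma card_porbits_mulr_tperm s x y :
  (#|porbits (s * tperm x y)%g| + (x \notin porbit s y).*2 = #|porbits s| + (x != y))%N.
Proof.
have := porbits_mul_tperm s^-1 x y; rewrite /= porbitsV porbitV => <-.
by rewrite -porbitsV invMg tpermV.
Qed.

Lemma card_porbits_skip s d : #|porbits (skip s d)| = (#|porbits s| + (s d != d))%N.
Proof.
have := card_porbits_mulr_tperm s d (s d).
by have := mem_porbit s 1 d; rewrite expg1 porbit_sym => -> /=; rewrite addn0 eq_sym.
Qed.

Lemma porbit_sub s (S : seq T) x :
  x \in S -> {in S, forall y, s y \in S} -> {subset porbit s x <= S}.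
Proof.
move=> xS sS y /porbitP[i ->]; elim: i => [|i IH]; first by rewrite expg0 perm1.
by rewrite expgSr permM; apply: sS.
Qed.

End Skip.

Lemma chi_bound_conj_map (G : groupType) (I : eqType) (p q : I -> G) (L : seq I) m :
  {in L, forall w, exists h, p w = (q w ^ h)%g} ->
  chi_bound (map q L) m -> chi_bound (map p L) m.
Proof.
suff H gs : {in L, forall w, exists h, p w = (q w ^ h)%g} ->
   chi_bound (map q L ++ gs) m -> chi_bound (map p L ++ gs) m.
  by move=> pq; have := H [::] pq; rewrite !cats0.
elim: L gs => //= w L IH gs pq b.
have [h ->] := pq w (mem_head _ _).
have : chi_bound (map p L ++ (q w ^ h)%g :: gs) m.
  apply: IH => [u uL|]; first by apply: pq; rewrite inE uL orbT.
  apply: (chi_bound_perm (gs1 := (q w ^ h)%g :: (map q L ++ gs))).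
    by rewrite -cat1s -[in X in perm_eq _ X]cat1s perm_catCA.
  exact: chi_bound_conj.
by apply: chi_bound_perm; rewrite -cat1s perm_catCA.
Qed.

Lemma fcycle_agree (T : eqType) (f g : T -> T) w :
  fcycle f w -> (forall x, x \in w -> f x \in w -> g x = f x) -> fcycle g w.
Proof.
case: w => //= a w cw agr; apply: fpath_agree cw _ => x.
by rewrite inE !mem_rcons inE orbA orbb => xw fx; apply: agr; rewrite inE.
Qed.

Section Surface.
Variables (G : groupType) (T : finType) (e : T -> T).
Hypotheses (eK : involutive e) (e_neq : forall x, e x != x).
Implicit Types (v : {perm T}) (L : seq (seq T)) (l : T -> G) (D w : seq T).

Definition wprod l w : G := (\prod_(x <- w) l x)%g.

(* [D] is the set of darts that are still present; deleted darts become fixed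
   points of the rotation [v] around the vertices. *)
Record live_darts v D : Prop := LiveDarts {
  live_uniq : uniq D;
  live_rev : {in D, forall x, e x \in D};
  live_out : forall x, x \notin D -> v x = x;
  live_in : {in D, forall x, v x != x} }.

Let eE x y : (e x == y) = (x == e y).
Proof. by rewrite -{2}(eK x) (inj_eq (inv_inj eK)). Qed.

(** What survives rotating boundary words and reordering their list: the darts, the property of
    being cycles of [f], and the estimate, which is pulled back from [L2] to [L1]. *)
Definition regroup f L1 L2 :=
  [/\ perm_eq (flatten L1) (flatten L2),
     {in L1, forall w, fcycle f w} -> {in L2, forall w, fcycle f w} &
     forall l gs m, chi_bound (map (wprod l) L2 ++ gs) m ->
                    chi_bound (map (wprod l) L1 ++ gs) m].

Lemma regroup_trans f L1 L2 L3 : regroup f L1 L2 -> regroup f L2 L3 -> regroup f L1 L3.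
Proof.
case=> p12 c12 b12 [p23 c23 b23]; split; first exact: perm_trans p23.
  by move=> /c12/c23.
by move=> l gs m /b23/b12.
Qed.

Lemma regroup_cons f w L1 L2 : regroup f L1 L2 -> regroup f (w :: L1) (w :: L2).
Proof.
case=> p12 c12 b12; split; first by rewrite /= perm_cat2l.
  move=> c u; rewrite inE => /predU1P[->|]; first by apply: c; rewrite mem_head.
  by apply: c12 => z zL; apply: c; rewrite inE zL orbT.
move=> l gs m b /=.
apply: (chi_bound_perm (gs1 := map (wprod l) L1 ++ wprod l w :: gs)).
  by rewrite -cat1s perm_catCA.
apply: b12; apply: chi_bound_perm b.
by rewrite /= -cat1s perm_catCA.
Qed.

Lemma wprod_rot l i w : exists h, wprod l w = (wprod l (rot i w) ^ h)%g.
Proof.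
exists (wprod l (take i w))^-1%g; rewrite -{1}(cat_take_drop i w) /rot /wprod !big_cat.
by rewrite conjgE invgK !mulgA mulgK.
Qed.

Lemma regroup_pick f L d : d \in flatten L ->
  exists X L', regroup f L ((d :: X) :: L').
Proof.
case/flattenP => w wL dw; case/path.splitPr: wL => p1 p2.
case/rot_to: dw => i X wX; exists X, (p1 ++ p2); split.
- by rewrite /= !flatten_cat /= perm_catCA -cat_cons perm_cat2r -wX perm_sym perm_rot.
- move=> c u; rewrite inE => /predU1P[->|].
    by rewrite -wX rot_cycle; apply: c; rewrite mem_cat mem_head orbT.
  by rewrite mem_cat => /orP[] uL; apply: c; rewrite mem_cat ?inE uL ?orbT.
move=> l gs m b.
apply: (chi_bound_perm (gs1 := wprod l w :: map (wprod l) (p1 ++ p2) ++ gs)).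
  by rewrite !map_cat /= -!catA /= perm_sym -cat1s perm_catCA.
have [h ->] := wprod_rot l i w; apply: chi_bound_conj.
by rewrite wX.
Qed.

Definition del v d := skip (skip v d) (e d).

Lemma delE v d x : x != d -> x != e d -> v d != e d -> v d != d ->
  del v d x = if v x == d then v d else
              if v x == e d then if v (e d) == d then v d else v (e d)
              else v x.
Proof.
move=> xd xed vd vdd; rewrite /del !skipE (negbTE xd) (negbTE xed) /=.
rewrite (negbTE (e_neq d)); case: (v x =P d) => [vx|_] //.
by rewrite (negbTE vd).
Qed.

Lemma del_id v d : del v d d = d /\ del v d (e d) = e d.
Proof.
rewrite /del !skipE !eqxx eq_sym (negbTE (e_neq d)).
by split=> //; case: eqP.
Qed.

Lemma del_notin v d x : x != d -> x != e d -> v x != d -> v x != e d ->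
  del v d x = v x.
Proof.
move=> xd xed vd vdd; rewrite /del !skipE (negbTE xd) (negbTE xed) /=.
by rewrite (negbTE vd) (negbTE vdd).
Qed.

(** When all edges are loops, deleting one isolates no other dart: if [x] were left alone, its old
    orbit would lie in [{x, d, e d}] and miss [e x]. *)
Lemma live_del v D d D' : live_darts v D -> perm_eq D (d :: e d :: D') ->
  {in D, forall x, e x \in porbit v x} -> live_darts (del v d) D'.
Proof.
case=> uD eD oD nD pD loop.
have := uD; rewrite (perm_uniq pD) /= inE negb_or -andbA => /and4P[_ dD' edD' uD'].
have xD x : x \in D' -> [/\ x \in D, x != d & x != e d].
  move=> xD'; rewrite (perm_mem pD) !inE xD' !orbT; split=> //.
    by apply: contraNneq dD' => <-.
  by apply: contraNneq edD' => <-.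
split=> //.
- move=> x /xD[xin xd xed]; have := eD _ xin.
  by rewrite (perm_mem pD) !inE !eE eK (negbTE xd) (negbTE xed).
- move=> x xD'; have [->|xd] := eqVneq x d; first exact: (del_id v d).1.
  have [->|xed] := eqVneq x (e d); first exact: (del_id v d).2.
  have vx : v x = x.
    by apply: oD; rewrite (perm_mem pD) !inE negb_or xd negb_or xed.
  by rewrite del_notin ?vx.
move=> x /xD[xin xd xed]; apply/eqP => dx.
have closed (S : seq T) : x \in S -> {in S, forall y, v y \in S} ->
    {subset S <= [:: x; d; e d]} -> False.
  move=> xS vS SS; have := SS _ (porbit_sub xS vS (loop _ xin)).
  by rewrite !inE !eE eK (negbTE xd) (negbTE xed) !orbF -eE (negbTE (e_neq x)).
have [vxd|vxd] := eqVneq (v x) d.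
  have [vd|vd] := eqVneq (v d) (e d).
    apply: (closed [:: x; d; e d]); rewrite ?mem_head //.
    move: dx; rewrite /del !skipE (negbTE xd) (negbTE xed) /= (negbTE (e_neq d)).
    rewrite vxd eqxx vd eqxx; case: eqP => [ved|_].
      by move/eqP: xed; case; apply: (@perm_inj _ v); rewrite vxd ved.
    move=> ved y; rewrite !inE => /or3P[]/eqP->; rewrite ?vxd ?vd ?ved eqxx ?orbT //.
  have vdd : v d != d by apply: nD; rewrite (perm_mem pD) mem_head.
  move: dx; rewrite delE // vxd eqxx => dx.
  apply: (closed [:: x; d]); rewrite ?mem_head //.
    by move=> y; rewrite !inE => /orP[]/eqP->; rewrite ?vxd ?dx eqxx ?orbT.
  by move=> y; rewrite !inE => /orP[] ->; rewrite ?orbT.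
have [vxed|vxed] := eqVneq (v x) (e d); last first.
  by move: dx; rewrite del_notin // => /eqP; apply/negP; apply: nD.
move: dx; rewrite /del !skipE (negbTE xd) (negbTE xed) (negbTE vxd) vxed eqxx.
rewrite (negbTE (e_neq d)); case: eqP => [ved|_] dx.
  apply: (closed [:: x; d; e d]); rewrite ?mem_head //.
  by move=> y; rewrite !inE => /or3P[]/eqP->; rewrite ?vxed ?dx ?ved eqxx ?orbT.
apply: (closed [:: x; e d]); rewrite ?mem_head //.
  by move=> y; rewrite !inE => /orP[]/eqP->; rewrite ?vxed ?dx eqxx ?orbT.
by move=> y; rewrite !inE => /orP[] ->; rewrite ?orbT.
Qed.

Lemma fcycle_del v d w : d \notin w -> e d \notin w ->
  fcycle (e \o v) w -> fcycle (e \o del v d) w.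
Proof.
move=> dw edw; move/fcycle_agree; apply=> x xw fxw /=; congr e; apply: del_notin.
- by apply: contraNneq dw => <-.
- by apply: contraNneq edw => <-.
- by apply: contraNneq edw => <-.
- by apply: contraNneq dw => vx; rewrite -[d]eK -vx.
Qed.

(** The transposition joins the cycles of the two end vertices; cutting out both darts leaves the
    vertex of the contracted edge. *)
Definition contract v d : {perm T} := skip (skip (v * tperm d (e d))%g d) (e d).

Section Contract.
Variables (v : {perm T}) (d : T).
Hypotheses (vd : v d != d) (ved : v (e d) != e d) (nonloop : e d \notin porbit v d).

Let vded : v d != e d.
Proof.
by apply: contraNneq nonloop => <-; have := mem_porbit v 1 d; rewrite expg1.
Qed.

Let vedd : v (e d) != d.
Proof.
apply: contraNneq nonloop => {2}<-; rewrite porbit_sym.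
by have := mem_porbit v 1 (e d); rewrite expg1.
Qed.

Let tvd : tperm d (e d) (v d) = v d.
Proof. by rewrite tpermD // eq_sym. Qed.

Let tved : tperm d (e d) (v (e d)) = v (e d).
Proof. by rewrite tpermD // eq_sym. Qed.

Lemma contract_id : contract v d d = d /\ contract v d (e d) = e d.
Proof.
rewrite /contract !skipE !eqxx eq_sym (negbTE (e_neq d)).
by split=> //; case: eqP.
Qed.

Lemma contractE x : x != d -> x != e d ->
  contract v d x = if v x == d then v (e d) else if v x == e d then v d else v x.
Proof.
move=> xd xed; rewrite /contract !skipE (negbTE xd) (negbTE xed) !permM.
rewrite (negbTE (e_neq d)).
rewrite tvd tved (negbTE vedd).
case: tpermP => [->|->|/eqP vx /eqP vx'].
- by rewrite (negbTE (e_neq d)) !eqxx.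
- by rewrite !eqxx (negbTE vded) (negbTE (e_neq d)).
- by rewrite (negbTE vx) (negbTE vx').
Qed.

(** Two vertices merge, but two darts become fixed points. *)
Lemma card_porbits_contract : #|porbits (contract v d)| = #|porbits v|.+1.
Proof.
rewrite /contract !card_porbits_skip skipE !permM (negbTE (e_neq d)).
rewrite tvd tved vd (negbTE vedd) ved.
have := card_porbits_mulr_tperm v d (e d).
by rewrite porbit_sym nonloop (eq_sym d) e_neq; lia.
Qed.

Lemma live_contract D D' : live_darts v D -> perm_eq D (d :: e d :: D') ->
  live_darts (contract v d) D'.
Proof.
case=> uD eD oD nD pD.
have := uD; rewrite (perm_uniq pD) /= inE negb_or -andbA => /and4P[_ dD' edD' uD'].
have xD x : x \in D' -> [/\ x \in D, x != d & x != e d].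
  move=> xD'; rewrite (perm_mem pD) !inE xD' !orbT; split=> //.
    by apply: contraNneq dD' => <-.
  by apply: contraNneq edD' => <-.
split=> //.
- move=> x /xD[xin xd xed]; have := eD _ xin.
  by rewrite (perm_mem pD) !inE !eE eK (negbTE xd) (negbTE xed).
- move=> x xD'; have [->|xd] := eqVneq x d; first exact: contract_id.1.
  have [->|xed] := eqVneq x (e d); first exact: contract_id.2.
  have vx : v x = x.
    by apply: oD; rewrite (perm_mem pD) !inE negb_or xd negb_or xed.
  by rewrite contractE // vx (negbTE xd) (negbTE xed).
move=> x /xD[xin xd xed]; rewrite contractE //.
have [vx|vx] := eqVneq (v x) d.
  apply: contraNneq nonloop => vx'; rewrite porbit_sym.
  by have := mem_porbit v 2 (e d); rewrite expgS expg1 permM vx' vx.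
have [vx'|vx'] := eqVneq (v x) (e d); last exact: nD.
apply: contraNneq nonloop => vx''.
by have := mem_porbit v 2 d; rewrite expgS expg1 permM vx'' vx'.
Qed.

Lemma fcycle_contract w : uniq w -> fcycle (e \o v) w ->
  fcycle (e \o contract v d) [seq x <- [seq x <- w | x != d] | x != e d].
Proof.
move=> uw cw.
pose f1 x := if e (v x) == d then e (v d) else e (v x).
apply: (@fcycle_skip _ f1); first exact: filter_uniq.
  exact: fcycle_skip cw _.
move=> x; rewrite mem_filter => /andP[xd _] xed /=; rewrite contractE // /f1.
rewrite !eE (negbTE ved); case: (v x =P e d) => [->|_].
  by rewrite (negbTE (e_neq d)) (inj_eq (inv_inj eK)) (negbTE vd).
by rewrite (inj_eq (inv_inj eK)); case: eqP.
Qed.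

End Contract.

Lemma flatten_uniq L w : uniq (flatten L) -> w \in L -> uniq w.
Proof.
move=> uL wL; case/path.splitPr: wL uL => p1 p2.
by rewrite flatten_cat /= !cat_uniq => /and4P[_ _ -> _].
Qed.

Lemma wprod_filter l (P : pred T) w :
  (forall x, ~~ P x -> l x = 1%g) -> wprod l [seq x <- w | P x] = wprod l w.
Proof.
move=> P1; rewrite /wprod big_filter big_mkcond; apply: eq_bigr => x _.
by case: ifPn => // /P1.
Qed.

Lemma card_porbits_del v d : v d != d ->
  #|porbits (del v d)| =
    (#|porbits v| + 1 + ((if v (e d) == d then v d else v (e d)) != e d))%N.
Proof.
by move=> vd; rewrite /del !card_porbits_skip vd skipE (negbTE (e_neq d)).
Qed.

(* Gauge transformation by [l d] at the end vertex of [d]. *)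
Lemma gauge v d L l : {in L, forall w, fcycle (e \o v) w} ->
  (forall x, l (e x) = (l x)^-1%g) -> e d \notin porbit v d ->
  exists l', [/\ forall x, l' (e x) = (l' x)^-1%g, l' d = 1%g &
    {in L, forall w, exists h, wprod l w = (wprod l' w ^ h)%g}].
Proof.
move=> cyc lV nonloop; pose h x := if x \in porbit v d then l d else 1%g.
have hv x : h (v x) = h x.
  rewrite /h ![_ \in porbit v d]porbit_sym.
  by have := porbit_perm v 1 x; rewrite expg1 => ->.
exists (fun x => h (e x) * l x * (h x)^-1)%g; split.
- by move=> x; rewrite eK lV !invMg invgK mulgA.
- by rewrite /h (negbTE nonloop) porbit_id mul1g mulgV.
case=> [|a w] wL; first by exists 1%g; rewrite /wprod !big_nil conj1g.
have := cyc _ wL; rewrite /cycle => cw.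
have tel X b : path (frel (e \o v)) b X ->
    wprod (fun x => h (e x) * l x * (h x)^-1)%g X =
    (h b * wprod l X * (h (last b X))^-1)%g.
  elim: X b => [|c X IHX] b /=; first by rewrite /wprod !big_nil mulg1 mulgV.
  case/andP=> /eqP bc pX; have := IHX c pX; rewrite /wprod !big_cons => ->.
  by rewrite -bc /= eK hv !mulgA mulgVK.
have {}tel := tel _ _ cw; rewrite last_rcons in tel.
rewrite -!cats1 in tel.
have [h1 ->] := wprod_rot l 1 (a :: w); rewrite rot1_cons -cats1.
have [h2 ->] := wprod_rot (fun x => h (e x) * l x * (h x)^-1)%g 1 (a :: w).
rewrite rot1_cons -cats1 tel.
exists (h2^-1 * h a * h1)%g.
by rewrite !conjgM conjgK; congr (_ ^ h1)%g; rewrite conjgE !mulgA mulVg mul1g mulgVK.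
Qed.

Lemma fpath_del v d b c Y : path (frel (e \o v)) b (rcons Y c) ->
  d \notin Y -> e d \notin Y ->
  (Y = [::] /\ e (v b) = c) \/
  exists y Y', [/\ Y = y :: Y', y = e (v b), path (frel (e \o del v d)) y Y' &
                   e (v (last y Y')) = c].
Proof.
case: Y => [|y Y] /=; first by rewrite andbT => /eqP; left.
case/andP=> /eqP <-; rewrite rcons_path => /andP[pY /eqP lY] dY edY.
right; exists (e (v b)), Y; split=> //; apply: fpath_agree pY _ => x xY fxY /=.
have fY : e (v x) \in e (v b) :: Y by rewrite inE fxY orbT.
congr e; apply: del_notin.
- by apply: contraNneq dY => <-.
- by apply: contraNneq edY => <-.
- by apply: contraNneq edY => <-.
- by apply: contraNneq dY => vx; rewrite -[d]eK -vx.
Qed.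

Section DelWords.
Variables (v : {perm T}) (d : T).
Hypotheses (vd : v d != d) (vded : v d != e d).

Lemma e_del_rev x : x != d -> x != e d -> e (v x) = e d -> e (del v d x) = e (v d).
Proof. by move=> xd xed /(inv_inj eK) vx; rewrite delE // vx eqxx. Qed.

Lemma e_del x : x != d -> x != e d -> e (v x) = d ->
  e (del v d x) = if e (v (e d)) == e d then e (v d) else e (v (e d)).
Proof.
move=> xd xed vx; have {}vx : v x = e d by rewrite -vx eK.
rewrite delE // vx (negbTE (e_neq d)) eqxx (inj_eq (inv_inj eK)).
by case: ifP.
Qed.

(** When both sides of the edge lie on one boundary word [d Y (e d) Z], deletion breaks it into [Y]
    and [Z]. *)
Lemma fcycle_del_split1 Y : path (frel (e \o v)) d (rcons Y (e d)) ->
  d \notin Y -> e d \notin Y -> fcycle (e \o del v d) Y.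
Proof.
move=> pY dY edY; have [[-> //]|[y [Y' [eY ey pY' lY']]]] := fpath_del pY dY edY.
rewrite eY /= rcons_path pY' /= e_del_rev ?lY' -?ey ?eqxx //.
  by apply: contraNneq dY => <-; rewrite eY mem_last.
by apply: contraNneq edY => <-; rewrite eY mem_last.
Qed.

Lemma fcycle_del_split2 Z : path (frel (e \o v)) (e d) (rcons Z d) ->
  d \notin Z -> e d \notin Z -> fcycle (e \o del v d) Z.
Proof.
move=> pY dY edY; have [[-> //]|[y [Y' [eY ey pY' lY']]]] := fpath_del pY dY edY.
rewrite eY /= rcons_path pY' /= e_del ?lY' //.
- rewrite -ey ifN // eq_sym; apply: contraNneq edY => ->.
  by rewrite eY mem_head.
- by apply: contraNneq dY => <-; rewrite eY mem_last.
- by apply: contraNneq edY => <-; rewrite eY mem_last.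
Qed.

(** When its sides lie on two boundary words, deletion joins them into one. *)
Lemma fcycle_del_merge X Y : path (frel (e \o v)) d (rcons X d) ->
  path (frel (e \o v)) (e d) (rcons Y (e d)) ->
  d \notin X -> e d \notin X -> d \notin Y -> e d \notin Y ->
  fcycle (e \o del v d) (X ++ Y).
Proof.
move=> pX pY dX edX dY edY.
have [[_ /eqP]|[x [X' [eX ex pX' lX']]]] := fpath_del pX dX edX.
  by rewrite eE (negbTE vded).
have lx : e (del v d (last x X')) =
    if e (v (e d)) == e d then e (v d) else e (v (e d)).
  apply: e_del => //.
  - by apply: contraNneq dX => <-; rewrite eX mem_last.
  - by apply: contraNneq edX => <-; rewrite eX mem_last.
have [[-> ey]|[y [Y' [eY ey pY' lY']]]] := fpath_del pY dY edY.
  by rewrite cats0 eX /= rcons_path pX' /= lx ey eqxx ex.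
rewrite eX eY /= rcons_path cat_path pX' /= lx last_cat /= pY' andbT.
rewrite -ey ifN ?eqxx /=; last first.
  by rewrite eq_sym; apply: contraNneq edY => ->; rewrite eY mem_head.
rewrite e_del_rev ?lY' -?ex ?eqxx //.
- by apply: contraNneq dY => <-; rewrite eY mem_last.
- by apply: contraNneq edY => <-; rewrite eY mem_last.
Qed.

End DelWords.

(** Each dead dart is an orbit of its own, so the equation says that [m] is minus the Euler
    characteristic of the live graph. The induction is on the number of live darts. *)
Lemma surface_chi_bound k v L l :
  (size (flatten L) <= k)%N -> live_darts v (flatten L) ->
  {in L, forall w, fcycle (e \o v) w} -> (forall x, l (e x) = (l x)^-1%g) ->
  exists2 m, chi_bound (map (wprod l) L) m &
    (2 * m + 2 * #|porbits v| + size (flatten L) = 2 * #|T|)%N.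
Proof.
elim: k v L l => [|k IH] v L l szL live cyc lV.
  have sz0 : size (flatten L) = 0%N by lia.
  have L0 := size0nil sz0; exists 0%N.
    elim: L {szL live cyc sz0} L0 => [|w L IHL]; first by move=> _; apply: chi_bound0.
    by case: w => //= L0; rewrite /wprod big_nil; apply/chi_bound_one/IHL.
  rewrite sz0 muln0 add0n addn0; congr (2 * _)%N.
  have v1 x : v x = x by apply: (live_out live); rewrite L0.
  rewrite /porbits card_imset // => x y exy.
  have : y \in porbit v x by rewrite exy porbit_id.
  by case/porbitP=> i ->; rewrite permX; elim: i => //= i <-.
(* An edge between distinct vertices is contracted. The gauge makes its label trivial, so boundary
   words change only by conjugation and [m] is kept. *)
have [[d [dL nonloop]]|loops] :=
    pselect (exists d, d \in flatten L /\ e d \notin porbit v d).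
  have edL : e d \in flatten L by apply: (live_rev live).
  have vd := live_in live dL; have ved := live_in live edL.
  have [l' [l'V l'd l'w]] := gauge cyc lV nonloop.
  pose fl (w : seq T) := [seq x <- [seq x <- w | x != d] | x != e d].
  have uL := live_uniq live.
  have pL : perm_eq (flatten L) (d :: e d :: flatten (map fl L)).
    have -> : flatten (map fl L) = fl (flatten L).
      by rewrite /fl !filter_flatten -map_comp.
    rewrite (perm_trans (perm_to_rem dL)) // perm_cons /fl -[[seq x <- _ | x != d]]rem_filter //.
    rewrite -[[seq x <- _ | x != e d]]rem_filter ?rem_uniq //.
    by apply: perm_to_rem; rewrite rem_filter // mem_filter /= edL e_neq.
  have sz := perm_size pL; rewrite /= in sz.
  have [] := IH (contract v d) (map fl L) l' _ (live_contract vd ved nonloop live pL).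
  - by move: szL; rewrite sz ltnS => /ltnW.
  - move=> _ /mapP[w wL ->]; apply: fcycle_contract => //; last exact: cyc.
    exact: flatten_uniq uL wL.
  - exact: l'V.
  rewrite card_porbits_contract // => m bm eqm; exists m; last by rewrite sz -eqm; move: (size _) #|porbits v| => a b; lia.
  apply: chi_bound_conj_map l'w _.
  have : map (wprod l') (map fl L) = map (wprod l') L.
    rewrite -map_comp; apply: eq_map => w /=.
    rewrite /fl !wprod_filter // => x; rewrite negbK => /eqP->//.
    by rewrite l'V l'd invg1.
  by move=> <-.
have {}loops : {in flatten L, forall x, e x \in porbit v x}.
  by move=> x xL; apply: contrapT => /negP nx; apply: loops; exists x.
(* A loop not followed by its own reverse is deleted at cost one: its sides lie on one word, which
   splits, or on two words, which merge. *)
have [[d [dL vded]]|bigons] :=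
    pselect (exists d, d \in flatten L /\ v d != e d).
  have edL : e d \in flatten L by apply: (live_rev live).
  have vd := live_in live dL; have ved := live_in live edL.
  suff [L2 [L'' [rg pL cyc'' bound]]] : exists L2 L'',
      [/\ regroup (e \o v) L L2,
          perm_eq (flatten L2) (d :: e d :: flatten L''),
          {in L'', forall w, fcycle (e \o del v d) w} &
          forall m, chi_bound (map (wprod l) L'') m -> chi_bound (map (wprod l) L2) m.+1].
    case: rg => pLL _ rg; have pD := perm_trans pLL pL.
    have sz := perm_size pD; rewrite /= in sz.
    have [] := IH (del v d) L'' l _ (live_del live pD loops) cyc'' lV.
      by move: szL; rewrite sz ltnS => /ltnW.
    rewrite card_porbits_del //.
    have -> : (if v (e d) == d then v d else v (e d)) != e d by case: ifP.
    move=> m bm eqm; exists m.+1; last by rewrite sz -eqm; move: (size _) #|porbits v| => a b; lia.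
    by have := rg l [::] m.+1; rewrite !cats0; apply; apply: bound.
  have [X [L1 rg1]] := regroup_pick (e \o v) dL.
  have [pL1 /(_ cyc) cyc1 _] := rg1.
  have cdX := cyc1 _ (mem_head _ _).
  have uL1 : uniq (flatten ((d :: X) :: L1)) by rewrite -(perm_uniq pL1) (live_uniq live).
  have /orP[edX|edL1] : (e d \in X) || (e d \in flatten L1).
    have := edL; rewrite (perm_mem pL1) /= inE mem_cat => /or3P[/eqP ed| -> | -> ] //.
      by have := e_neq d; rewrite ed eqxx.
    by rewrite orbT.
  - case/path.splitPr: edX rg1 pL1 cyc1 cdX uL1 => Y Z rg1 pL1 cyc1 cdX uL1.
    exists ((d :: Y ++ e d :: Z) :: L1), (Y :: Z :: L1).
    have pL2 : perm_eq (flatten ((d :: Y ++ e d :: Z) :: L1))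
                       (d :: e d :: flatten (Y :: Z :: L1)).
      by rewrite /= perm_cons -catA /= -cat1s perm_catCA.
    move: uL1; rewrite (perm_uniq pL2) /= inE !mem_cat !negb_or.
    case/and3P=> /and4P[_ dY dZ dL1] /and3P[edY edZ edL1] _.
    move: cdX; rewrite /= rcons_cat /= -cat_rcons cat_path last_rcons => /andP[pY pZ].
    split=> //.
      move=> w; rewrite !inE => /or3P[/eqP->|/eqP->|wL1].
      - exact: fcycle_del_split1.
      - exact: fcycle_del_split2.
      - apply: fcycle_del; last by apply: cyc1; rewrite inE wL1 orbT.
          by apply: contra dL1 => dw; apply/flattenP; exists w.
        by apply: contra edL1 => dw; apply/flattenP; exists w.
    move=> m /= b.
    have -> : wprod l (d :: Y ++ e d :: Z) =
              (wprod l Y ^ (l d)^-1 * wprod l Z)%g.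
      by rewrite /wprod big_cons big_cat big_cons lV conjgE invgK !mulgA.
    by apply: chi_bound_merge; apply: chi_bound_conj.
  - have [Y [L2 rg2]] := regroup_pick (e \o v) edL1.
    have rg := regroup_trans rg1 (regroup_cons (d :: X) rg2).
    exists ((d :: X) :: (e d :: Y) :: L2), ((X ++ Y) :: L2).
    have pL2 : perm_eq (flatten ((d :: X) :: (e d :: Y) :: L2))
                       (d :: e d :: flatten ((X ++ Y) :: L2)).
      by rewrite /= perm_cons -cat1s perm_catCA /= catA.
    have [pLL /(_ cyc) cyc2 _] := rg.
    have : uniq (flatten ((d :: X) :: (e d :: Y) :: L2)).
      by rewrite -(perm_uniq pLL) (live_uniq live).
    rewrite (perm_uniq pL2) /= inE !mem_cat !negb_or -!andbA.
    case/and5P=> _ dX dY dL2 /and4P[edX edY edL2 _].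
    split=> //.
      move=> w; rewrite inE => /predU1P[->|wL2].
        apply: fcycle_del_merge => //.
        by apply: (cyc2 (e d :: Y)); rewrite !inE eqxx orbT.
      apply: fcycle_del; last by apply: cyc2; rewrite !inE wL2 !orbT.
        by apply: contra dL2 => dw; apply/flattenP; exists w.
      by apply: contra edL2 => dw; apply/flattenP; exists w.
    move=> m /= b.
    have -> : wprod l (d :: X) = ((wprod l X * l d) ^ (l d)^-1)%g.
      by rewrite /wprod big_cons conjgE invgK !mulgA mulgK.
    apply: chi_bound_conj; apply: chi_bound_split.
    by move: b; rewrite /wprod big_cons big_cat lV !mulgA mulgK.
have [[d dL]|D0] := pselect (exists d, d \in flatten L); last first.
  apply: IH => //; case: (flatten L) D0 => // d D [].
  by exists d; rewrite mem_head.
have edL : e d \in flatten L by apply: (live_rev live).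
(* What remains at this vertex is a single loop, that is an annulus; its boundary words [l d] and
   its inverse cost nothing. *)
have vd : v d = e d by apply: contrapT => /eqP vd; apply: bigons; exists d.
have ved : v (e d) = d.
  by apply: contrapT => /eqP ved; apply: bigons; exists (e d); rewrite eK.
have pick x L' : v x = e x -> x \in flatten L' ->
    {in L', forall w, fcycle (e \o v) w} -> uniq (flatten L') ->
    exists L'', regroup (e \o v) L' ([:: x] :: L'').
  move=> vx xL' cyc' uL'; have [X [L1 rg1]] := regroup_pick (e \o v) xL'.
  have [p1 /(_ cyc') c1 _] := rg1; exists L1; have := c1 _ (mem_head _ _).
  move: uL'; rewrite (perm_uniq p1); case: X rg1 {p1 c1} => //= y X rg1.
  by rewrite vx eK inE => /andP[xX _] /andP[/eqP xy]; rewrite xy eqxx in xX.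
have [L1 rg1] := pick d L vd dL cyc (live_uniq live).
have [pL1 /(_ cyc) cyc1 _] := rg1.
have uL1 : uniq (flatten ([:: d] :: L1)) by rewrite -(perm_uniq pL1) (live_uniq live).
have edL1 : e d \in flatten L1.
  by have := edL; rewrite (perm_mem pL1) /= inE (negbTE (e_neq d)).
have [] := pick (e d) L1 _ edL1 _ _.
- by rewrite eK.
- by move=> w wL; apply: cyc1; rewrite inE wL orbT.
- by case/andP: uL1.
move=> L2 rg2; have rg := regroup_trans rg1 (regroup_cons [:: d] rg2).
have [pL2 /(_ cyc) cyc2 bL2] := rg.
have sz := perm_size pL2; rewrite /= in sz.
have [] := IH (del v d) L2 l _ (live_del live pL2 loops) _ lV.
- by move: szL; rewrite sz ltnS => /ltnW.
- move=> w wL; apply: fcycle_del; last by apply: cyc2; rewrite !inE wL !orbT.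
    move: (live_uniq live); rewrite (perm_uniq pL2) /= inE negb_or => /andP[/andP[_ dL2] _].
    by apply: contra dL2 => dw; apply/flattenP; exists w.
  move: (live_uniq live); rewrite (perm_uniq pL2) /= => /and3P[_ edL2 _].
  by apply: contra edL2 => dw; apply/flattenP; exists w.
rewrite card_porbits_del; last exact: (live_in live dL).
rewrite ved eqxx vd eqxx addn0 => m bm eqm; exists m.
  have := bL2 l [::] m; rewrite !cats0; apply => /=.
  rewrite /wprod !big_seq1 lV; exact: chi_bound_inv.
by rewrite sz -eqm; move: (size _) #|porbits v| => a b; lia.
Qed.
End Surface.

(** * Orbits and the boundary chain of a fatgraph *)

Section Orbits.
Variables (T : finType) (f : T -> T).
Hypothesis f_inj : injective f.

Lemma big_froots (R : Type) (idx : R) (op : Monoid.com_law idx) (F : T -> R) :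
  \big[op/idx]_x F x =
  \big[op/idx]_(d in froots f) \big[op/idx]_(x <- fingraph.orbit f d) F x.
Proof.
have symf := fconnect_sym f_inj.
rewrite (partition_big (froot f) (mem (froots f))) /= => [|x _]; last exact: roots_root.
apply: eq_bigr => d /eqP rd; rewrite big_uniq ?orbit_uniq //=.
apply: eq_bigl => x; rewrite -fconnect_orbit.
by rewrite -(root_connect symf) rd eq_sym.
Qed.

Lemma perm_orbits :
  perm_eq (flatten [seq fingraph.orbit f d | d <- enum (froots f)]) (enum T).
Proof.
apply/allP => y _ /=; apply/eqP.
rewrite (count_uniq_mem _ (enum_uniq T)) mem_enum inE.
have := big_froots addn (fun x => (x == y) : nat).
rewrite (bigD1 y) //= eqxx big1 ?addn0 => [|x /negbTE->] //; rewrite /nat_of_bool => ->.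
rewrite count_flatten -map_comp sumnE big_map big_enum /=.
by apply: eq_bigr => d _; rewrite -sum1_count big_mkcond.
Qed.

Lemma card_porbits_perm : #|porbits (perm f_inj)| = fcard f T.
Proof.
have symf := fconnect_sym f_inj.
have porbitE x : porbit (perm f_inj) x = [set y | fconnect f x y]%SET.
  apply/setP => y; rewrite inE; apply/porbitP/idP => [[i ->]|].
    rewrite permX (eq_iter (f := perm f_inj) (f' := f)) ?fconnect_iter // => z.
    by rewrite permE.
  move/iter_findex <-; exists (findex f x y); rewrite permX.
  by apply: eq_iter => z; rewrite permE.
have -> : fcard f T = #|[set porbit (perm f_inj) d | d in froots f]%SET|.
  rewrite card_in_imset => [|d d' /eqP rd /eqP rd' ].
    by apply: eq_card => x; rewrite !inE andbT.
  rewrite !porbitE => /setP/(_ d'); rewrite !inE connect0.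
  by rewrite -(root_connect symf) rd rd' => /eqP.
apply: eq_card => S; apply/imsetP/imsetP => [[x _ ->]|[x _ ->]]; last by exists x.
exists (froot f x); first exact: roots_root.
rewrite !porbitE; apply/setP => y; rewrite !inE.
by apply: same_connect => //; apply: connect_root.
Qed.

End Orbits.

Section FatgraphChain.
Variable Y : fatgraph.

Lemma bnext_inj : injective (@bnext Y).
Proof. exact: inj_comp (inv_inj (@edge_revK Y)) (@vertex_rot_inj Y). Qed.

Lemma card_edges : (2 * fcard (@edge_rev Y) Y = #|Y|)%N.
Proof.
rewrite mulnC; apply: (fcard_order_set (inv_inj (@edge_revK Y))) => //.
  apply/fintype.subsetP => x _; rewrite inE.
  have cy : fcycle (@edge_rev Y) [:: x; edge_rev x] by rewrite /= edge_revK !eqxx.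
  by rewrite (order_cycle cy) /= ?inE ?eqxx // eq_sym edge_rev_neq.
Qed.

Lemma boundary_chi_bound r (l : Y -> freegrp r) :
  (forall d, l (edge_rev d) = (l d)^-1%g) ->
  exists2 m, chi_bound (boundary l) m & m%:Z = - euler_char Y.
Proof.
move=> lV; pose L := [seq fingraph.orbit (@bnext Y) d | d <- enum (froots (@bnext Y))].
have pL : perm_eq (flatten L) (enum Y) := perm_orbits bnext_inj.
pose v := perm (@vertex_rot_inj Y).
have inL x : x \in flatten L by rewrite (perm_mem pL) mem_enum.
have [] := @surface_chi_bound _ _ _ (@edge_revK Y) (@edge_rev_neq Y)
  _ v L l (leqnn _) .
- split=> //; first by rewrite (perm_uniq pL) enum_uniq.
  - by move=> x; rewrite inL.
  - move=> x _; rewrite permE; apply/eqP => vx.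
    have cx : fcycle (@vertex_rot Y) [:: x] by rewrite /= vx eqxx.
    have := valence_ge3 x; by rewrite (order_cycle cx) ?mem_head.
- move=> w /mapP[d _ ->].
  rewrite (eq_cycle (e' := frel (@bnext Y))); first exact: (cycle_orbit bnext_inj).
  by move=> x y; rewrite /= permE.
- exact: lV.
move=> m bm eqm; exists m; first by move: bm; rewrite -map_comp.
move: eqm; rewrite card_porbits_perm (perm_size pL) -cardE /euler_char -card_edges.
lia.
Qed.

End FatgraphChain.

(** * Bavard duality *)

Section Scl.
Variables (R : realType) (G : groupType).
Implicit Types (gs : seq G) (g : G).

Lemma prodcommP k g : prodcomm k g <->
  exists a b : 'I_k -> G, g = (\prod_(i < k) [~ a i, b i])%g.
Proof.
split=> [[s <- ->]|[a [b ->]]].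
  exists (fun i : 'I_(size s) => (nth (1, 1) s i)%g.1), (fun i => (nth (1, 1) s i)%g.2).
  by rewrite (big_nth (1, 1)%g) big_mkord.
exists [seq (a i, b i) | i <- enum 'I_k]; first by rewrite size_map size_enum_ord.
by rewrite big_map enumT [index_enum _]unlock.
Qed.

Lemma conjprodP gs g : conjprod gs g <->
  exists h : 'I_(size gs) -> G,
    g = (\prod_(i < size gs) (h i * nth 1 gs i * (h i)^-1))%g.
Proof.
elim: gs g => [|x gs IH] g.
  split=> [->|[h ->]]; last by rewrite /= big_ord0.
  by exists (fun _ => 1%g); rewrite big_ord0.
split=> [[h [g' [/IH[h' ->] ->]]]|[h ->]].
  exists (fun i => oapp h' h^-1%g (unlift ord0 i)).
  rewrite big_ord_recl unlift_none /= conjgE invgK mulgA; congr (_ * _)%g.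
  by apply: eq_bigr => i _; rewrite liftK.
exists (h ord0)^-1%g, (\prod_(i < size gs)
    (h (lift ord0 i) * nth 1 gs i * (h (lift ord0 i))^-1))%g; split.
  by apply/IH; exists (fun i => h (lift ord0 i)).
by rewrite big_ord_recl conjgE invgK mulgA.
Qed.

Local Open Scope ereal_scope.

Lemma cl_chain_le k gs : ccl k gs -> cl_chain R gs <= k%:R%:E.
Proof.
case=> g /conjprodP[h ->] /prodcommP[a [b e]].
apply: ge_ereal_inf; exists (cl R (\prod_(i < size gs) (h i * nth 1 gs i * (h i)^-1))%g).
  by exists h.
apply: ge_ereal_inf; exists k%:R%:E => //.
by exists k => //; exists a, b.
Qed.

Lemma le_cl_chain (c : R) gs :
  (forall k, ccl k gs -> (c <= k%:R)%R) -> c%:E <= cl_chain R gs.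
Proof.
move=> lec; apply/ereal_infP => _ [h _ <-].
apply/ereal_infP => _ [k [a [b e]] <-]; rewrite lee_fin; apply: lec.
by exists (\prod_(i < size gs) (h i * nth 1 gs i * (h i)^-1))%g;
  [apply/conjprodP; exists h | apply/prodcommP; exists a, b].
Qed.

(** Both bounds have an error independent of [n], hence the squeeze. The sequence is shifted by one
    because its term at [0] involves the inverse of zero. *)
Lemma scl_eq gs m (c : R) : chi_bound gs m ->
  (forall n k, ccl k [seq (g ^+ n)%g | g <- gs] -> (n%:R * (m%:R / 2) - c <= k%:R)%R) ->
  scl R gs = (m%:R / 2)%:E.
Proof.
move=> [K b] lb; apply/cvg_lim => //.
have cvg1 (d : R) : ((m%:R / 2 + d * n.+1%:R^-1)%:E @[n --> \oo] --> (m%:R / 2)%:E)%classic.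
  apply: cvg_EFin; first by near=> n.
  rewrite -[X in _ --> X]addr0; apply: cvgD; first exact: cvg_cst.
  rewrite -(mulr0 d); apply: cvgM; first exact: cvg_cst.
  exact: cvg_harmonic.
rewrite -(cvg_shiftS); apply: (squeeze_cvge _ (cvg1 (- c)%R) (cvg1 K%:R)).
near=> n; have n0 : (0 < n.+1%:R :> R)%R by [].
apply/andP; split.
  rewrite lee_pdivlMr // -EFinM; apply: le_cl_chain => k ck.
  apply: le_trans (lb _ _ ck); rewrite mulrDl mulrC lerD2l.
  by rewrite divfK ?lt0r_neq0.
have [k ck kb] := b n.+1.
rewrite lee_pdivrMr // -EFinM; apply: le_trans (cl_chain_le ck) _.
rewrite lee_fin mulrDl divfK ?lt0r_neq0 //.
have : (k.*2%:R <= n.+1%:R * m%:R + K%:R :> R)%R by rewrite -natrM -natrD ler_nat.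
rewrite -mul2n natrM; have := ler0n R K; lra.
Unshelve. all: by end_near.
Qed.

End Scl.

Section Quasimorphism.
Variables (R : realType) (G : groupType) (phi : G -> R) (D : R).
Hypothesis phiD : defect_bound phi D.
Implicit Types (g h x y : G) (k m n : nat).

Let D0 : 0 <= D. Proof. by case: phiD. Qed.

Let qm g h : `|phi (g * h)%g - phi g - phi h| <= D. Proof. by case: phiD. Qed.

Lemma defect_bound1 : `|phi 1%g| <= D.
Proof. by have := qm 1 1; rewrite mulg1 subrr sub0r normrN. Qed.

Let powM g m n : `|phi (g ^+ (m * n.+1))%g - n.+1%:R * phi (g ^+ m)%g| <= n%:R * D.
Proof.
elim: n => [|n IHn]; first by rewrite muln1 mul1r subrr normr0 mul0r.
have := qm (g ^+ m)%g (g ^+ (m * n.+1))%g; rewrite -expgnDr -mulnS.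
move: IHn; rewrite !ler_norml -!natr1.
move: (phi _) (phi _) (phi _) => a b c; lra.
Qed.

(* The limit is squeezed between all [(phi (g^m) - D) / m] and all
   [(phi (g^n) + D) / n]. *)
Lemma homogenization_ex g : exists c, forall n, `|phi (g ^+ n)%g - n%:R * c| <= D.
Proof.
pose lo := [set (phi (g ^+ n.+1)%g - D) / n.+1%:R | n in [set: nat]].
have ub m n : (phi (g ^+ m.+1)%g - D) / m.+1%:R <= (phi (g ^+ n.+1)%g + D) / n.+1%:R.
  have m0 : 0 < m.+1%:R :> R by [].
  have n0 : 0 < n.+1%:R :> R by [].
  rewrite ler_pdivrMr // mulrAC ler_pdivlMr //.
  have := powM g m.+1 n; have := powM g n.+1 m; rewrite mulnC.
  rewrite !ler_norml -!natr1.
  move: (phi _) (phi _) (phi _) => a b c; have := D0; lra.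
have supl : has_sup lo.
  split; first by exists ((phi (g ^+ 1)%g - D) / 1); exists 0%N.
  by exists ((phi (g ^+ 1)%g + D) / 1) => _ [m _ <-]; apply: ub.
exists (sup lo); case=> [|n]; first by rewrite expg0 mul0r subr0 defect_bound1.
have n0 : 0 < n.+1%:R :> R by [].
have l1 : (phi (g ^+ n.+1)%g - D) / n.+1%:R <= sup lo.
  by apply: sup_upper_bound => //; exists n.
have l2 : sup lo <= (phi (g ^+ n.+1)%g + D) / n.+1%:R.
  by apply: ge_sup; [case: supl | move=> _ [m _ <-]; apply: ub].
rewrite ler_pdivrMr // in l1; rewrite ler_pdivlMr // in l2.
by rewrite ler_norml mulrC; apply/andP; split; lra.
Qed.

(** Bounded distance to a linear sequence determines the limit; the values of homogenizations below
    are all found by this criterion. *)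
Lemma homogenizationE g c K :
  (forall n, `|phi (g ^+ n)%g - n%:R * c| <= K) -> homogenization phi g = c.
Proof.
move=> bd; apply/cvg_lim => //.
have cvg1 (d : R) : (c + d * n.+1%:R^-1) @[n --> \oo] --> c.
  rewrite -[X in _ --> X]addr0; apply: cvgD; first exact: cvg_cst.
  rewrite -(mulr0 d); apply: cvgM; first exact: cvg_cst.
  exact: cvg_harmonic.
rewrite -(cvg_shiftS); apply: (squeeze_cvgr _ (cvg1 (- K)) (cvg1 K)).
near=> n; have n0 : (0 < n.+1%:R :> R)%R by [].
rewrite ler_pdivlMr // ler_pdivrMr // !mulrDl !divfK ?lt0r_neq0 //.
by have := bd n.+1; rewrite ler_norml => /andP[? ?]; apply/andP; split; lra.
Unshelve. all: by end_near.
Qed.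

Local Notation psi := (homogenization phi).

Lemma homogenization_dist n g : `|phi (g ^+ n)%g - n%:R * psi g| <= D.
Proof. by have [c cP] := homogenization_ex g; rewrite (homogenizationE cP). Qed.

Lemma homogenizationX g k : psi (g ^+ k)%g = k%:R * psi g.
Proof.
apply: (@homogenizationE _ _ D) => n; rewrite -expgnA mulrA -natrM [(n * k)%N]mulnC.
exact: homogenization_dist.
Qed.

Lemma homogenizationJ g h : psi (g ^ h)%g = psi g.
Proof.
apply: (@homogenizationE _ _ (3 * D + `|phi h^-1%g| + `|phi h|)) => n.
rewrite -conjXg conjgE.
have := homogenization_dist n g; have := qm h^-1%g (g ^+ n * h)%g.
have := qm (g ^+ n)%g h.
rewrite !ler_norml; have := ler_norm (phi h); have := ler_norm (- phi h).
have := ler_norm (phi h^-1%g); have := ler_norm (- phi h^-1%g); rewrite !normrN.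
move: (phi _) (phi _) (phi _) (phi _) (phi _) => a b c d e; lra.
Qed.

Lemma homogenization1 : psi 1%g = 0.
Proof.
by apply: (@homogenizationE _ _ D) => n; rewrite expg1n mulr0 subr0 defect_bound1.
Qed.

Lemma homogenizationV g : psi g^-1%g = - psi g.
Proof.
apply: (@homogenizationE _ _ (3 * D)) => n; rewrite expVgn mulrN.
have := homogenization_dist n g; have := qm (g ^+ n)%g (g ^- n)%g.
rewrite mulgV; have := defect_bound1; rewrite !ler_norml.
move: (phi _) (phi _) (phi _) => a b c; lra.
Qed.

Hypothesis phiV : forall g, phi g^-1%g = - phi g.

Lemma norm_prodcomm k g : prodcomm k g -> `|phi g| <= (4 * k)%:R * D.
Proof.
have phi1 : phi 1%g = 0 by have := phiV 1; rewrite invg1; lra.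
case=> s <- ->; elim: s => [|[a b] s IHs] /=.
  by rewrite big_nil phi1 normr0 muln0 mul0r.
rewrite big_cons /= commgEl conjgE.
set x := (\prod_(_ <- s) _)%g in IHs *.
have := qm (a^-1 * (b^-1 * (a * b)))%g x; have := qm a^-1%g (b^-1 * (a * b))%g.
have := qm b^-1%g (a * b)%g; have := qm a b; rewrite !phiV.
move: IHs; rewrite mulnS natrD; rewrite !ler_norml.
move: (phi _) (phi _) (phi _) (phi _) (phi _) (phi _) (phi _) => *; lra.
Qed.

(* The defect only doubles because [(gh)^n] and [g^n h^n] differ by [n / 2]
   commutators. *)
Lemma homogenization_defect : defect_bound psi (2 * D).
Proof.
split=> [|g h]; first by rewrite mulr_ge0.
apply/ler_addgt0Pr => e e0.
(* The [5 * D] collects three comparisons of [phi] with its homogenization and two uses of the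
   defect; it vanishes after division by [n]. *)
have [n nlt] : exists n : nat, 5 * D / e < n.+1%:R.
  exists (Num.truncn (5 * D / e)).
  exact: truncnS_gt.
have n0 : 0 < n.+1%:R :> R by [].
rewrite ltr_pdivrMr // in nlt.
suff : `|n.+1%:R * psi (g * h)%g - n.+1%:R * psi g - n.+1%:R * psi h| <=
       n.+1%:R * (2 * D) + 5 * D.
  rewrite -!mulrBr normrM gtr0_norm // => le1.
  rewrite -(ler_pM2l n0); apply: le_trans le1 _; rewrite mulrDr lerD2l; lra.
have [/norm_prodcomm pA _] := prodcomm_expM n.+1 g h.
set A := (_ * _ * _)%g in pA.
have eA : ((g * h) ^+ n.+1 = g ^+ n.+1 * (A * h ^+ n.+1))%g.
  by rewrite /A -!mulgA mulVg mulg1 mulVKg.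
have nn : (4 * n.+1./2)%:R <= 2 * n.+1%:R :> R.
  by rewrite -natrM ler_nat; lia.
have {pA}pA : `|phi A| <= 2 * n.+1%:R * D.
  by apply: le_trans pA _; apply: ler_wpM2r.
have := homogenization_dist n.+1 (g * h); have := homogenization_dist n.+1 g.
have := homogenization_dist n.+1 h; rewrite eA.
have := qm (g ^+ n.+1)%g (A * h ^+ n.+1)%g; have := qm A (h ^+ n.+1)%g.
move: pA; rewrite !ler_norml.
move: (phi _) (phi _) (phi _) (phi _) (phi _) => *; lra.
Qed.

End Quasimorphism.

Section Bavard.
Variables (R : realType) (G : groupType) (phi : G -> R) (D E : R).
Hypotheses (phiE : defect_bound phi E) (psiD : defect_bound (homogenization phi) D).
Local Notation psi := (homogenization phi).

Let D0 : 0 <= D. Proof. by case: psiD. Qed.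
Let qm g h : `|psi (g * h)%g - psi g - psi h| <= D. Proof. by case: psiD. Qed.

(** A commutator is [a^-1 * a ^ b], and [psi] takes opposite values on the two factors: its value
    costs one [D], and multiplying it on costs another. *)
Lemma homogenization_prodcomm k g : prodcomm k g -> `|psi g| <= (2 * k)%:R * D.
Proof.
case=> s <- ->; elim: s => [|[a b] s IHs] /=.
  by rewrite big_nil (homogenization1 phiE) normr0 muln0 mul0r.
rewrite big_cons /= commgEl.
set x := (\prod_(_ <- s) _)%g in IHs *.
have := qm (a^-1 * a ^ b)%g x; have := qm a^-1%g (a ^ b)%g.
rewrite (homogenizationV phiE) (homogenizationJ phiE).
move: IHs; rewrite mulnS natrD; rewrite !ler_norml.
move: (psi _) (psi _) (psi _) (psi _) => *; lra.
Qed.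

Lemma homogenization_conjprod gs g : conjprod gs g ->
  `|psi g - \sum_(x <- gs) psi x| <= (size gs)%:R * D.
Proof.
elim: gs g => [|x gs IH] g /=.
  by move=> ->; rewrite big_nil (homogenization1 phiE) subr0 normr0 mul0r.
case=> h [g' [/IH{}IH ->]]; rewrite big_cons.
have := qm (x ^ h)%g g'; rewrite (homogenizationJ phiE).
move: IH; rewrite -addn1 natrD !ler_norml.
move: (psi _) (psi _) (psi _) (\sum_(_ <- _) _) => *; lra.
Qed.

Lemma bavard gs n k : ccl k [seq (g ^+ n)%g | g <- gs] ->
  n%:R * on_chain psi gs <= (2 * k + size gs)%:R * D.
Proof.
case=> g /homogenization_conjprod cg /homogenization_prodcomm pg.
have eS : \sum_(x <- [seq (g ^+ n)%g | g <- gs]) psi x = n%:R * on_chain psi gs.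
  rewrite big_map /on_chain mulr_sumr; apply: eq_bigr => x _.
  exact: homogenizationX phiE _ _.
rewrite size_map eS in cg; move: cg pg; rewrite !ler_norml natrD.
move: (psi _) => *; lra.
Qed.

End Bavard.

(** The chain itself pins the defect to [6]: a defect bound [D < 6] of [psi] would give
    [6 n m <= (n m + K + size gs) D] for every [n], since the surface bounds [2 k] by [n m + K].
    This is absurd for large [n] because [m] is positive. *)
Lemma certificate (R : realType) (G : groupType) (phi : G -> R) gs m :
  chi_bound gs m -> (0 < m)%N -> defect_bound phi 3 ->
  (forall g, phi g^-1%g = - phi g) ->
  on_chain (homogenization phi) gs = 6 * m%:R ->
  scl R gs = (m%:R / 2)%:E /\ defect (homogenization phi) = 6.
Proof.
move=> bm m0 phi3 phiV val; split.
  apply: (scl_eq (c := (size gs)%:R / 2) bm) => n k ck.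
  have := bavard phi3 (homogenization_defect phi3 phiV) ck.
  by rewrite val natrD natrM; lra.
have in6 : defect_bound (homogenization phi) 6.
  by have := homogenization_defect phi3 phiV; congr defect_bound; lra.
have lb : lbound (defect_bound (homogenization phi)) 6.
  move=> D DP; have [D0 _] := DP; rewrite leNgt; apply/negP => D6.
  have [K b] := bm; pose B := (K + size gs)%:R * D.
  have m0' : 1 <= m%:R :> R by rewrite ler1n.
  pose n := (Num.truncn (B / (6 - D))).+1.
  have nB : B < n%:R * (6 - D).
    by rewrite -ltr_pdivrMr ?subr_gt0 //; apply: truncnS_gt.
  have [k ck kb] := b n; have := bavard phi3 DP ck; rewrite val.
  have : (2 * k + size gs)%:R * D <= (n * m + K + size gs)%:R * D.
    by apply: ler_wpM2r => //; rewrite ler_nat mul2n leq_add2r.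
  rewrite -addnA (natrD _ (n * m)) mulrDl -/B (natrM _ n m).
  have : n%:R * (6 - D) <= n%:R * m%:R * (6 - D).
    by rewrite ler_wpM2r ?subr_ge0 ?(ltW D6) // ler_peMr.
  by lra.
apply/eqP; rewrite eq_le /defect; apply/andP; split.
  by apply: ge_inf => //; exists 6.
by apply: lb_le_inf => //; exists 6.
Qed.

(** * The stack function *)

Section Stack.
Variables (R : realType) (eps : R).
Hypotheses (eps0 : 0 < eps) (eps1 : eps < 1).

(** The probability, for [t] uniform in [[eps, 1]], that fewer than [j] letters are cut from each
    end of a word of length [2 h]; [stack_weight h f] is the probability of cutting exactly [f]. *)
Definition stack_cdf (h j : nat) : R := Num.min 1 (j%:R / ((1 - eps) * h%:R)).

Definition stack_weight (h f : nat) : R := stack_cdf h f.+1 - stack_cdf h f.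

Let level (h f : nat) : set R := [set t | f%:R <= (1 - t) * h%:R < f.+1%:R].

Let levelE h f t : t <= 1 -> level h f t <-> Num.truncn ((1 - t) * h%:R) = f.
Proof.
move=> t1; have t0 : 0 <= (1 - t) * h%:R by rewrite mulr_ge0 ?subr_ge0.
split=> [/truncn_def //|<-]; exact: truncn_itv.
Qed.

Let level_itv h f : (0 < h)%N ->
  level h f = [set` `]1 - f.+1%:R / h%:R, 1 - f%:R / h%:R] ].
Proof.
move=> h0; have h0' : 0 < h%:R :> R by rewrite ltr0n.
apply/seteqP; split=> t; rewrite /level /= in_itv /=.
  by rewrite -ler_pdivrMr // -ltr_pdivlMr // => /andP[? ?]; apply/andP; split; lra.
by rewrite -ler_pdivrMr // -ltr_pdivlMr // => /andP[? ?]; apply/andP; split; lra.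
Qed.

Let mu_level h f : (0 < h)%N ->
  lebesgue_measure (level h f `&` `[eps, 1]) = ((1 - eps) * stack_weight h f)%:E.
Proof.
move=> h0; have h0' : 0 < h%:R :> R by rewrite ltr0n.
have K0 : 0 < (1 - eps) * h%:R by rewrite mulr_gt0 ?subr_gt0.
have eK j : j%:R / ((1 - eps) * h%:R) = j%:R / h%:R / (1 - eps).
  by rewrite [in RHS]mulrAC invfM mulrA.
rewrite level_itv // /stack_weight /stack_cdf !eK.
have fS : f.+1%:R / h%:R = f%:R / h%:R + h%:R^-1 :> R by rewrite -natr1 mulrDl mul1r.
have hV : 0 < h%:R^-1 :> R by rewrite invr_gt0.
have y0 : 0 <= f%:R / h%:R :> R by rewrite divr_ge0.
rewrite fS; move: hV y0; move: (f%:R / h%:R) => y; move: (h%:R^-1) => z z0 y0.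
have e1 : 0 < 1 - eps by rewrite subr_gt0.
have [le1|gt1] := leP (y + z) (1 - eps).
  rewrite !min_r ?ler_pdivrMr ?mul1r //; last by lra.
  have -> : (`]1 - (y + z), 1 - y] `&` `[eps, 1])%classic = `]1 - (y + z), 1 - y]%classic.
    apply/seteqP; split=> t /=; rewrite !in_itv /=; first by case.
    by move=> /andP[? ?]; split; apply/andP; split; lra.
  rewrite lebesgue_measure_itv /= lte_fin ifT; last by lra.
  by rewrite -EFinB; congr _%:E; field; lra.
rewrite [Num.min 1 ((y + z) / _)]min_l ?ler_pdivlMr ?mul1r ?(ltW gt1) //.
have -> : (`]1 - (y + z), 1 - y] `&` `[eps, 1])%classic = `[eps, 1 - y]%classic.
  apply/seteqP; split=> t /=; rewrite !in_itv /=.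
    by case=> /andP[? ?] /andP[? ?]; apply/andP; split; lra.
  by move=> /andP[? ?]; split; apply/andP; split; lra.
rewrite lebesgue_measure_itv /= lte_fin; case: ltP => yy.
  rewrite min_r ?ler_pdivrMr ?mul1r //; last by lra.
  by rewrite -EFinB; congr _%:E; field; lra.
rewrite min_l ?ler_pdivlMr ?mul1r //; last by lra.
by rewrite subrr mulr0.
Qed.

Let integral_level (c : nat -> R) h : (0 < h)%N -> (forall f, 0 <= c f) ->
  (\int[@lebesgue_measure R]_(t in `[eps, 1]) (c (Num.truncn ((1 - t) * h%:R))))%R =
  (1 - eps) * \sum_(f < h) stack_weight h f * c f.
Proof.
move=> h0 c0; have h0' : 0 < h%:R :> R by rewrite ltr0n.
have mI : measurable (`[eps, 1]%classic : set R) by [].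
have mL f : measurable (level h f) by rewrite level_itv.
rewrite /Rintegral.
under eq_integral => t.
  rewrite inE /= in_itv /= => /andP[et t1].
  have -> : (c (Num.truncn ((1 - t) * h%:R)))%:E =
      (\sum_(f <- index_enum 'I_h) (c f * \1_(level h f) t)%:E)%E.
    have fh : (Num.truncn ((1 - t) * h%:R) < h)%N.
      by rewrite truncn_lt_nat ?mulr_ge0 ?subr_ge0 // gtr_pMl // ltrBlDr ltrDl (lt_le_trans eps0).
    rewrite (bigD1 (Ordinal fh)) //= big1 ?adde0 => [|f nf].
      by rewrite indicE mem_set ?mulr1 //; apply/levelE.
    rewrite indicE memNset ?mulr0 // => /(levelE _ _ t1) e; move/eqP: nf; apply.
    by apply: val_inj; rewrite /= e.
  over.
rewrite ge0_integral_sum //=; first last.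
- by move=> f t _; rewrite lee_fin mulr_ge0.
- move=> f; apply/measurable_EFinP; apply: measurable_funM; first exact: measurable_cst.
  apply: measurable_indic; exact: mL.
have int f : (\int[lebesgue_measure]_(x in `[eps, 1%R]) (c f * \1_(level h f) x)%:E)%E =
    ((1 - eps) * (stack_weight h f * c f))%:E.
  have /= -> := @integralZl_indic _ _ _ lebesgue_measure _ mI (fun _ => level h f) (c f);
    [|by move=> cf; have := c0 f; rewrite leNgt cf|exact: mL].
  rewrite integral_indic //; last exact: mL.
  transitivity ((c f)%:E * ((1 - eps) * stack_weight h f)%:E)%E.
    by congr (_ * _)%E; apply: mu_level.
  by rewrite -EFinM; congr _%:E; ring.
under eq_bigr => f _ do rewrite int.
by rewrite sumEFin /= mulr_sumr.
Qed.

(** Even length makes the cut symmetric: rounding down in front and up at the back removes the same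
    number [f] of letters, and [f < h] because [t >= eps > 0]. The integrand is thus a step function
    of [t]. *)
Lemma stackE r (x v : freegrp r) h : (0 < h)%N -> size x = h.*2 ->
  stack eps x v =
  \sum_(f < h) stack_weight h f * (copies (drop f (take (h.*2 - f) x)) v)%:R.
Proof.
move=> h0 sx; rewrite /stack.
have -> : (\int[@lebesgue_measure R]_(t in `[eps, 1]) (copies (central_subword x t) v)%:R)%R
  = (\int[@lebesgue_measure R]_(t in `[eps, 1])
       (fun f => (copies (drop f (take (h.*2 - f) x)) v)%:R)
          (Num.truncn ((1 - t) * h%:R)))%R; last first.
  rewrite (@integral_level (fun f => (copies (drop f (take (h.*2 - f) x)) v)%:R)) //.
  by rewrite mulKf // subr_eq0 gt_eqF.
apply: eq_Rintegral => t; rewrite inE /= in_itv /= => /andP[et t1].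
  have eh : (1 - t) / 2 * (size x)%:R = (1 - t) * h%:R.
    by rewrite sx -mul2n natrM; field.
  have eh' : (1 + t) / 2 * (size x)%:R = (h.*2)%:R - (1 - t) * h%:R.
    by rewrite sx -mul2n natrM; field.
  rewrite /central_subword eh eh'.
  have y0 : 0 <= (1 - t) * h%:R by rewrite mulr_ge0 ?subr_ge0.
  have yh : (1 - t) * h%:R <= h%:R by rewrite ler_piMl // lerBlDr lerDl (le_trans (ltW eps0)).
  move: ((1 - t) * h%:R) y0 yh => y y0 yh.
  have -> : `|Num.ceil ((h.*2)%:R - y)|%N = (h.*2 - Num.truncn y)%N.
    have /andP[k1 k2] := truncn_itv y0.
    have kh : (Num.truncn y <= h.*2)%N.
      rewrite -(ler_nat R); apply: le_trans k1 _; apply: le_trans yh _.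
      by rewrite ler_nat -addnn leq_addr.
    rewrite (@ceil_def _ _ (h.*2 - Num.truncn y)%N) //.
    rewrite intrB -!pmulrn natrB //; rewrite -natr1 in k2.
    apply/andP; split; lra.
by [].
Qed.

End Stack.

(** * Turns read in words *)

Lemma size_wordV r (a : seq (letter r)) : size (wordV a) = size a.
Proof. by rewrite /wordV size_rev size_map. Qed.

Lemma nth_wordV r (a0 : letter r) a i : (i < size a)%N ->
  nth a0 (wordV a) i = letterV (nth a0 a (size a - i.+1)).
Proof.
move=> ia; rewrite /wordV nth_rev size_map // (nth_map a0) //; lia.
Qed.

Lemma wordVK r : involutive (@wordV r).
Proof.
move=> a; rewrite /wordV -map_rev revK -map_comp.
by rewrite (eq_map (g := id)) ?map_id // => x /=; rewrite letterVK.
Qed.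

Lemma wordV_cat r (a b : seq (letter r)) : wordV (a ++ b) = wordV b ++ wordV a.
Proof. by rewrite /wordV map_cat rev_cat. Qed.

Section Matches.
Variables (r n N L : nat) (Y : fatgraph) (O : Y -> nat -> letter r) (a0 : letter r).
Local Notation e := (@edge_rev Y).
(* [O d k] is the [k]-th letter read on the way out of the end vertex of [d],
   backwards along [d]. *)
Hypotheses (OV : forall d i, (i < n)%N -> O (e d) i = letterV (O d (n.-1 - i)))
  (Ored : forall d i, (i.+1 < n)%N -> O d i.+1 != letterV (O d i)).
Hypothesis small_cancel : forall d d' i i', (i + L <= n)%N -> (i' + L <= n)%N ->
  (forall k, (k < L)%N -> O d (i + k) = O d' (i' + k)) -> d = d' /\ i = i'.
Hypotheses (L0 : (0 < L)%N) (LN : (3 * L <= N)%N) (Nn : (N.*2 <= n)%N).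
Implicit Types (d x y z : Y) (W a b c : seq (letter r)) (q p k : nat).

(** The number of letters that cancel in the middle of the turn from [d] to [d']. *)
Definition common d d' := find (fun k => O d k != O d' k) (iota 0 n).

Lemma common_le d d' : (common d d' <= n)%N.
Proof. by rewrite -[X in (_ <= X)%N](size_iota 0 n) find_size. Qed.

Lemma before_common d d' k : (k < common d d')%N -> O d k = O d' k.
Proof.
move=> kc; have := before_find 0%N kc; rewrite nth_iota ?add0n => [/negbFE/eqP//|].
exact: leq_trans kc (common_le _ _).
Qed.

Lemma at_common d d' : (common d d' < n)%N ->
  O d (common d d') != O d' (common d d').
Proof.
move=> cn; have := cn; rewrite -[X in (_ < X)%N](size_iota 0 n) -has_find.
by move/(nth_find 0%N); rewrite nth_iota.
Qed.

Lemma common_lt d d' : d != d' -> (common d d' < L)%N.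
Proof.
move=> dd; rewrite ltnNge; apply/negP => Lc; move/eqP: dd; apply.
have [|||//] := @small_cancel d d' 0 0; try lia.
by move=> k kL; apply: before_common; apply: leq_trans Lc.
Qed.

Lemma commonC d d' : common d d' = common d' d.
Proof. by apply: eq_find => k; rewrite eq_sym. Qed.

Lemma common_eq d d' m : (m < n)%N -> (forall k, (k < m)%N -> O d k = O d' k) ->
  O d m != O d' m -> common d d' = m.
Proof.
move=> mn eqm neqm; apply/eqP; rewrite eqn_leq; apply/andP; split.
  by rewrite leqNgt; apply/negP => /before_common/eqP; apply/negP.
rewrite leqNgt; apply/negP => cm.
by have := at_common (ltn_trans cm mn); rewrite eqm ?eqxx.
Qed.

(** The reduced turn that comes in along [d] and leaves along [d'] reverses at depth [common d d'].
    A match is an occurrence in [W], centered at position [q], of the central part of that turn with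
    [rho] letters on each side. *)
Record matches d d' W q rho : Prop := Matches {
  match_neq : d != d';
  match_vertex : fconnect vertex_rot d d';
  match_half : (rho <= N - common d d')%N;
  match_left : (rho <= q)%N;
  match_right : (q + rho <= size W)%N;
  match_in : forall k, (k < rho)%N ->
    letterV (nth a0 W (q.-1 - k)) = O d (common d d' + k);
  match_out : forall k, (k < rho)%N -> nth a0 W (q + k) = O d' (common d d' + k) }.

Lemma match_sub d d' W q rho rho' : (rho' <= rho)%N ->
  matches d d' W q rho -> matches d d' W q rho'.
Proof.
move=> rr [h0 h00 h1 h2 h3 h4 h5]; split=> //; try lia.
  by move=> k kr; apply: h4; lia.
by move=> k kr; apply: h5; lia.
Qed.

Lemma match_lt d d' W q rho : matches d d' W q rho -> (0 < rho)%N ->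
  (common d d' + rho <= N)%N.
Proof. by case=> _ _ h1 *; lia. Qed.

(* Windows lying on one side of the center are read along a single edge. *)
Lemma match_window_in d d' W q rho j : matches d d' W q rho -> (0 < rho)%N ->
  (j + L <= q)%N -> (q <= j + rho)%N ->
  forall k, (k < L)%N -> nth a0 W (j + k) = O (e d) (n - common d d' - (q - j) + k).
Proof.
move=> m r0 jq qj k kL; have lN := match_lt m r0; case: m => _ _ h1 h2 h3 h4 h5.
rewrite OV; last by lia.
have -> : (n.-1 - (n - common d d' - (q - j) + k) = common d d' + (q - j - 1 - k))%N by lia.
rewrite -h4; last by lia.
by rewrite letterVK; congr nth; lia.
Qed.

Lemma match_window_out d d' W q rho j : matches d d' W q rho ->
  (q <= j)%N -> (j + L <= q + rho)%N ->
  forall k, (k < L)%N -> nth a0 W (j + k) = O d' (common d d' + (j - q) + k).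
Proof.
case=> _ _ h1 h2 h3 h4 h5 qj jq k kL.
by rewrite -addnA -h5; [congr nth|]; lia.
Qed.

Section TwoMatches.
Variables (d1 d1' d2 d2' : Y) (W1 W2 : seq (letter r)) (q1 q2 r1 r2 : nat).
Hypotheses (m1 : matches d1 d1' W1 q1 r1) (m2 : matches d2 d2' W2 q2 r2).
Hypotheses (r10 : (0 < r1)%N) (r20 : (0 < r2)%N).
Local Notation s1 := (common d1 d1').
Local Notation s2 := (common d2 d2').
Variable j : nat.
Hypothesis W12 : forall k, (k < L)%N -> nth a0 W1 (j + k) = nth a0 W2 (j + k).

(** The shared letters fix the edge and the offset along it. The number [q + common] is the position
    at which the incoming edge would reach the vertex; for the outgoing edge it is [q - common],
    written without subtraction in [window_out_out]. *)
Lemma window_in_in : (j + L <= q1)%N -> (q1 <= j + r1)%N ->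
  (j + L <= q2)%N -> (q2 <= j + r2)%N -> d1 = d2 /\ (q1 + s1 = q2 + s2)%N.
Proof.
move=> j1 j1' j2 j2'; have l1 := match_lt m1 r10; have l2 := match_lt m2 r20.
have [|||ed eqi] := @small_cancel (e d1) (e d2)
   (n - s1 - (q1 - j)) (n - s2 - (q2 - j)); try lia.
  move=> k kL; rewrite -(match_window_in m1) // -(match_window_in m2) //.
  exact: W12.
by split; [apply: (inv_inj (@edge_revK Y)) | lia].
Qed.

Lemma window_out_out : (q1 <= j)%N -> (j + L <= q1 + r1)%N ->
  (q2 <= j)%N -> (j + L <= q2 + r2)%N -> d1' = d2' /\ (q1 + s2 = q2 + s1)%N.
Proof.
move=> j1 j1' j2 j2'; have l1 := match_lt m1 r10; have l2 := match_lt m2 r20.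
have [|||ed eqi] := @small_cancel d1' d2' (s1 + (j - q1)) (s2 + (j - q2)); try lia.
  move=> k kL; rewrite -(match_window_out m1) // -(match_window_out m2) //.
  exact: W12.
by split=> //; lia.
Qed.

(** An incoming window lies in the last [N] letters of a label and an outgoing one in the first [N];
    as [2 N <= n], they are different subwords. *)
Lemma window_in_out : (j + L <= q1)%N -> (q1 <= j + r1)%N ->
  (q2 <= j)%N -> (j + L <= q2 + r2)%N -> False.
Proof.
move=> j1 j1' j2 j2'; have l1 := match_lt m1 r10; have l2 := match_lt m2 r20.
have [|||ed eqi] := @small_cancel (e d1) d2'
   (n - s1 - (q1 - j)) (s2 + (j - q2)); try lia.
move=> k kL; rewrite -(match_window_in m1) // -(match_window_out m2) //.
exact: W12.
Qed.

End TwoMatches.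

(** Of three consecutive windows of length [L], two centers spoil at most two. The remaining one
    lies on the same side of both centers and identifies one edge of the turns; a window just past
    both centers identifies the other edge, and the two relations between [q] and [common] give
    [q1 = q2]. *)
Lemma match_unique d1 d1' d2 d2' W q1 q2 r1 r2 lo :
  matches d1 d1' W q1 r1 -> matches d2 d2' W q2 r2 ->
  (3 * L <= r1)%N -> (3 * L <= r2)%N ->
  (q1 <= lo + r1)%N -> (q2 <= lo + r2)%N ->
  (lo + 3 * L <= q1 + r1)%N -> (lo + 3 * L <= q2 + r2)%N ->
  [/\ d1 = d2, d1' = d2' & q1 = q2].
Proof.
move=> m1 m2 L1 L2 lo1 lo2 hi1 hi2.
have r10 : (0 < r1)%N by lia.
have r20 : (0 < r2)%N by lia.
have W0 j k : (k < L)%N -> nth a0 W (j + k) = nth a0 W (j + k) by [].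
have b1 := match_left m1; have b2 := match_left m2.
have l1 := common_lt (match_neq m1); have l2 := common_lt (match_neq m2).
have g1 := match_lt m1 r10; have g2 := match_lt m2 r20.
have in_case j : (j + L <= q1)%N -> (q1 <= j + r1)%N ->
    (j + L <= q2)%N -> (q2 <= j + r2)%N -> [/\ d1 = d2, d1' = d2' & q1 = q2].
  move=> h1 h2 h3 h4; have [ed es] := window_in_in m1 m2 r10 r20 (@W0 j) h1 h2 h3 h4.
  have [|||| ed' es'] := window_out_out m1 m2 r10 r20 (@W0 (maxn q1 q2)); try lia.
  by split=> //; lia.
have out_case j : (q1 <= j)%N -> (j + L <= q1 + r1)%N ->
    (q2 <= j)%N -> (j + L <= q2 + r2)%N -> [/\ d1 = d2, d1' = d2' & q1 = q2].
  move=> h1 h2 h3 h4; have [ed es] := window_out_out m1 m2 r10 r20 (@W0 j) h1 h2 h3 h4.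
  have [|||| ed' es'] := window_in_in m1 m2 r10 r20 (@W0 (minn q1 q2 - L)%N); try lia.
  by split=> //; lia.
have [j [jlo jhi p1 p2]] : exists j, [/\ (lo <= j)%N, (j + L <= lo + 3 * L)%N,
    (j + L <= q1)%N \/ (q1 <= j)%N & (j + L <= q2)%N \/ (q2 <= j)%N].
  have [|[|]] :
     (((lo + L <= q1) || (q1 <= lo)) && ((lo + L <= q2) || (q2 <= lo)) \/
      ((lo + L + L <= q1) || (q1 <= lo + L)) && ((lo + L + L <= q2) || (q2 <= lo + L)) \/
      ((lo + 2 * L + L <= q1) || (q1 <= lo + 2 * L)) &&
      ((lo + 2 * L + L <= q2) || (q2 <= lo + 2 * L)))%N by lia.
  - by case/andP=> /orP p1 /orP p2; exists lo; split; lia.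
  - by case/andP=> /orP p1 /orP p2; exists (lo + L)%N; split; lia.
  - by case/andP=> /orP p1 /orP p2; exists (lo + 2 * L)%N; split; lia.
case: p1 p2 => p1 [] p2.
- by apply: (in_case j); lia.
- by case: (window_in_out m1 m2 r10 r20 (@W0 j)); lia.
- by case: (window_in_out m2 m1 r20 r10 (@W0 j)); lia.
- by apply: (out_case j); lia.
Qed.

(* [p] is well inside the interval that the match covers. *)
Definition deep d d' W q p := exists rho,
  [/\ matches d d' W q rho, (q + 3 * L <= p + rho)%N & (p + 3 * L <= q + rho)%N].

Lemma deep_edge d d' W q p : deep d d' W q p -> (p < q)%N || (q + L <= p)%N ->
  exists y i, (i + L.+1 <= n)%N /\
    forall k, (k < L.+1)%N -> nth a0 W (p - L + k) = O y (i + k).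
Proof.
case=> rho [m lo hi]; have ml := match_left m; have r0 : (0 < rho)%N by lia.
have mr := match_lt m r0; case/orP => pq.
  exists (e d), (n - common d d' - (q - (p - L)))%N; split; first by lia.
  move=> [|k] kL; first by apply: (match_window_in m); lia.
  rewrite -addSnnS (match_window_in m) //; [congr O|..]; lia.
exists d', (common d d' + (p - L - q))%N; split; first by lia.
move=> [|k] kL; first by apply: (match_window_out m); lia.
rewrite -addSnnS (match_window_out m) //; [congr O|..]; lia.
Qed.

(** If the words agreed at [q1], the second would still come in along [d] there, where [d1'] has the
    same letters as [d], while the first already leaves along [d1']; the label of [d1'] would
    backtrack. *)
Lemma match_no_turn d d1' d2' W1 W2 q1 q2 r1 r2 :
  matches d d1' W1 q1 r1 -> matches d d2' W2 q2 r2 -> (0 < r1)%N -> (0 < r2)%N ->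
  nth a0 W1 q1 = nth a0 W2 q1 -> (q1 < q2)%N -> (q2 <= q1 + r2)%N ->
  (q1 + common d d1' = q2 + common d d2')%N -> False.
Proof.
move=> m1 m2 r10 r20 W12 q12 q2r es.
have l1 := match_lt m1 r10; have l2 := match_lt m2 r20.
have e1 := match_out m1 r10; rewrite !addn0 in e1.
have kr : (q2 - q1 - 1 < r2)%N by lia.
have := match_in m2 kr.
have -> : (q2.-1 - (q2 - q1 - 1) = q1)%N by lia.
have -> : (common d d2' + (q2 - q1 - 1) = (common d d1').-1)%N by lia.
rewrite (@before_common d d1'); last by lia.
rewrite -W12 e1 => ev; have [|//] := negP (@Ored d1' (common d d1').-1 _); first by lia.
by rewrite -ev letterVK prednK //; lia.
Qed.

(* The two matches agree up to [p]; they must diverge at the vertex and not in the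
   interior of an edge, where the label on either side of [p] would be the same. *)
Lemma deep_diverge d1 d1' d2 d2' W1 W2 q1 q2 p :
  deep d1 d1' W1 q1 p -> deep d2 d2' W2 q2 p ->
  (forall k, (k < p)%N -> nth a0 W1 k = nth a0 W2 k) -> nth a0 W1 p != nth a0 W2 p ->
  [/\ d1 = d2, (q1 + common d1 d1' = q2 + common d2 d2')%N &
     [\/ (q1 = q2 /\ q1 <= p)%N, (q1 = p /\ p < q2)%N | (q2 = p /\ p < q1)%N]].
Proof.
move=> D1 D2 W12 Wp.
wlog near1 : d1 d1' d2 d2' W1 W2 q1 q2 D1 D2 W12 Wp / (p < q1 + L)%N && (q1 <= p)%N.
  move=> near_case.
  have [n1|f1] := boolP ((p < q1 + L)%N && (q1 <= p)%N).
    exact: near_case D1 D2 W12 Wp n1.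
  have [n2|f2] := boolP ((p < q2 + L)%N && (q2 <= p)%N).
    have Wp' : nth a0 W2 p != nth a0 W1 p by rewrite eq_sym.
    have [ed eq cs] := near_case _ _ _ _ _ _ _ _ D2 D1
      (fun k kp => esym (W12 k kp)) Wp' n2.
    split=> //; case: cs => -[c1 c2]; [apply: Or31|apply: Or33|apply: Or32]; lia.
  (* Neither center is near [p], so both words follow an edge up to and including [p]; the [L]
     letters before [p] make it the same edge at the same place, and the words cannot part. *)
  exfalso; have [|y1 [i1 [b1 E1]]] := deep_edge D1; first by lia.
  have [|y2 [i2 [b2 E2]]] := deep_edge D2; first by lia.
  have pL : (L <= p)%N by case: D1 => rho [/match_left *]; lia.
  have [|||ey ei] := @small_cancel y1 y2 i1 i2; try lia.
    move=> k kL; rewrite -E1 -?E2; try lia.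
    by apply: W12; lia.
  have := E1 L (leqnn _); have := E2 L (leqnn _); rewrite subnK // -ey -ei => e2 e1.
  by rewrite e1 e2 eqxx in Wp.
have [rho1 [m1 lo1 hi1]] := D1; have [rho2 [m2 lo2 hi2]] := D2.
have r10 : (0 < rho1)%N by lia.
have r20 : (0 < rho2)%N by lia.
have b1 := match_left m1; have b2 := match_left m2.
have l1 := common_lt (match_neq m1); have l2 := common_lt (match_neq m2).
have g1 := match_lt m1 r10; have g2 := match_lt m2 r20.
have W0 j k : (j + L <= p)%N -> (k < L)%N -> nth a0 W1 (j + k) = nth a0 W2 (j + k).
  by move=> jp kL; apply: W12; lia.
(* A second center far before [p] would make one window outgoing for the second match and incoming
   for the first. *)
have [far|near2] := leqP (q2 + 2 * L) p.
  by case: (window_in_out m1 m2 r10 r20 (fun k => @W0 (p - 2 * L)%N k _)); lia.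
have [ed es] : d1 = d2 /\ (q1 + common d1 d1' = q2 + common d2 d2')%N.
  have [h|h] := leqP p (q2 + L).
    by apply: (window_in_in m1 m2 r10 r20 (fun k => @W0 (p - 2 * L)%N k _)); lia.
  by apply: (window_in_in m1 m2 r10 r20 (fun k => @W0 (p - 3 * L)%N k _)); lia.
split=> //; subst d2.
have [q12|q21|q12] := ltngtP q1 q2.
- have [q1p|pq1] := ltnP q1 p; last by apply: Or32; lia.
  by case: (match_no_turn m1 m2 r10 r20 (W12 _ q1p) q12 _ es); lia.
- have q2p : (q2 < p)%N by lia.
  by case: (match_no_turn m2 m1 r20 r10 (esym (W12 _ q2p)) q21 _ (esym es)); lia.
- by apply: Or31; lia.
Qed.

Lemma match_rev d d' W q rho :
  matches d d' W q rho -> matches d' d (wordV W) (size W - q) rho.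
Proof.
case=> h0 h00 h1 h2 h3 h4 h5; split.
- by rewrite eq_sym.
- by rewrite (fconnect_sym (@vertex_rot_inj Y)).
- by rewrite commonC.
- lia.
- by rewrite size_wordV; lia.
- move=> k kr; rewrite nth_wordV; last by lia.
  by rewrite letterVK commonC -h5 //; congr nth; lia.
- move=> k kr; rewrite nth_wordV; last by lia.
  by rewrite commonC -h4 //; congr (letterV (nth _ _ _)); lia.
Qed.

(** Both legs are read outwards from the junction, which is at position [size a]. *)
Definition turn a b := wordV a ++ b.

Lemma turn_rev a b : wordV (turn a b) = turn b a.
Proof. by rewrite /turn wordV_cat wordVK. Qed.

Lemma size_turn a b : size (turn a b) = (size a + size b)%N.
Proof. by rewrite size_cat size_wordV. Qed.

Lemma turnl a b i : (i < size a)%N -> nth a0 (turn a b) i = letterV (nth a0 a (size a - i.+1)).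
Proof. by move=> ia; rewrite nth_cat size_wordV ia nth_wordV. Qed.

Lemma turnr a b i : nth a0 (turn a b) (size a + i) = nth a0 b i.
Proof. by rewrite nth_cat size_wordV ltnNge leq_addr /= addKn. Qed.

Lemma match_turn_rev d d' a b q rho : matches d d' (turn a b) q rho ->
  matches d' d (turn b a) (size a + size b - q) rho.
Proof. by move/match_rev; rewrite turn_rev size_turn. Qed.

Lemma deep_turn_rev d d' a b q : deep d d' (turn a b) q (size a) ->
  deep d' d (turn b a) (size a + size b - q) (size b).
Proof.
case=> rho [m lo hi]; exists rho; have := match_left m; have := match_right m.
by rewrite size_turn => mr ml; split; [exact: match_turn_rev | lia | lia].
Qed.

Definition reads a i d j m :=
  (i + m <= size a)%N /\ forall k, (k < m)%N -> nth a0 a (i + k) = O d (j + k).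

(* The legs [a], [b], [c] of a tripod are read along [x], [y], [z], and its center
   is the point where [y] and [z] part, [k] letters after they part from [x]. *)
Record tripod_at_vertex a b c x y z k : Prop := TripodAtVertex {
  tripod_xy : x != y; tripod_xz : x != z; tripod_yz : y != z;
  tripod_cxy : fconnect vertex_rot x y; tripod_cxz : fconnect vertex_rot x z;
  tripod_sxz : common x z = common x y;
  tripod_syz : common y z = (common x y + k)%N;
  tripod_k : (k <= size a)%N;
  tripod_back : forall i, (i < k)%N ->
    letterV (nth a0 a (k - i.+1)) = O y (common x y + i) }.

Lemma tripod_swap a b c x y z k :
  tripod_at_vertex a b c x y z k -> tripod_at_vertex a c b x z y k.
Proof.
case=> xy xz yz cxy cxz sxz syz ka back; split=> //.
- by rewrite eq_sym.
- by rewrite commonC syz sxz.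
move=> i ik; rewrite back // sxz.
by apply: before_common; rewrite syz ltn_add2l.
Qed.

(** For the leg along [x], the dart that parts first, the center of the turn is [k] letters before
    the junction. The stretch between them is read along [y] anyway, so a match decouples into one
    condition on each leg. *)
Lemma match_turn_odd a b c x y z k rho : tripod_at_vertex a b c x y z k ->
  (k <= rho)%N -> matches x y (turn a b) (size a - k) rho <->
  [/\ (rho <= N - common x y)%N, reads a k x (common x y) rho &
     reads b 0 y (common x y + k) (rho - k)].
Proof.
case=> xy _ _ cxy _ _ _ ka back kr; split.
  case=> _ _ h1 h2; rewrite size_turn => h3 h4 h5; split=> //.
    split=> [|i ir]; first by lia.
    rewrite -h4 // turnl ?letterVK; last by lia.
    by congr nth; lia.
  split=> [|i ir]; first by lia.
  rewrite -addnA -h5; last by lia.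
  by rewrite add0n -(turnr a b); congr nth; lia.
case=> h1 [h2 h3] [h4 h5]; split=> //; first by lia.
- by rewrite size_turn; lia.
- move=> i ir; rewrite turnl; last by lia.
  by rewrite letterVK -h3 //; congr nth; lia.
- move=> i ir; have [ik|ki] := ltnP i k.
    rewrite turnl; last by lia.
    by rewrite -back //; congr (letterV (nth _ _ _)); lia.
  have -> : (size a - k + i = size a + (i - k))%N by lia.
  by rewrite turnr -[(i - k)%N]add0n h5; [congr O|]; lia.
Qed.

(** The turn between the two darts that part last is centered at the junction, with [k] letters less
    on each side. *)
Lemma match_turn_even a b c x y z k rho : tripod_at_vertex a b c x y z k ->
  matches y z (turn b c) (size b) rho <->
  [/\ (rho <= N - common x y - k)%N, reads b 0 y (common x y + k) rho &
     reads c 0 z (common x y + k) rho].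
Proof.
case=> xy xz yz cxy cxz _ syz ka back; split.
  case=> _ _; rewrite syz size_turn => h1 h2 h3 h4 h5; split.
  - by rewrite -subnDA.
  - split=> // i ir; rewrite -h4 // turnl ?letterVK; last by lia.
    by congr nth; lia.
  - split=> [|i ir]; first by lia.
    by rewrite -h5 // turnr.
case=> h1 [h2 h3] [h4 h5]; split=> //.
- apply: connect_trans cxz; by rewrite (fconnect_sym (@vertex_rot_inj Y)).
- by rewrite syz subnDA.
- by rewrite size_turn; lia.
- move=> i ir; rewrite turnl; last by lia.
  by rewrite letterVK syz -h3 //; congr nth; lia.
- by move=> i ir; rewrite turnr syz -h5.
Qed.

Definition deep_tripod a b c x y z k := tripod_at_vertex a b c x y z k /\
  exists rho, [/\ (3 * L + k <= rho)%N, (rho <= N - common x y)%N,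
    reads a k x (common x y) rho, reads b 0 y (common x y + k) (rho - k) &
    reads c 0 z (common x y + k) (rho - k)].

Lemma reads_sub a i d j m m' : (m' <= m)%N -> reads a i d j m -> reads a i d j m'.
Proof. by move=> mm [h1 h2]; split=> [|k km]; [lia | apply: h2; lia]. Qed.

(** By [deep_diverge] the two centers coincide, or one is the junction and the other lies beyond it.
    In the first case [a] is the leg that parts first; in the second it is the leg containing the
    farther center. *)
Lemma deep_tripodP a b c d1 d1' d2 d2' q1 q2 :
  deep d1 d1' (turn a b) q1 (size a) -> deep d2 d2' (turn a c) q2 (size a) ->
  nth a0 b 0 != nth a0 c 0 ->
  exists x y z k, [\/ deep_tripod a b c x y z k, deep_tripod b a c x y z k |
                      deep_tripod c a b x y z k].
Proof.
have case2 e1 e1' e2 e2' a' b' c' p1 p2 :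
    deep e1 e1' (turn a' b') p1 (size a') -> deep e2 e2' (turn a' c') p2 (size a') ->
    e1 = e2 -> (p1 + common e1 e1' = p2 + common e2 e2')%N ->
    p1 = size a' -> (size a' < p2)%N ->
    exists x y z k, deep_tripod c' a' b' x y z k.
  move=> [rho1 [m1 lo1 hi1]] [rho2 [m2 lo2 hi2]] ed es ep ltp; subst e2 p1.
  have [ne1 cn1 hf1 ml1 mr1 mi1 mo1] := m1.
  have [ne2 cn2 hf2 ml2 mr2 mi2 mo2] := m2.
  rewrite size_turn in mr1; rewrite size_turn in mr2.
  pose k := (p2 - size a')%N.
  have se : common e1 e1' = (common e1 e2' + k)%N by lia.
  have lt1 := common_lt ne1.
  have sxz : common e2' e1' = common e1 e2'.
    apply: common_eq; first by lia.
      move=> i ik; rewrite -(@before_common e1 e2') //.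
      by apply: before_common; lia.
    rewrite -(@before_common e1 e1'); last by lia.
    by rewrite eq_sym; apply: at_common; lia.
  have yz : e2' != e1'.
    by apply/eqP => e21; rewrite e21 in se; lia.
  have T : tripod_at_vertex c' a' b' e2' e1 e1' k.
    split.
    - by rewrite eq_sym.
    - by [].
    - by [].
    - by rewrite (fconnect_sym (@vertex_rot_inj Y)).
    - apply: connect_trans cn1; by rewrite (fconnect_sym (@vertex_rot_inj Y)).
    - by rewrite sxz commonC.
    - by rewrite commonC in se *; rewrite [common e2' _]commonC.
    - lia.
    - move=> i ik; rewrite commonC -mi2; last by lia.
      by congr letterV; rewrite -(turnr a' c'); congr nth; lia.
  exists e2', e1, e1', k; split=> //.
  exists (minn rho2 (rho1 + k)); rewrite [common e2' e1]commonC; split; try lia.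
  - split=> [|i ir]; first by lia.
    rewrite -mo2; last by lia.
    by rewrite -(turnr a' c'); congr nth; lia.
  - split=> [|i ir]; first by lia.
    rewrite -se -mi1; last by lia.
    rewrite turnl; last by lia.
    by rewrite letterVK; congr nth; lia.
  - split=> [|i ir]; first by lia.
    rewrite -se -mo1; last by lia.
    by rewrite turnr.
move=> D1 D2 bc.
have W12 k : (k < size a)%N -> nth a0 (turn a b) k = nth a0 (turn a c) k.
  by move=> ka; rewrite !turnl.
have Wp : nth a0 (turn a b) (size a) != nth a0 (turn a c) (size a).
  by rewrite -[size a]addn0 !turnr.
have [ed es [[eq qp]|[eq qp]|[eq qp]]] := deep_diverge D1 D2 W12 Wp; last first.
- have [x [y [z [k T]]]] := case2 _ _ _ _ _ _ _ _ _ D2 D1 (esym ed) (esym es) eq qp.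
  by exists x, y, z, k; apply: Or32.
- have [x [y [z [k T]]]] := case2 _ _ _ _ _ _ _ _ _ D1 D2 ed es eq qp.
  by exists x, y, z, k; apply: Or33.
subst d2 q2; have {}es : common d1 d2' = common d1 d1' by lia.
have [rho1 [m1 lo1 hi1]] := D1; have [rho2 [m2 lo2 hi2]] := D2.
have [ne1 cn1 hf1 ml1 mr1 mi1 mo1] := m1.
have [ne2 cn2 hf2 ml2 mr2 mi2 mo2] := m2.
rewrite size_turn in mr1; rewrite size_turn in mr2.
have lt1 := common_lt ne1.
pose k := (size a - q1)%N.
have qk : (q1 + k = size a)%N by rewrite /k; lia.
have d12 : O d1' (common d1 d1' + k) != O d2' (common d1 d1' + k).
  by rewrite -mo1 -1?es -?mo2 ?qk //; lia.
have syz : common d1' d2' = (common d1 d1' + k)%N.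
  apply: common_eq => //; first by lia.
  move=> i ik; have [ic|ci] := ltnP i (common d1 d1').
    rewrite -(@before_common d1 d1') // -(@before_common d1 d2') // es //.
  have [j ij] : exists j, i = (common d1 d1' + j)%N.
    by exists (i - common d1 d1')%N; lia.
  rewrite ij in ik *; rewrite -mo1; last by lia.
  rewrite -es -mo2; last by lia.
  by apply: W12; lia.
have T : tripod_at_vertex a b c d1 d1' d2' k.
  split=> //.
  - by apply: contraNneq d12 => ->.
  - by rewrite /k; lia.
  - move=> i ik; rewrite -mo1; last by lia.
    rewrite turnl; last by lia.
    by congr (letterV (nth _ _ _)); lia.
exists d1, d1', d2', k; apply: Or31; split=> //.
exists (minn rho1 rho2); split; try lia.
- split=> [|i ir]; first by lia.
  rewrite -mi1; last by lia.
  rewrite turnl; last by lia.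
  by rewrite letterVK; congr nth; lia.
- split=> [|i ir]; first by lia.
  rewrite -addnA -mo1; last by lia.
  by rewrite add0n -(turnr a b); congr nth; lia.
- split=> [|i ir]; first by lia.
  rewrite -es -addnA -mo2; last by lia.
  by rewrite add0n -(turnr a c); congr nth; lia.
Qed.

End Matches.

(** * Tripods *)

Ltac nat_lia := repeat match goal with
  | H : is_true (Order.le _ _) |- _ => clear H
  | H : is_true (Order.lt _ _) |- _ => clear H
  | H : is_true (negb (_ == _)) |- _ => clear H
  | H : forall _, _ |- _ => clear H
  end; lia.

Section StackWeights.
Variables (R : realType) (eps : R).
Hypotheses (eps0 : 0 < eps) (eps1 : eps <= 2^-1).

Let e10 : 0 < 1 - eps. Proof. have := eps1; lra. Qed.

Lemma stack_cdf0 h : stack_cdf eps h 0 = 0.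
Proof. by rewrite /stack_cdf mul0r min_r. Qed.

Lemma stack_cdfS h : (0 < h)%N -> stack_cdf eps h h = 1.
Proof.
move=> h0; have h0' : 0 < h%:R :> R by rewrite ltr0n.
rewrite /stack_cdf min_l // ler_pdivlMr ?mulr_gt0 // mul1r.
by rewrite ler_piMl ?(ltW h0') //; have := eps0; lra.
Qed.

Lemma stack_cdf_le1 h j : stack_cdf eps h j <= 1.
Proof. by rewrite /stack_cdf ge_min lexx. Qed.

Lemma stack_cdf_ge0 h j : 0 <= stack_cdf eps h j.
Proof. by rewrite /stack_cdf le_min ler01 divr_ge0 ?mulr_ge0 ?(ltW e10). Qed.

Lemma stack_cdf_mono h j j' : (j <= j')%N -> stack_cdf eps h j <= stack_cdf eps h j'.
Proof.
move=> jj; rewrite /stack_cdf le_min ge_min lexx /= ge_min; apply/orP; right.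
by rewrite ler_wpM2r ?ler_nat // invr_ge0 mulr_ge0 ?(ltW e10).
Qed.

Lemma stack_weight_ge0 h f : 0 <= stack_weight eps h f.
Proof. by rewrite subr_ge0 stack_cdf_mono. Qed.

Lemma stack_weight_le h f : (0 < h)%N -> stack_weight eps h f <= 2 / h%:R.
Proof.
move=> h0; have h0' : 0 < h%:R :> R by rewrite ltr0n.
have iv : 0 < ((1 - eps) * h%:R)^-1 by rewrite invr_gt0 mulr_gt0.
have iv2 : ((1 - eps) * h%:R)^-1 <= 2 / h%:R.
  rewrite invfM ler_wpM2r ?invr_ge0 ?(ltW h0') //.
  by rewrite -[leLHS]mul1r ler_pdivrMr //; have := eps1; lra.
rewrite /stack_weight /stack_cdf -natr1 mulrDl mul1r.
move: (f%:R / _) => y; move: iv iv2; move: (_^-1) (2 / _) => z u z0 zu.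
by case: (leP 1 (y + z)) => ?; case: (leP 1 y) => ?; lra.
Qed.

(** This is the purpose of truncating at [eps]: subwords that carry weight keep more than the
    fraction [eps] of the half-length. *)
Lemma stack_weight_neq0 h f : (0 < h)%N -> stack_weight eps h f != 0 ->
  eps * h%:R < h%:R - f%:R.
Proof.
move=> h0; have h0' : 0 < h%:R :> R by rewrite ltr0n.
apply: contraNT; rewrite -leNgt => fh.
have ge1 j : f%:R <= j%:R :> R -> stack_cdf eps h j = 1.
  move=> fj; rewrite /stack_cdf min_l // ler_pdivlMr ?mulr_gt0 // mul1r.
  by rewrite mulrBl mul1r; lra.
by rewrite /stack_weight !ge1 ?subrr ?ler_nat.
Qed.

Lemma sum_stack_weight h j : (j <= h)%N -> (0 < h)%N ->
  \sum_(f < h) stack_weight eps h f * (j <= f)%N%:R = 1 - stack_cdf eps h j.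
Proof.
move=> jh h0.
have tel i : \sum_(f < i) stack_weight eps h f * (j <= f)%N%:R =
   if (j <= i)%N then stack_cdf eps h i - stack_cdf eps h j else 0.
  elim: i => [|i IH].
    by rewrite big_ord0; case: j {jh} => // ; rewrite subrr.
  rewrite big_ord_recr /= IH /stack_weight; have [ji|ij] := leqP j i.
    by rewrite (leq_trans ji) // mulr1; ring.
  rewrite mulr0 addr0; have [->|ne] := eqVneq j i.+1; first by rewrite leqnn subrr.
  by rewrite ifN // -ltnNge; lia.
by rewrite tel jh stack_cdfS.
Qed.

Lemma count_range h lo m : (\sum_(f < h) ((lo <= f) && (f < lo + m)) <= m)%N.
Proof.
have -> : (\sum_(f < h) ((lo <= f) && (f < lo + m)) =
           size [seq f <- iota 0 h | (lo <= f) && (f < lo + m)])%N.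
  rewrite size_filter -sum1_count [RHS]big_mkcond -[in RHS](subn0 h) -/(index_iota 0 h).
  by rewrite big_mkord /=; apply: eq_bigr => f _; case: andb.
rewrite -[leqRHS](size_iota lo); apply: uniq_leq_size.
  by rewrite filter_uniq ?iota_uniq.
by move=> f; rewrite mem_filter !mem_iota => /andP[].
Qed.

End StackWeights.

(** On the share [1 - G] of the cuts all three turns are read, with total coefficient [s]; on the
    share [G - t] only one is, with coefficient at most [3 - 2 * d]. The slack [2 * d * G] pays for
    the error [er] due to unequal half-lengths. *)
Lemma tripod_inequality (R : realFieldType) (d theta s w w' G t er : R) :
  `|s| <= 3 -> `|w| <= 3 - 2 * d -> `|w'| <= 3 -> 0 <= t <= G -> G <= 1 ->
  `|er| <= theta * G -> 3 * theta <= 2 * d ->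
  `|s * (1 - G) + w * (G - t) + w' * er| <= 3.
Proof.
move=> s3 wd w'3 /andP[t0 tG] G1 erG th.
have G0 : 0 <= G by apply: le_trans tG.
have w0 : 0 <= 3 - 2 * d by apply: le_trans wd.
have A : `|s * (1 - G)| <= 3 * (1 - G).
  by rewrite normrM [`|1 - G|]ger0_norm ?subr_ge0 // ler_wpM2r ?subr_ge0.
have B : `|w * (G - t)| <= (3 - 2 * d) * G.
  rewrite normrM [`|G - t|]ger0_norm ?subr_ge0 //; apply: ler_pM => //; last by lra.
  by rewrite subr_ge0.
have C : `|w' * er| <= 2 * d * G.
  rewrite normrM; apply: (@le_trans _ _ (3 * (theta * G))); first exact: ler_pM.
  by rewrite mulrA ler_wpM2r.
apply: le_trans (ler_normD _ _) _; have := ler_normD (s * (1 - G)) (w * (G - t)).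
lra.
Qed.

Lemma sumr_neq0 (R : numDomainType) (I : finType) (F : I -> R) :
  \sum_i F i != 0 -> exists i, F i != 0.
Proof.
move=> S0; apply: contrapT => no; move/eqP: S0; apply; apply: big1 => i _.
by apply/eqP; apply: contrapT => /negP Fi; apply: no; exists i.
Qed.

Lemma sumr_le_single (R : numDomainType) (I : finType) (P : pred I) (F : I -> R) B :
  0 <= B -> (forall i, P i -> F i <= B) ->
  (forall i j, P i -> P j -> F i != 0 -> F j != 0 -> i = j) -> \sum_(i | P i) F i <= B.
Proof.
move=> B0 FB uniqF; have [[i [Pi Fi]]|no] := pselect (exists i, P i /\ F i != 0).
  rewrite (bigD1 i) //= big1 ?addr0 ?FB // => j /andP[Pj ji].
  by apply/eqP; apply: contraNT ji => Fj; apply/eqP; apply: uniqF.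
rewrite big1 // => i Pi; apply/eqP; apply: contrapT => /negP Fi.
by apply: no; exists i.
Qed.

Section TripodBound.
Variables (R : realType) (eps V : R).
Variables (r n N L : nat) (Y : fatgraph) (O : Y -> nat -> letter r) (a0 : letter r).
Local Notation e := (@edge_rev Y).
Hypotheses (OV : forall d i, (i < n)%N -> O (e d) i = letterV (O d (n.-1 - i)))
  (Ored : forall d i, (i.+1 < n)%N -> O d i.+1 != letterV (O d i)).
Hypothesis small_cancel : forall d d' i i', (i + L <= n)%N -> (i' + L <= n)%N ->
  (forall k, (k < L)%N -> O d (i + k) = O d' (i' + k)) -> d = d' /\ i = i'.
Hypotheses (L0 : (0 < L)%N) (LN : (3 * L <= N)%N) (Nn : (N.*2 <= n)%N).
Hypotheses (eps0 : 0 < eps) (eps1 : eps <= 2^-1).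
Hypothesis epsN : (5 * L)%:R <= eps * (N - L)%N%:R.
Hypotheses (V3 : 3 <= V) (VN : 12 * V * L%:R <= (N - L)%N%:R).
Variable om : Y -> Y -> R.
Hypotheses (omC : forall x y, om y x = - om x y)
  (om_le : forall x y, `|om x y| <= 3 - 6 / V)
  (om_sum : forall x y z, x != y -> x != z -> y != z ->
     fconnect vertex_rot x y -> fconnect vertex_rot x z ->
     `|om x y + om y z + om z x| <= 3).
Implicit Types (x y z d : Y) (W a b c : seq (letter r)) (p q : nat).

Local Notation common := (common n O).
Local Notation matches := (matches n N O a0).
Local Notation deep := (deep n N L O a0).

(** The stack weight of those subwords of the turn from [d] to [d'] that occur in [W] centered at
    [q] and run across position [p]. *)
Definition match_mass W p d d' q : R :=
  \sum_(f < N - common d d') stack_weight eps (N - common d d') f *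
    [&& `[< matches d d' W q (N - common d d' - f) >],
        (q < p + (N - common d d' - f))%N & (p < q + (N - common d d' - f))%N]%:R.

(** The failure of additivity at the junction; see [stack_sum_cat]. *)
Definition crossing a b : R :=
  \sum_(z : Y * Y * 'I_(size a + size b).+1)
     om z.1.1 z.1.2 * match_mass (turn a b) (size a) z.1.1 z.1.2 z.2.

Let V0 : 0 < V. Proof. by apply: lt_le_trans V3. Qed.

Let NL0 : (0 < N - L)%N. Proof. by have := L0; have := LN; nat_lia. Qed.

Let NL0' : 0 < (N - L)%N%:R :> R. Proof. by rewrite ltr0n. Qed.

Let half_gt d d' : d != d' -> (N - L < N - common d d')%N.
Proof. by move/(common_lt small_cancel L0 LN Nn); have := LN; have := L0; nat_lia. Qed.

Let weight_range d d' f : d != d' ->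
  stack_weight eps (N - common d d') f != 0 -> (5 * L <= N - common d d' - f)%N.
Proof.
move=> /half_gt hg w0; have h0 : (0 < N - common d d')%N by nat_lia.
have := stack_weight_neq0 eps1 h0 w0; set h := (N - common d d')%N in hg h0 w0 *.
have : eps * (N - L)%N%:R <= eps * h%:R by rewrite ler_wpM2l ?ler_nat ?(ltW eps0) // ltnW.
move=> e1 e2; have : (5 * L + f)%:R < h%:R :> R by rewrite natrD; have := epsN; lra.
by rewrite ltr_nat; nat_lia.
Qed.

Lemma match_mass_ge0 W p d d' q : 0 <= match_mass W p d d' q.
Proof.
by apply: sumr_ge0 => f _; rewrite mulr_ge0 ?stack_weight_ge0.
Qed.

Lemma match_mass_neq0 W p d d' q : match_mass W p d d' q != 0 ->
  exists rho, [/\ matches d d' W q rho, (q < p + rho)%N, (p < q + rho)%N & (5 * L <= rho)%N].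
Proof.
case/sumr_neq0 => f; case: and3P => [[/asboolP m c1 c2]|_]; last by rewrite mulr0 eqxx.
rewrite mulr1 => w0; exists (N - common d d' - f)%N; split=> //.
exact: weight_range (match_neq m) w0.
Qed.

Lemma match_mass_le1 W p d d' q : match_mass W p d d' q <= 1.
Proof.
have [->//|/match_mass_neq0[rho [m _ _ _]]] := eqVneq (match_mass W p d d' q) 0.
have h0 : (0 < N - common d d')%N by have := half_gt (match_neq m); nat_lia.
rewrite (_ : 1 = 1 - stack_cdf eps (N - common d d') 0); last by rewrite stack_cdf0 subr0.
rewrite -sum_stack_weight //; apply: ler_sum => f _.
by apply: ler_wpM2l; rewrite ?stack_weight_ge0 //; case: [&& _, _ & _].
Qed.

Lemma deep_mass W p d d' q d1 d1' q1 : deep d d' W q p ->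
  match_mass W p d1 d1' q1 != 0 -> [/\ d = d1, d' = d1' & q = q1].
Proof.
case=> rho [m lo hi] /match_mass_neq0[rho1 [m1 c1 c2 L1]].
have u := match_unique OV small_cancel L0 LN Nn m m1; have := L0 => L0'.
have [pq|qp] := leqP p q1; first by apply: (u p); nat_lia.
have ml := match_left m; have ml1 := match_left m1.
by apply: (u (p - 3 * L)%N); nat_lia.
Qed.

(** Without a deep match, the radius of a subword across [p] exceeds the distance from [p] to [q] by
    less than [3 L]. This leaves at most [3 L] values of [f], each of weight at most
    [2 / (N - L)]. *)
Lemma shallow_mass W p d d' q : ~ deep d d' W q p ->
  match_mass W p d d' q <= 6 * L%:R / (N - L)%N%:R.
Proof.
move=> nd; have [->|m0] := eqVneq (match_mass W p d d' q) 0.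
  by rewrite divr_ge0 ?mulr_ge0.
have [rho [m _ _ _]] := match_mass_neq0 m0.
have hg := half_gt (match_neq m); have dd := match_neq m.
rewrite /match_mass; have wr f := @weight_range d d' f dd; move: hg wr.
set h := (N - common d d')%N => hg wr.
have h0 : (0 < h)%N by nat_lia.
pose lo := (h - ((p - q) + (q - p)) - 3 * L)%N.
apply: (@le_trans _ _ (\sum_(f < h) 2 / (N - L)%N%:R * ((lo <= f)%N && (f < lo + 3 * L)%N)%:R)).
  apply: ler_sum => f _; have [->|w0] := eqVneq (stack_weight eps h f) 0.
    by rewrite mul0r mulr_ge0 // divr_ge0.
  have L5 := wr _ w0; have := L0 => L0'.
  case: and3P => [[/asboolP mf c1 c2]|_]; last by rewrite mulr0 mulr_ge0 // divr_ge0.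
  have -> : ((lo <= f) && (f < lo + 3 * L))%N.
    have fh := ltn_ord f; have mfl := match_left mf.
    have : ~~ ((q + 3 * L <= p + (h - f)) && (p + 3 * L <= q + (h - f)))%N.
      by apply/negP => /andP[c3 c4]; apply: nd; exists (h - f)%N.
    by rewrite /lo; nat_lia.
  rewrite !mulr1; apply: le_trans (stack_weight_le eps1 _ h0) _.
  rewrite ler_wpM2l // lef_pV2 ?posrE ?ltr0n // ler_nat; exact: ltnW.
rewrite -mulr_sumr -natr_sum.
have -> : 6 * L%:R / (N - L)%N%:R = 2 / (N - L)%N%:R * (3 * L)%:R :> R.
  by rewrite natrM; field; rewrite gt_eqF.
by rewrite ler_wpM2l ?divr_ge0 // ler_nat count_range.
Qed.

Lemma mass_unique_right W p d d' q d1 d1' q1 : (p <= q)%N -> (p <= q1)%N ->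
  match_mass W p d d' q != 0 -> match_mass W p d1 d1' q1 != 0 ->
  [/\ d = d1, d' = d1' & q = q1].
Proof.
move=> pq pq1 /match_mass_neq0[rho [m c1 c2 L5]] /match_mass_neq0[rho1 [m1 c3 c4 L6]].
have := L0 => L0'.
by apply: (match_unique OV small_cancel L0 LN Nn m m1 (lo := p)); nat_lia.
Qed.

Lemma mass_unique_left W p d d' q d1 d1' q1 : (q < p)%N -> (q1 < p)%N ->
  match_mass W p d d' q != 0 -> match_mass W p d1 d1' q1 != 0 ->
  [/\ d = d1, d' = d1' & q = q1].
Proof.
move=> pq pq1 /match_mass_neq0[rho [m c1 c2 L5]] /match_mass_neq0[rho1 [m1 c3 c4 L6]].
have := L0 => L0'; have ml := match_left m.
by apply: (match_unique OV small_cancel L0 LN Nn m m1 (lo := (p - 3 * L)%N)); nat_lia.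
Qed.

Lemma crossing_deep a b d d' q : deep d d' (turn a b) q (size a) ->
  crossing a b = om d d' * match_mass (turn a b) (size a) d d' q.
Proof.
move=> D; have [rho [m _ _]] := D; have := match_right m.
have := L0 => L0'; rewrite size_turn => mr.
have qs : (q < (size a + size b).+1)%N by nat_lia.
rewrite /crossing (bigD1 (d, d', Ordinal qs)) //= big1 ?addr0 // => -[[d1 d1'] q1] /= ne.
have [->|m0] := eqVneq (match_mass (turn a b) (size a) d1 d1' q1) 0; first by rewrite mulr0.
have [e1 e2 e3] := deep_mass D m0; case/eqP: ne; rewrite e1 e2; congr (_, _).
exact: val_inj.
Qed.

(** At most one match on each side of the junction has mass, so the total is at most
    [36 L / (N - L)]; this is where the [12] in [VN] comes from. *)
Lemma crossing_shallow a b : (forall d d' q, ~ deep d d' (turn a b) q (size a)) ->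
  `|crossing a b| <= 3 / V.
Proof.
move=> nd; rewrite /crossing; apply: le_trans (ler_norm_sum _ _ _) _.
have B0 : 0 <= 6 * L%:R / (N - L)%N%:R :> R by rewrite divr_ge0 ?mulr_ge0.
have V6 : 0 < 6 / V by rewrite divr_gt0.
pose F (z : Y * Y * 'I_(size a + size b).+1) :=
  match_mass (turn a b) (size a) z.1.1 z.1.2 z.2.
pose P (z : Y * Y * 'I_(size a + size b).+1) := (size a <= z.2)%N.
apply: (@le_trans _ _ (\sum_t 3 * F t)).
  apply: ler_sum => z _; rewrite normrM [`|match_mass _ _ _ _ _|]ger0_norm ?match_mass_ge0 //.
  rewrite ler_wpM2r ?match_mass_ge0 //; apply: le_trans (om_le _ _) _; lra.
rewrite -mulr_sumr (bigID P) /=.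
have S1 : \sum_(t | P t) F t <= 6 * L%:R / (N - L)%N%:R.
  apply: sumr_le_single => // [z _|[[x y] q] [[x' y'] q'] /= p1 p2 f1 f2].
    exact/shallow_mass/nd.
  by have /= [-> -> e3] := mass_unique_right p1 p2 f1 f2; congr (_, _); apply: val_inj.
have S2 : \sum_(t | ~~ P t) F t <= 6 * L%:R / (N - L)%N%:R.
  apply: sumr_le_single => // [z _|[[x y] q] [[x' y'] q'] /=].
    exact/shallow_mass/nd.
  rewrite /P -!ltnNge => p1 p2 f1 f2.
  by have /= [-> -> e3] := mass_unique_left p1 p2 f1 f2; congr (_, _); apply: val_inj.
apply: (@le_trans _ _ (36 * L%:R / (N - L)%N%:R)); first by move: S1 S2; rewrite -!mulrA; lra.
rewrite ler_pdivrMr // mulrAC ler_pdivlMr //.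
have := VN; lra.
Qed.

Lemma crossing_deep_le a b d d' q : deep d d' (turn a b) q (size a) ->
  `|crossing a b| <= 3 - 6 / V.
Proof.
move/crossing_deep->; rewrite normrM [`|match_mass _ _ _ _ _|]ger0_norm ?match_mass_ge0 //.
apply: le_trans (om_le d d'); by rewrite ler_piMr ?match_mass_le1.
Qed.

Lemma crossing_rev a b : crossing b a = - crossing a b.
Proof.
rewrite /crossing -sumrN.
pose F (z : Y * Y * 'I_(size a + size b).+1) : Y * Y * 'I_(size b + size a).+1 :=
  (z.1.2, z.1.1, cast_ord (congr1 S (addnC _ _)) (rev_ord z.2)).
have Fbij : bijective F.
  exists (fun t : Y * Y * 'I_(size b + size a).+1 => (t.1.2, t.1.1, cast_ord (congr1 S (addnC _ _)) (rev_ord t.2))).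
    case=> [[x y] [q qs]]; congr (_, _); apply: val_inj => /=; move: qs.
    by rewrite [(size b + _)%N]addnC; move: (size a + size b)%N => *; nat_lia.
  case=> [[x y] [q qs]]; congr (_, _); apply: val_inj => /=; move: qs.
  by rewrite [(size b + _)%N]addnC; move: (size a + size b)%N => *; nat_lia.
rewrite (reindex F) /=; last exact: onW_bij.
apply: eq_bigr => -[[x y] q] _ /=; rewrite omC mulNr; congr (- (_ * _)).
rewrite /match_mass [common y x]commonC; apply: eq_bigr => f _; congr (_ * (nat_of_bool _)%:R).
case: q => q qs /=; move: (N - _ - f)%N => rho.
have -> : ((size a + size b).+1 - q.+1 < size b + rho)%N = (size a < q + rho)%N.
  by move: (size a) (size b) qs => *; nat_lia.
have -> : (size b < (size a + size b).+1 - q.+1 + rho)%N = (q < size a + rho)%N.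
  by move: (size a) (size b) qs => *; nat_lia.
congr (_ && _); last exact: andbC.
rewrite subSS; apply/asboolP/asboolP => m; have := match_turn_rev L0 LN Nn m => //.
by rewrite [(size b + _)%N]addnC subKn.
Qed.

Let min_index (Q : nat -> Prop) f0 : Q f0 ->
  (forall f f', (f <= f')%N -> Q f -> Q f') ->
  exists2 j, (j <= f0)%N & forall f, Q f <-> (j <= f)%N.
Proof.
move=> Q0 mono.
have ex : exists f, `[< Q f >] by exists f0; apply/asboolP.
exists (ex_minn ex); case: ex_minnP => j /asboolP Qj minj.
  by apply: minj; apply/asboolP.
by move=> f; split=> [Qf|/mono]; [apply: minj; apply/asboolP | apply].
Qed.

Let theta : R := L%:R / (N - L)%N%:R.

(** The mismatch between turns of unequal length, measured on cut probabilities. *)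
Let cdf_compare h k j : (k < L)%N -> (N - L < h - k)%N ->
  stack_cdf eps h j <= stack_cdf eps (h - k) j <= (1 + theta) * stack_cdf eps h j.
Proof.
move=> kL hk; have K0 : 0 < (h - k)%N%:R :> R by rewrite ltr0n; nat_lia.
have H0 : 0 < h%:R :> R by rewrite ltr0n; nat_lia.
have e1 : 0 < 1 - eps by have := eps1; lra.
have hk' : (h - k)%N%:R <= h%:R :> R by rewrite ler_nat leq_subr.
have th0 : 0 <= theta by rewrite divr_ge0.
have ht : h%:R <= (1 + theta) * (h - k)%N%:R.
  have -> : h%:R = (h - k)%N%:R + k%:R :> R by rewrite -natrD subnK //; nat_lia.
  rewrite mulrDl mul1r lerD2l mulrAC ler_pdivlMr //; rewrite -!natrM ler_nat.
  by apply: leq_mul; nat_lia.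
have y0 : 0 <= j%:R / (1 - eps) by rewrite divr_ge0 // ltW.
rewrite /stack_cdf !invfM !mulrA; move: (j%:R / _) y0 => y y0.
have le1 : y / h%:R <= y / (h - k)%N%:R by rewrite ler_wpM2l // lef_pV2 ?posrE.
have le2 : y / (h - k)%N%:R <= (1 + theta) * (y / h%:R).
  rewrite ler_pdivrMr // [X in X <= _](_ : y = y / h%:R * h%:R); last first.
    by rewrite divfK // gt_eqF.
  by rewrite (mulrC (1 + theta)) -[X in _ <= X]mulrA ler_wpM2l // divr_ge0 // ltW.
have z0 : 0 <= y / h%:R by rewrite divr_ge0 // ltW.
move: (y / h%:R) (y / (h - k)%N%:R) z0 le1 le2 => u v u0 uv vu.
apply/andP; split; first by case: (leP 1 u) => ?; case: (leP 1 v) => ?; lra.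
by case: (leP 1 u) => ?; case: (leP 1 v) => ?; rewrite ?mulr1; lra.
Qed.

(** Each leg is read once [f] reaches a threshold of its own, and a turn once [f] reaches the larger
    threshold of its two legs. The three masses of a tripod thus depend on three numbers. *)
Lemma mass_odd a b c x y z k jA jB (s := common x y) (h := (N - s)%N) :
  tripod_at_vertex n O a0 a b c x y z k -> (k < L)%N -> (jA <= h)%N -> (jB <= h)%N ->
  (forall f, reads O a0 a k x s (h - f) <-> (jA <= f)%N) ->
  (forall f, reads O a0 b 0 y (s + k) (h - k - f) <-> (jB <= f)%N) ->
  match_mass (turn a b) (size a) x y (size a - k) = 1 - stack_cdf eps h (maxn jA jB).
Proof.
move=> T kL jAh jBh QA QB; have hg := half_gt (tripod_xy T).
rewrite -sum_stack_weight ?geq_max ?jAh //; last by rewrite /h /s; nat_lia.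
apply: eq_bigr => f _; rewrite -/h.
have [->|w0] := eqVneq (stack_weight eps h f) 0; first by rewrite !mul0r.
have L5 := weight_range (tripod_xy T) w0; rewrite -/s -/h in L5.
have ka := tripod_k T; have := L0 => L0'.
have kf : (k <= h - f)%N by apply: leq_trans L5; nat_lia.
have := @match_turn_odd r n N L Y O a0 L0 LN Nn a b c x y z k (h - f)%N T kf.
rewrite -/s -/h => M; congr (_ * (nat_of_bool _)%:R); rewrite geq_max.
apply/idP/idP.
  case/and3P=> /asboolP /M[_ ra rb] _ _; apply/andP; split; first exact/QA.
  by apply/QB; rewrite subnAC.
case/andP=> /QA ra /QB rb; apply/and3P; split; [|nat_lia|nat_lia].
by apply/asboolP/M; split=> //; [nat_lia | rewrite subnAC].
Qed.

Lemma mass_even a b c x y z k jB jC (s := common x y) (h := (N - s)%N) :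
  tripod_at_vertex n O a0 a b c x y z k -> (jB <= h - k)%N -> (jC <= h - k)%N ->
  (forall f, reads O a0 b 0 y (s + k) (h - k - f) <-> (jB <= f)%N) ->
  (forall f, reads O a0 c 0 z (s + k) (h - k - f) <-> (jC <= f)%N) ->
  match_mass (turn b c) (size b) y z (size b) = 1 - stack_cdf eps (h - k) (maxn jB jC).
Proof.
move=> T jBh jCh QB QC; have hg := half_gt (tripod_yz T).
have hk : (N - common y z = h - k)%N by rewrite (tripod_syz T) subnDA.
rewrite -sum_stack_weight ?geq_max ?jBh //; last by nat_lia.
rewrite /match_mass hk.
apply: eq_bigr => f _.
have [->|w0] := eqVneq (stack_weight eps (h - k) f) 0; first by rewrite !mul0r.
have := @weight_range y z f (tripod_yz T); rewrite hk => /(_ w0) L5.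
have := L0 => L0'.
have := @match_turn_even r n N L Y O a0 L0 LN Nn a b c x y z k (h - k - f)%N T.
rewrite -/s -/h => M; congr (_ * (nat_of_bool _)%:R); rewrite geq_max.
apply/idP/idP.
  by case/and3P=> /asboolP /M[_ rb rc] _ _; apply/andP; split; [apply/QB | apply/QC].
case/andP=> /QB rb /QC rc; apply/and3P; split; [|nat_lia|nat_lia].
by apply/asboolP/M; split=> //; nat_lia.
Qed.

(** Among the pairwise maxima of [jA], [jB], [jC] the two largest coincide. For equal half-lengths
    the sum would be [s (1 - G) + om' (G - t)], with [s] the sum of the coefficients; replacing [h]
    by [h - k] for the turn from [y] to [z] adds the error term of [tripod_inequality]. *)
Lemma deep_tripod_crossing a b c x y z k : deep_tripod n N L O a0 a b c x y z k ->
  `|crossing a b + crossing b c + crossing c a| <= 3.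
Proof.
case=> T [rho [rho3 rhoN ra rb rc]]; have := L0 => L0'.
have kL : (k < L)%N.
  have := common_lt small_cancel L0 LN Nn (tripod_yz T).
  by rewrite (tripod_syz T); nat_lia.
have T' := tripod_swap T; have sxz := tripod_sxz T; have ka := tripod_k T.
have kr : (k <= rho)%N by nat_lia.
have mab : matches x y (turn a b) (size a - k) rho.
  by apply/(match_turn_odd L0 LN Nn T kr).
have mac : matches x z (turn a c) (size a - k) rho.
  by apply/(match_turn_odd L0 LN Nn T' kr); rewrite sxz.
have mbc : matches y z (turn b c) (size b) (rho - k).
  by apply/(match_turn_even L0 LN Nn _ T); split=> //; nat_lia.
have Dab : deep x y (turn a b) (size a - k) (size a).
  by exists rho; split=> //; have := match_left mab; nat_lia.
have Dac : deep x z (turn a c) (size a - k) (size a).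
  by exists rho; split=> //; have := match_left mac; nat_lia.
have Dbc : deep y z (turn b c) (size b) (size b).
  by exists (rho - k)%N; split=> //; nat_lia.
rewrite (crossing_rev a c) (crossing_deep Dab) (crossing_deep Dac) (crossing_deep Dbc).
move: rhoN ra rb rc; set s := common x y => rhoN ra rb rc; pose h := (N - s)%N.
have hg : (N - L < h - k)%N.
  by have := half_gt (tripod_yz T); rewrite (tripod_syz T) -/s /h; nat_lia.
have rsub := @reads_sub r n N L Y O a0 L0 LN Nn.
have [jA jAr QA] : exists2 j, (j <= h - rho)%N &
    forall f, reads O a0 a k x s (h - f) <-> (j <= f)%N.
  apply: min_index; first by rewrite subKn.
  by move=> f f' ff; apply: rsub; nat_lia.
have kh : (h - k - (h - rho) = rho - k)%N by rewrite /h; nat_lia.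
have [jB jBr QB] : exists2 j, (j <= h - rho)%N &
    forall f, reads O a0 b 0 y (s + k) (h - k - f) <-> (j <= f)%N.
  apply: min_index; first by rewrite kh.
  by move=> f f' ff; apply: rsub; nat_lia.
have [jC jCr QC] : exists2 j, (j <= h - rho)%N &
    forall f, reads O a0 c 0 z (s + k) (h - k - f) <-> (j <= f)%N.
  apply: min_index; first by rewrite kh.
  by move=> f f' ff; apply: rsub; nat_lia.
rewrite (mass_odd T kL _ _ QA QB); try nat_lia.
rewrite (mass_even T _ _ QB QC); try nat_lia.
have -> : match_mass (turn a c) (size a) x z (size a - k) =
    1 - stack_cdf eps h (maxn jA jC).
  have := @mass_odd a c b x z y k jA jC T' kL; rewrite sxz -/s -/h; apply=> //; nat_lia.
rewrite -/s -/h.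
have th0 : 0 <= theta by rewrite divr_ge0.
have thV : 3 * theta <= 2 * (3 / V).
  have -> : 3 * theta = (3 * L%:R) / (N - L)%N%:R by rewrite /theta mulrA.
  rewrite ler_pdivrMr // mulrA mulrAC ler_pdivlMr //; have := VN; have := NL0'; lra.
have om3 u v : `|om u v| <= 3.
  by apply: le_trans (om_le _ _) _; rewrite gerBl divr_ge0 // ltW.
have om6 u v : `|om u v| <= 3 - 2 * (3 / V).
  by apply: le_trans (om_le _ _) _; rewrite mulrA -natrM.
have S3 := om_sum (tripod_xy T) (tripod_xz T) (tripod_yz T) (tripod_cxy T) (tripod_cxz T).
have ge0 := stack_cdf_ge0 eps1 h; have le1 := stack_cdf_le1 eps h.
have cmp j := @cdf_compare h k j kL hg.
set w' := stack_cdf eps (h - k) _; pose w := stack_cdf eps h (maxn jB jC).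
have [ww w2] : w <= w' /\ w' <= (1 + theta) * w by apply/andP/cmp.
set u := stack_cdf eps h (maxn jA jB); set v := stack_cdf eps h (maxn jA jC).
have wer G : w <= G -> `|w - w'| <= theta * G.
  move=> wG; rewrite distrC ger0_norm ?subr_ge0 //.
  apply: (@le_trans _ _ (theta * w)); last exact: ler_wpM2l.
  by move: w2; rewrite mulrDl mul1r; lra.
have mono j j' : (j <= j')%N -> 0 <= stack_cdf eps h j <= stack_cdf eps h j'.
  by move=> jj; rewrite ge0 stack_cdf_mono.
have bound om' om'' G t er : `|om'| <= 3 - 2 * (3 / V) -> `|om''| <= 3 ->
    0 <= t <= G -> G <= 1 -> `|er| <= theta * G ->
    `|(om x y + om y z + om z x) * (1 - G) + om' * (G - t) + om'' * er| <= 3.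
  by move=> *; apply: (@tripod_inequality _ (3 / V) theta).
(* The cases differ in which of the three turns has the smallest threshold. *)
rewrite (omC z x); have [jCm|[jAC jBC]] : (jC <= maxn jA jB)%N \/ (jA <= jC)%N /\ (jB <= jC)%N by nat_lia.
  have [mx|mx] : maxn jA jB = maxn jA jC \/ maxn jA jB = maxn jB jC by nat_lia.
    have wv : (maxn jB jC <= maxn jA jC)%N by nat_lia.
    have -> : u = v by rewrite /u mx.
    have wv' : w <= v by have /andP[] := mono _ _ wv.
    have := bound (om y z) (om y z) v w (w - w') (om6 _ _) (om3 _ _) (mono _ _ wv)
      (le1 _) (wer _ wv').
    by congr (`|_| <= 3); ring.
  have vw : (maxn jA jC <= maxn jB jC)%N by nat_lia.
  have -> : u = w by rewrite /u mx.
  have := bound (om z x) (om y z) w v (w - w') (om6 _ _) (om3 _ _) (mono _ _ vw)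
    (le1 _) (wer _ (lexx _)).
  by congr (`|_| <= 3); ring.
have uw : (maxn jA jB <= maxn jB jC)%N by nat_lia.
have -> : v = w by rewrite /v /w; congr stack_cdf; nat_lia.
have := bound (om x y) (om y z) w u (w - w') (om6 _ _) (om3 _ _) (mono _ _ uw)
  (le1 _) (wer _ (lexx _)).
by congr (`|_| <= 3); ring.
Qed.

(* Distinct letters leave the center of the tripod along each of its legs. *)
Definition leaves_apart a b := [|| nilp a, nilp b | nth a0 a 0 != nth a0 b 0].

(** Two deep turns share a leg, after reversal if necessary, and yield a tripod at a vertex. With
    one deep turn the bounds [3 - 6 / V], [3 / V] and [3 / V] add up to [3]; with none the sum is at
    most [9 / V <= 3]. *)
Lemma tripod_crossing a b c :
  leaves_apart a b -> leaves_apart b c -> leaves_apart c a ->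
  `|crossing a b + crossing b c + crossing c a| <= 3.
Proof.
have V6 : 0 < 6 / V by rewrite divr_gt0.
have e36 : 6 / V = 3 / V + 3 / V by rewrite -mulrDl; congr (_ / _); ring.
have two a' b' c' : leaves_apart b' c' ->
    (exists d d' q, deep d d' (turn a' b') q (size a')) ->
    (exists d d' q, deep d d' (turn a' c') q (size a')) ->
    `|crossing a' b' + crossing b' c' + crossing c' a'| <= 3.
  move=> ap [d1 [d1' [q1 D1]]] [d2 [d2' [q2 D2]]].
  have nn b'' d d' q : deep d d' (turn a' b'') q (size a') -> ~~ nilp b''.
    have := L0 => L0'.
    by case=> rho [m lo hi]; have := match_right m; rewrite size_turn /nilp; nat_lia.
  have ne : nth a0 b' 0 != nth a0 c' 0.
    by move: ap; rewrite /leaves_apart (negbTE (nn _ _ _ _ D1)) (negbTE (nn _ _ _ _ D2)).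
  have [x [y [z [k [T|T|T]]]]] := deep_tripodP OV Ored small_cancel L0 LN Nn D1 D2 ne.
  - exact: deep_tripod_crossing T.
  - have := deep_tripod_crossing T; rewrite (crossing_rev a' b') (crossing_rev c' a').
    by rewrite (crossing_rev b' c') -!opprD normrN; congr (`|_| <= 3); ring.
  - by have := deep_tripod_crossing T; congr (`|_| <= 3); ring.
have dec a' b' : (exists d d' q, deep d d' (turn a' b') q (size a')) \/
    `|crossing a' b'| <= 3 / V.
  have [|nd] := pselect (exists d d' q, deep d d' (turn a' b') q (size a')); first by left.
  by right; apply: crossing_shallow => d d' q D; apply: nd; exists d, d', q.
have big a' b' : (exists d d' q, deep d d' (turn a' b') q (size a')) ->
    `|crossing a' b'| <= 3 - 6 / V.
  by case=> d [d' [q]]; apply: crossing_deep_le.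
have rev a' b' : (exists d d' q, deep d d' (turn a' b') q (size a')) ->
    exists d d' q, deep d d' (turn b' a') q (size b').
  by case=> d [d' [q /(deep_turn_rev L0 LN Nn) D]]; exists d', d, (size a' + size b' - q)%N.
move=> ab bc ca.
have small : forall t1 t2 t3 : R, `|t1| <= 3 - 6 / V -> `|t2| <= 3 / V -> `|t3| <= 3 / V ->
    `|t1 + t2 + t3| <= 3.
  move=> t1 t2 t3; rewrite !ler_norml; lra.
have [Dab|Sab] := dec a b; have [Dbc|Sbc] := dec b c; have [Dca|Sca] := dec c a.
- exact: two bc Dab (rev _ _ Dca).
- have := two b c a ca Dbc (rev _ _ Dab); by congr (`|_| <= 3); ring.
- exact: two bc Dab (rev _ _ Dca).
- exact: small (big _ _ Dab) Sbc Sca.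
- have := two c a b ab Dca (rev _ _ Dbc); by congr (`|_| <= 3); ring.
- have := small _ _ _ (big _ _ Dbc) Sca Sab; by congr (`|_| <= 3); ring.
- have := small _ _ _ (big _ _ Dca) Sab Sbc; by congr (`|_| <= 3); ring.
have : 3 / V <= 1 by rewrite ler_pdivrMr // mul1r.
move: Sab Sbc Sca; rewrite !ler_norml; lra.
Qed.

End TripodBound.

(** * Matches as copies of subwords *)

Section Counting.
Variables (r n N L : nat) (Y : fatgraph) (O : Y -> nat -> letter r) (a0 : letter r).
Hypotheses (Ored : forall d i, (i.+1 < n)%N -> O d i.+1 != letterV (O d i)).
Hypotheses (L0 : (0 < L)%N) (LN : (3 * L <= N)%N) (Nn : (N.*2 <= n)%N).
Local Notation common := (common n O).
Local Notation matches := (matches n N O a0).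
Implicit Types (d : Y) (W u v : seq (letter r)) (p q rho : nat).

Definition match_count d d' W rho : nat :=
  \sum_(q < (size W).+1) `[< matches d d' W q rho >].

Definition cross_count d d' W p rho : nat :=
  \sum_(q < (size W).+1)
    [&& `[< matches d d' W q rho >], (q < p + rho)%N & (p < q + rho)%N].

Lemma match_count_widen d d' W rho m : (size W <= m)%N ->
  match_count d d' W rho = (\sum_(q < m.+1) `[< matches d d' W q rho >])%N.
Proof.
move=> Wm; rewrite /match_count (big_ord_widen m.+1 (fun q => `[< matches d d' W q rho >] : nat)) //.
rewrite big_mkcond; apply: eq_bigr => q _; case: ifP => // qW.
case: asboolP => // /match_right; have := ltn_ord q; move: qW.
by move: (size W) => *; lia.
Qed.

Lemma match_catl d d' u v q rho : (q + rho <= size u)%N ->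
  matches d d' (u ++ v) q rho <-> matches d d' u q rho.
Proof.
move=> qu; split=> -[h0 h00 h1 h2 h3 h4 h5]; split=> //.
- by move=> k kr; rewrite -h4 // nth_cat ifT //; lia.
- by move=> k kr; rewrite -h5 // nth_cat ifT //; lia.
- by rewrite size_cat; lia.
- by move=> k kr; rewrite -h4 // nth_cat ifT //; lia.
- by move=> k kr; rewrite -h5 // nth_cat ifT //; lia.
Qed.

Lemma match_catr d d' u v q rho : (rho <= q)%N ->
  matches d d' (u ++ v) (size u + q) rho <-> matches d d' v q rho.
Proof.
move=> qu; split=> -[h0 h00 h1 h2 h3 h4 h5]; split=> //.
- by move: h3; rewrite size_cat; lia.
- move=> k kr; rewrite -h4 // nth_cat ifN; last by lia.
  by congr (letterV (nth _ _ _)); lia.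
- move=> k kr; rewrite -h5 // nth_cat ifN; last by lia.
  by congr nth; lia.
- by lia.
- by rewrite size_cat; lia.
- move=> k kr; rewrite -h4 // nth_cat ifN; last by lia.
  by congr (letterV (nth _ _ _)); lia.
- move=> k kr; rewrite -h5 // nth_cat ifN; last by lia.
  by congr nth; lia.
Qed.

(** A match of positive radius lies in [u], lies in [v], or has the junction strictly inside. *)
Lemma match_count_cat d d' u v rho : (0 < rho)%N ->
  (match_count d d' (u ++ v) rho =
   match_count d d' u rho + match_count d d' v rho +
   cross_count d d' (u ++ v) (size u) rho)%N.
Proof.
move=> r0.
have sz : size (u ++ v) = (size u + size v)%N by rewrite size_cat.
rewrite (@match_count_widen d d' u rho (size (u ++ v))); last by rewrite sz leq_addr.
have -> : match_count d d' v rho = (\sum_(q < (size (u ++ v)).+1)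
    ((size u <= q)%N && `[< matches d d' v (q - size u) rho >]))%N.
  rewrite sz -(big_mkord xpredT (fun q => (size u <= q)%N && `[< matches d d' v (q - size u) rho >] : nat)).
  rewrite (@big_cat_nat _ _ _ (size u)) //=; last by rewrite -addnS leq_addr.
  rewrite big_nat_cond big1 ?add0n => [|q]; last first.
    by rewrite andbT => /andP[_ qu]; rewrite leqNgt qu.
  rewrite -[X in \sum_(X <= _ < _) _]add0n big_addn -addnS addKn big_mkord.
  by apply: eq_bigr => q _; rewrite leq_addl addnK.
rewrite /match_count /cross_count -!big_split; apply: eq_bigr => q _ /=.
have [qu|uq] := leqP (q + rho) (size u).
  have -> : (size u <= q)%N = false by lia.
  rewrite !andbF !addn0; congr nat_of_bool.
  by apply/asboolP/asboolP => /match_catl; apply.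
have -> : `[< matches d d' u q rho >] = false.
  by apply/asboolP => /match_right mr; move: uq; rewrite ltnNge mr.
have [uq'|qu'] := leqP (size u + rho) q.
  have -> : (size u <= q)%N by lia.
  rewrite andbF addn0 add0n /=; congr nat_of_bool.
  have rq : (rho <= q - size u)%N by move: uq'; clear; move: (size u) (nat_of_ord q) => *; lia.
  have eq : nat_of_ord q = (size u + (q - size u))%N.
    by move: uq'; clear; move: (size u) (nat_of_ord q) => *; lia.
  by rewrite {1}eq; apply/asboolP/asboolP => /(match_catr _ _ _ _ rq); apply.
have -> : (size u <= q)%N && `[< matches d d' v (q - size u) rho >] = false.
  apply/negP => /andP[_ /asboolP /match_left]; move: qu' r0; clear.
  by move: (size u) (nat_of_ord q) => *; lia.
by rewrite /= andbT.
Qed.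

Lemma match_count_rev d d' W rho : match_count d' d (wordV W) rho = match_count d d' W rho.
Proof.
rewrite /match_count size_wordV (reindex_inj rev_ord_inj) /=; apply: eq_bigr => q _.
rewrite subSS; congr nat_of_bool; apply/asboolP/asboolP => m.
  have := match_rev L0 LN Nn m; rewrite wordVK size_wordV subKn //.
  by rewrite -ltnS ltn_ord.
by have := match_rev L0 LN Nn m.
Qed.

(** The central part of radius [rho] of the reduced turn from [d] to [d']; a copy that starts at [i]
    is a match centered at [i + rho]. *)
Definition arm d d' rho : seq (letter r) :=
  rev [seq letterV (O d (common d d' + k)) | k <- iota 0 rho] ++
  [seq O d' (common d d' + k) | k <- iota 0 rho].

Lemma size_arm d d' rho : size (arm d d' rho) = rho.*2.
Proof. by rewrite size_cat size_rev !size_map size_iota addnn. Qed.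

Lemma nth_arm_in d d' rho k : (k < rho)%N ->
  nth a0 (arm d d' rho) (rho.-1 - k) = letterV (O d (common d d' + k)).
Proof.
move=> kr; rewrite nth_cat size_rev size_map size_iota ifT; last by lia.
rewrite nth_rev size_map size_iota; last by lia.
rewrite (nth_map 0%N) ?size_iota; last by lia.
by rewrite nth_iota; last lia; congr (letterV (O _ (_ + _))); lia.
Qed.

Lemma nth_arm_out d d' rho k : (k < rho)%N ->
  nth a0 (arm d d' rho) (rho + k) = O d' (common d d' + k).
Proof.
move=> kr; rewrite nth_cat size_rev size_map size_iota ifN; last by lia.
by rewrite addKn (nth_map 0%N) ?size_iota // nth_iota.
Qed.

Lemma arm_central d d' h f : (f <= h)%N ->
  drop f (take (h.*2 - f) (arm d d' h)) = arm d d' (h - f).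
Proof.
move=> fh; apply: (@eq_from_nth _ a0).
  by rewrite size_drop size_take_min size_arm size_arm; lia.
move=> i; rewrite size_drop size_take_min size_arm => ih.
have {}ih : (i < (h - f).*2)%N by lia.
rewrite nth_drop nth_take; last by lia.
have [il|li] := ltnP i (h - f).
  have e1 : (f + i = h.-1 - (h - (f + i).+1))%N by lia.
  have e2 : i = ((h - f).-1 - (h - (f + i).+1))%N by lia.
  by rewrite e1 [in RHS]e2 !nth_arm_in //; lia.
have e1 : (f + i = h + (i - (h - f)))%N by lia.
have e2 : i = ((h - f) + (i - (h - f)))%N by lia.
by rewrite e1 [in RHS]e2 !nth_arm_out //; lia.
Qed.

Lemma arm_reduced d d' rho : d != d' -> (common d d' + rho <= N)%N ->
  reduced (arm d d' rho).
Proof.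
move=> dd cN; have := L0; have := LN; have := Nn => Nn' LN' L0'.
apply/(sortedP a0) => i; rewrite size_arm => ir; rewrite /no_cancel.
have [i1|i1] := ltnP i.+1 rho.
  have e1 : i = (rho.-1 - (rho - i.+1))%N by lia.
  have e2 : i.+1 = (rho.-1 - (rho - i.+2))%N by lia.
  rewrite [X in letterV (nth _ _ X)]e1 [X in nth _ _ X == _]e2 !nth_arm_in; try lia.
  rewrite (inj_eq (inv_inj (@letterVK r))).
  have -> : (rho - i.+1 = (rho - i.+2).+1)%N by lia.
  have kn : ((common d d' + (rho - i.+2)).+1 < n)%N by lia.
  by rewrite addnS; apply: contraNneq (Ored d kn) => ->; rewrite letterVK.
have [i2|i2] := ltnP rho i.+1.
  have e1 : i = (rho + (i - rho))%N by lia.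
  have e2 : i.+1 = (rho + (i - rho).+1)%N by lia.
  rewrite [X in letterV (nth _ _ X)]e1 [X in nth _ _ X == _]e2 !nth_arm_out; try lia.
  by rewrite addnS; apply: Ored; lia.
have e1 : i = (rho.-1 - 0)%N by lia.
have e2 : i.+1 = (rho + 0)%N by lia.
rewrite [X in letterV (nth _ _ X)]e1 [X in nth _ _ X == _]e2 nth_arm_in ?nth_arm_out; try lia.
by rewrite letterVK addn0 eq_sym; apply: at_common; lia.
Qed.

Lemma prefix_arm d d' W rho i : d != d' -> fconnect vertex_rot d d' ->
  (0 < rho)%N -> (rho <= N - common d d')%N ->
  prefix (arm d d' rho) (drop i W) <-> matches d d' W (i + rho) rho.
Proof.
move=> dd cdd r0 rN; rewrite prefixE size_arm; split.
  move=> /eqP eW.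
  have sz : (i + rho.*2 <= size W)%N.
    by have := size_arm d d' rho; rewrite -eW size_take_min size_drop; lia.
  have nthW j : (j < rho.*2)%N -> nth a0 W (i + j) = nth a0 (arm d d' rho) j.
    by move=> jr; rewrite -eW nth_take // nth_drop.
  split=> //; [lia | lia | | ].
    move=> k kr; have -> : ((i + rho).-1 - k = i + (rho.-1 - k))%N by lia.
    by rewrite nthW ?nth_arm_in ?letterVK //; lia.
  by move=> k kr; rewrite -addnA nthW ?nth_arm_out //; lia.
case=> _ _ _ _ sz inW outW; apply/eqP/(@eq_from_nth _ a0).
  by rewrite size_take_min size_drop size_arm; lia.
move=> j; rewrite size_take_min size_drop => jr.
have {}jr : (j < rho.*2)%N by lia.
rewrite nth_take // nth_drop; have [jl|lj] := ltnP j rho.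
  have {2}-> : j = (rho.-1 - (rho - j.+1))%N by lia.
  rewrite nth_arm_in; last by lia.
  rewrite -inW ?letterVK; last by lia.
  by congr nth; lia.
have {2}-> : j = (rho + (j - rho))%N by lia.
rewrite nth_arm_out; last by lia.
by rewrite -outW; [congr nth|]; lia.
Qed.

Lemma copies_arm d d' W rho : d != d' -> fconnect vertex_rot d d' ->
  (0 < rho)%N -> (rho <= N - common d d')%N ->
  copies (arm d d' rho) W = match_count d d' W rho.
Proof.
move=> dd cdd r0 rN.
have -> : copies (arm d d' rho) W = (\sum_(i < size W) `[< matches d d' W (i + rho) rho >])%N.
  apply: eq_bigr => i _; congr nat_of_bool.
  by apply/idP/asboolP => /prefix_arm; apply.
rewrite -(big_mkord xpredT (fun i => `[< matches d d' W (i + rho) rho >] : nat)).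
rewrite (@match_count_widen _ _ _ _ (size W + rho).-1); last by lia.
rewrite prednK; last by lia.
rewrite -(big_mkord xpredT (fun i => `[< matches d d' W i rho >] : nat)).
rewrite [RHS](@big_cat_nat _ _ _ rho) ?leq_addl //=.
rewrite [X in _ = (X + _)%N]big_nat_cond [X in _ = (X + _)%N]big1 ?add0n => [|q]; last first.
  by rewrite andbT => /andP[_ qr]; case: asboolP => // /match_left; rewrite leqNgt qr.
by rewrite -[X in _ = \sum_(X <= _ < _) _]add0n big_addn addnK.
Qed.

End Counting.

(** * The vertex quasimorphism *)

(** The three pieces become the legs of a tripod in [stack_sum_defect]. *)
Lemma reduced_cat_split r (s t : seq (letter r)) : reduced s -> reduced t ->
  exists s' z t', [/\ s = s' ++ z, t = wordV z ++ t' & reduced (s' ++ t')].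
Proof.
elim/last_ind: s t => [|s x IHs] t rs rt; first by exists [::], [::], t.
case: t rt => [|y t] rt; first by exists (rcons s x), [::], [::]; rewrite !cats0.
have [yx|yx] := eqVneq y (letterV x).
  have rs' : reduced s.
    by move: rs; rewrite /reduced -cats1 => /cat_sorted2[].
  have [s' [z [t' [-> -> red]]]] := IHs t rs' (path_sorted rt).
  exists s', (rcons z x), t'; split=> //; first by rewrite rcons_cat.
  by rewrite /wordV map_rcons rev_rcons /= yx.
exists (rcons s x), [::], (y :: t); split=> //; first by rewrite cats0.
rewrite /reduced; case: s rs {IHs} => [|w s] rs /=; first by rewrite /no_cancel yx.
by rewrite cat_path; move: rs => /= ->; rewrite last_rcons /= /no_cancel yx.
Qed.

Lemma reduce_cancel r (s z t : seq (letter r)) : reduced (s ++ t) ->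
  reduce ((s ++ z) ++ (wordV z ++ t)) = s ++ t.
Proof.
move=> red; have [rs rt] := cat_sorted2 red.
rewrite -catA /reduce foldr_cat catA foldr_cat -{1}[z]wordVK.
rewrite foldr_push_wordVK ?foldr_push_reduced // -foldr_cat.
exact: reduce_id.
Qed.

Lemma word_reduced r (g : freegrp r) : reduced (word g).
Proof. by case: g. Qed.

Lemma word_mul r (g h : freegrp r) : word (g * h)%g = reduce (word g ++ word h).
Proof. by []. Qed.

Lemma word_inv r (g : freegrp r) : word g^-1%g = wordV (word g).
Proof. by rewrite -[RHS]reduce_id ?wordV_reduced ?word_reduced. Qed.

Lemma reduced_leaves_apart r (a0 : letter r) (u v : seq (letter r)) :
  reduced (u ++ v) -> leaves_apart a0 (wordV u) v.
Proof.
case: v => [|y v]; first by rewrite /leaves_apart orbT.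
case/lastP: u => [|u x]; first by rewrite /leaves_apart.
rewrite /leaves_apart /wordV map_rcons rev_rcons /= cat_rcons /reduced => red.
by have [_] := cat_sorted2 red; rewrite /= /no_cancel eq_sym => /andP[].
Qed.

Section Functional.
Variables (R : realType) (eps : R).
Variables (r n N L : nat) (Y : fatgraph) (O : Y -> nat -> letter r) (a0 : letter r).
Hypotheses (L0 : (0 < L)%N) (LN : (3 * L <= N)%N) (Nn : (N.*2 <= n)%N).
Variable om : Y -> Y -> R.
Hypothesis omC : forall x y, om y x = - om x y.
Local Notation common := (common n O).
Local Notation crossing := (crossing eps n N O a0 om).
Implicit Types (x y : Y) (u v W : seq (letter r)).

(** [H_Y] in terms of match counts, by [H_Y_stack_sum]. The sum runs over ordered pairs of darts;
    antisymmetry of [om] supplies the subtracted turn of each pair. *)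
Definition stack_sum W : R := \sum_x \sum_y om x y *
  \sum_(f < N - common x y) stack_weight eps (N - common x y) f *
     (match_count n N O a0 x y W (N - common x y - f))%:R.

Lemma crossingE u v : crossing u v = \sum_x \sum_y om x y *
  \sum_(f < N - common x y) stack_weight eps (N - common x y) f *
     (cross_count n N O a0 x y (turn u v) (size u) (N - common x y - f))%:R.
Proof.
rewrite [RHS]pair_bigA /=.
pose F (xy : Y * Y) (q : 'I_(size u + size v).+1) := om xy.1 xy.2 *
   match_mass eps n N O a0 (turn u v) (size u) xy.1 xy.2 q.
transitivity (\sum_xy \sum_q F xy q); first by rewrite pair_bigA.
apply: eq_bigr => -[x y] _ /=; rewrite -mulr_sumr; congr (_ * _).
rewrite /match_mass exchange_big /=; apply: eq_bigr => f _.
by rewrite -mulr_sumr -natr_sum /cross_count size_turn.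
Qed.

Lemma stack_sum_cat u v : stack_sum (u ++ v) =
  stack_sum u + stack_sum v + crossing (wordV u) v.
Proof.
rewrite crossingE /turn wordVK size_wordV /stack_sum -!big_split; apply: eq_bigr => x _.
rewrite -!big_split; apply: eq_bigr => y _ /=; rewrite -!mulrDr; congr (_ * _).
rewrite -!big_split; apply: eq_bigr => f _ /=; rewrite -!mulrDr -!natrD.
by rewrite (match_count_cat O a0 L0 LN Nn) // subn_gt0.
Qed.

Lemma stack_sum_rev W : stack_sum (wordV W) = - stack_sum W.
Proof.
rewrite /stack_sum exchange_big -sumrN; apply: eq_bigr => x _ /=.
rewrite -sumrN; apply: eq_bigr => y _; rewrite omC mulNr [common y x]commonC.
congr (- (_ * _)); apply: eq_bigr => f _; congr (_ * _%:R).
exact: match_count_rev O a0 L0 LN Nn _ _ _ _.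
Qed.

End Functional.

Section Certificate.
Variables (R : realType) (eps V : R).
Variables (r n N L : nat) (Y : fatgraph) (O : Y -> nat -> letter r) (a0 : letter r).
Local Notation e := (@edge_rev Y).
Hypotheses (OV : forall d i, (i < n)%N -> O (e d) i = letterV (O d (n.-1 - i)))
  (Ored : forall d i, (i.+1 < n)%N -> O d i.+1 != letterV (O d i)).
Hypothesis small_cancel : forall d d' i i', (i + L <= n)%N -> (i' + L <= n)%N ->
  (forall k, (k < L)%N -> O d (i + k) = O d' (i' + k)) -> d = d' /\ i = i'.
Hypotheses (L0 : (0 < L)%N) (LN : (3 * L <= N)%N) (Nn : (N.*2 <= n)%N).
Hypotheses (eps0 : 0 < eps) (eps1 : eps <= 2^-1).
Hypothesis epsN : (5 * L)%:R <= eps * (N - L)%N%:R.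
Hypotheses (V3 : 3 <= V) (VN : 12 * V * L%:R <= (N - L)%N%:R).
Variable om : Y -> Y -> R.
Hypotheses (omC : forall x y, om y x = - om x y)
  (om_le : forall x y, `|om x y| <= 3 - 6 / V)
  (om_sum : forall x y z, x != y -> x != z -> y != z ->
     fconnect vertex_rot x y -> fconnect vertex_rot x z ->
     `|om x y + om y z + om z x| <= 3).
Local Notation phi := (stack_sum eps n N O a0 om).

(** Write [g = s z] and [h = z^-1 t] with [g h = s t] reduced. The values at [s] and [t] cancel,
    those at [z] cancel by antisymmetry, and what is left is, up to sign, the sum of the crossings
    of the tripod with legs [s^-1], [z], [t]. *)
Lemma stack_sum_defect : defect_bound (fun g : freegrp r => phi (word g)) 3.
Proof.
split=> // g h; rewrite word_mul.
have [s [z [t [eg eh red]]]] := reduced_cat_split (word_reduced g) (word_reduced h).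
have rg : reduced (s ++ z) by rewrite -eg word_reduced.
have rh : reduced (wordV z ++ t) by rewrite -eh word_reduced.
rewrite eg eh reduce_cancel // !(stack_sum_cat eps O a0 L0 LN Nn).
have l1 := reduced_leaves_apart a0 rg.
have l2 := reduced_leaves_apart a0 rh; rewrite wordVK in l2.
have l3 : leaves_apart a0 t (wordV s).
  have := reduced_leaves_apart a0 red; rewrite /leaves_apart.
  by rewrite orbCA eq_sym.
have := tripod_crossing OV Ored small_cancel L0 LN Nn eps0 eps1 epsN V3 VN omC
  om_le om_sum l1 l2 l3.
rewrite (crossing_rev eps O a0 L0 LN Nn omC (wordV s) t).
rewrite (stack_sum_rev eps O a0 L0 LN Nn omC) wordVK -normrN.
by congr (`|_| <= 3); ring.
Qed.

Lemma stack_sum_inv (g : freegrp r) : phi (word g^-1%g) = - phi (word g).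
Proof. by rewrite word_inv (stack_sum_rev eps O a0 L0 LN Nn omC). Qed.

(* At a vertex crossed by the boundary, the turn from [x] to the next dart is
   matched all the way. *)
Lemma crossing_corner x y u v : x != y -> fconnect vertex_rot x y ->
  common n O x y = 0%N -> (N <= size u)%N -> (N <= size v)%N ->
  (forall k, (k < N)%N -> nth a0 u k = O x k) ->
  (forall k, (k < N)%N -> nth a0 v k = O y k) ->
  crossing eps n N O a0 om u v = om x y.
Proof.
move=> xy cxy s0 Nu Nv ux vy.
have m : matches n N O a0 x y (turn u v) (size u) N.
  split=> //; rewrite ?s0 ?subn0 ?size_turn ?leq_add2l //.
  - move=> k kN; rewrite turnl; last by nat_lia.
    by rewrite letterVK -ux //; congr nth; nat_lia.
  - by move=> k kN; rewrite turnr vy.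
have D : deep n N L O a0 x y (turn u v) (size u) (size u) by exists N; rewrite !leq_add2l.
rewrite (crossing_deep OV small_cancel L0 LN Nn eps0 eps1 epsN om D).
rewrite -[RHS]mulr1; congr (_ * _); rewrite /match_mass s0 subn0.
have N0 : (0 < N)%N by nat_lia.
transitivity (1 - stack_cdf eps N 0); last by rewrite stack_cdf0 subr0.
rewrite -(sum_stack_weight eps0 eps1 (leq0n N) N0).
apply: eq_bigr => f _; congr (_ * (nat_of_bool _)%:R).
have fN := ltn_ord f; apply/and3P; split; [|nat_lia|nat_lia].
by apply/asboolP; apply: (match_sub L0 LN Nn (leq_subr f N) m).
Qed.

End Certificate.

(** * The coefficients at the vertices *)

Section CornerWeight.
Variables (R : realType) (Y : fatgraph).
Implicit Types x y z : Y.
Local Notation rot := (@vertex_rot Y).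

Let rot_inj := @vertex_rot_inj Y.

(** Extended by zero, so that sums may run over all pairs of darts. *)
Definition corner_weight x y : R :=
  if fconnect rot x y && (x != y) then 3 - 6 * (findex rot x y)%:R / (valence x)%:R
  else 0.

Lemma order_fconnect (T : finType) (f : T -> T) (x y : T) : injective f ->
  fconnect f x y -> fingraph.order f y = fingraph.order f x.
Proof.
move=> fi cxy; apply: eq_card => z; rewrite !inE; apply/esym.
by apply: (same_connect (fconnect_sym fi) cxy).
Qed.

Lemma findex_iter_iter (T : finType) (f : T -> T) (x : T) i j : injective f ->
  (i <= j < fingraph.order f x)%N ->
  findex f (iter i f x) (iter j f x) = (j - i)%N.
Proof.
move=> fi /andP[ij jo]; rewrite -{1}(subnK ij) iterD findex_iter //.
rewrite (order_fconnect fi (fconnect_iter f i x)); lia.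
Qed.

Lemma findex_opp (T : finType) (f : T -> T) (x y : T) : injective f -> fconnect f x y -> x != y ->
  (findex f x y + findex f y x = fingraph.order f x)%N.
Proof.
move=> fi cxy xy; have io := findex_max cxy; have iE := iter_findex cxy.
have i0 : (0 < findex f x y)%N by rewrite lt0n findex_eq0.
move: (findex f x y) io iE i0 => i io iE i0.
have xE : iter (fingraph.order f x - i) f y = x.
  by rewrite -iE -iterD subnK ?iter_order // ltnW.
have -> : findex f y x = (fingraph.order f x - i)%N.
  by rewrite -[in LHS]xE findex_iter // (order_fconnect fi cxy); lia.
by rewrite subnKC // ltnW.
Qed.

Lemma corner_weightC x y : corner_weight y x = - corner_weight x y.
Proof.
rewrite /corner_weight (fconnect_sym rot_inj) eq_sym.
case: ifP => [/andP[cxy xy]|_]; last by rewrite oppr0.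
have v0 : (valence x)%:R != 0 :> R by rewrite pnatr_eq0 -lt0n; exact: fingraph.order_gt0.
have vy : valence y = valence x by apply: order_fconnect.
rewrite vy; have := findex_opp rot_inj cxy xy; rewrite -/(valence x) => fE.
have -> : (findex rot y x)%:R = (valence x)%:R - (findex rot x y)%:R :> R.
  by rewrite -fE natrD addrC addKr.
by field.
Qed.

Lemma corner_weight_le x y (V : R) : 3 <= V -> (valence x)%:R <= V ->
  `|corner_weight x y| <= 3 - 6 / V.
Proof.
move=> V3 xV; have V0 : 0 < V by apply: lt_le_trans V3.
have V6 : 6 / V <= 2 by rewrite ler_pdivrMr //; lra.
rewrite /corner_weight; case: ifP => [/andP[cxy xy]|_]; last by rewrite normr0; lra.
have i0 : (0 < findex rot x y)%N by rewrite lt0n findex_eq0.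
have io := findex_max cxy; rewrite -/(valence x) in io.
have v0 : 0 < (valence x)%:R :> R by rewrite ltr0n; exact: fingraph.order_gt0.
have iv : 6 / V <= 6 / (valence x)%:R by rewrite ler_wpM2l // lef_pV2 ?posrE.
have l1 : 6 / (valence x)%:R <= 6 * (findex rot x y)%:R / (valence x)%:R :> R.
  by rewrite ler_pM2r ?invr_gt0 // ler_peMr // ler1n.
have l2 : 6 * (findex rot x y)%:R / (valence x)%:R + 6 / (valence x)%:R <= 6 :> R.
  rewrite -mulrDl ler_pdivrMr // -[X in _ + X]mulr1 -mulrDr natr1.
  by rewrite ler_pM2l // ler_nat.
rewrite ler_norml; apply/andP; split; lra.
Qed.

(** In cyclic order, the steps between three darts add up to the valence, so the sum is [9 - 6 = 3];
    in the opposite order it is [-3]. *)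
Lemma corner_weight_sum x y z : x != y -> x != z -> y != z ->
  fconnect rot x y -> fconnect rot x z ->
  `|corner_weight x y + corner_weight y z + corner_weight z x| <= 3.
Proof.
move=> xy xz yz cxy cxz; rewrite (corner_weightC x z).
have v0 : (valence x)%:R != 0 :> R by rewrite pnatr_eq0 -lt0n; exact: fingraph.order_gt0.
have cyz : fconnect rot y z by apply: connect_trans cxz; rewrite (fconnect_sym rot_inj).
have vy : valence y = valence x by apply: order_fconnect.
have vz : valence z = valence x by apply: order_fconnect.
have io := findex_max cxy; have iE := iter_findex cxy.
have ko := findex_max cxz; have kE := iter_findex cxz.
rewrite {1}/corner_weight {2}/corner_weight cxy cxz xy xz /=.
move: (findex rot x y) (findex rot x z) io iE ko kE => i k io iE ko kE.
have [ik|ki|ik] := ltngtP i k; last by rewrite -iE -kE ik eqxx in yz.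
  rewrite /corner_weight cyz yz vy /= -{1}iE -{1}kE findex_iter_iter //; last first.
    by rewrite ltnW.
  rewrite natrB; last exact: ltnW.
  by rewrite [X in `|X|](_ : _ = 3) ?ger0_norm //; field.
rewrite corner_weightC /corner_weight (fconnect_sym rot_inj) cyz eq_sym yz vz /=.
rewrite -{1}iE -{1}kE findex_iter_iter //; last by rewrite ltnW.
rewrite natrB; last exact: ltnW.
by rewrite [X in `|X|](_ : _ = -3) ?normrN ?ger0_norm //; field.
Qed.

Lemma corner_weight_rot x : corner_weight x (rot x) = 3 - 6 / (valence x)%:R.
Proof.
have v3 := valence_ge3 x.
have f1 : findex rot x (rot x) = 1%N.
  by have := @findex_iter _ rot x 1; apply; apply: leq_trans v3.
by rewrite /corner_weight fconnect1 /= -(findex_eq0 rot) f1 mulr1.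
Qed.

(** The terms [6 / |v|] of the darts at one vertex add up to [6], and the [3] of the two darts of an
    edge to [6] as well. *)
Lemma sum_corner_weight : \sum_x corner_weight x (rot x) = - 6 * (euler_char Y)%:~R.
Proof.
under eq_bigr => x _ do rewrite corner_weight_rot.
rewrite sumrB sumr_const -mulr_sumr.
have -> : \sum_(x : Y) ((valence x)%:R)^-1 = (fcard rot Y)%:R :> R.
  rewrite (@big_froots _ _ rot_inj R 0 +%R) /= /n_comp_mem -sum1_card natr_sum.
  apply: eq_big => [d|d rd]; first by rewrite !inE andbT.
  rewrite (eq_big_seq (fun _ => ((valence d)%:R)^-1)) => [|x]; last first.
    by rewrite -fconnect_orbit => cdx; congr (_%:R^-1); apply: order_fconnect.
  rewrite big_const_seq count_predT size_orbit iter_addr_0 -[_ *+ _]mulr_natr mulVf //.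
  by rewrite pnatr_eq0 -lt0n; exact: fingraph.order_gt0.
have -> : #|(xpredT : pred Y)| = (2 * fcard (@edge_rev Y) Y)%N.
  by rewrite card_edges; apply: eq_card.
by rewrite /euler_char intrB -!pmulrn -[3 *+ _]mulr_natr natrM; ring.
Qed.

End CornerWeight.

Lemma sum_square (R : nmodType) (F : nat -> nat -> R) v :
  \sum_(i < v) \sum_(j < v) F i j = \sum_(j < v) (F j j + \sum_(i < j) (F i j + F j i)).
Proof.
elim: v => [|v IHv]; first by rewrite !big_ord0.
rewrite !big_ord_recr /= -IHv; under eq_bigr => i _ do rewrite big_ord_recr /=.
rewrite big_split /= [\sum_(i < v) (F i v + F v i)]big_split /=.
by rewrite -addrA; congr (_ + _); rewrite addrA addrC.
Qed.

Lemma big_orbit (R : nmodType) (T : finType) (f : T -> T) d (F : T -> R) :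
  \sum_(x <- fingraph.orbit f d) F x = \sum_(i < fingraph.order f d) F (iter i f d).
Proof.
rewrite (big_nth d) size_orbit big_mkord; apply: eq_bigr => i _.
by rewrite /fingraph.orbit nth_traject.
Qed.

(** * Extremality of fatgraphs without repeated subwords *)

Section LabeledFatgraph.
Variables (R : realType) (eps : R).
Variables (r n N L : nat) (Y : fatgraph) (l : Y -> freegrp r) (a0 : letter r).
Local Notation e := (@edge_rev Y).
Local Notation rot := (@vertex_rot Y).
Hypotheses (size_l : forall d, size (word (l d)) = n) (lV : forall d, l (e d) = (l d)^-1%g).
Hypotheses (L0 : (0 < L)%N) (LN : (3 * L <= N)%N) (Nn : (N.*2 <= n)%N).

Definition outward d k := nth a0 (word (l (e d))) k.
Local Notation O := outward.
Local Notation common := (common n O).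

Hypothesis small_cancel : forall d d' i i', (i + L <= n)%N -> (i' + L <= n)%N ->
  (forall k, (k < L)%N -> O d (i + k) = O d' (i' + k)) -> d = d' /\ i = i'.

Lemma outwardE d k : (k < n)%N -> O d k = letterV (nth a0 (word (l d)) (n.-1 - k)).
Proof.
move=> kn; rewrite /O lV word_inv nth_wordV size_l //.
by congr (letterV (nth _ _ _)); clear -kn; lia.
Qed.

Lemma outward_rev d i : (i < n)%N -> O (e d) i = letterV (O d (n.-1 - i)).
Proof.
by move=> kn; rewrite outwardE // /O; congr letterV; congr nth; clear -kn; lia.
Qed.

Lemma nth_label d k : (k < n)%N -> nth a0 (word (l d)) k = letterV (O d (n.-1 - k)).
Proof. by move=> kn; rewrite -outward_rev // /O edge_revK. Qed.

Lemma outward_reduced d i : (i.+1 < n)%N -> O d i.+1 != letterV (O d i).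
Proof.
by move=> iN; have /(sortedP a0) := word_reduced (l (e d)); apply; rewrite size_l.
Qed.

Lemma word_end_arc d : word (end_arc l N d) = drop (n - N) (word (l d)).
Proof. by rewrite /= size_l reduce_id //; apply: drop_sorted; apply: word_reduced. Qed.

(** Both arcs end in the same [common d d'] letters, which cancel; the next letters differ, so the
    cancellation stops there. *)
Lemma word_turn d d' : d != d' ->
  word (end_arc l N d * (end_arc l N d')^-1)%g = arm n O d d' (N - common d d').
Proof.
move=> dd; have sL := common_lt small_cancel L0 LN Nn dd.
rewrite word_mul word_inv !word_end_arc.
set s := common d d' in sL *.
pose p x := take (N - s) (drop (n - N) (word (l x))).
have tail x : drop (n - N) (word (l x)) = p x ++ drop (n - s) (word (l x)).
  rewrite -{1}(cat_take_drop (N - s) (drop (n - N) (word (l x)))) drop_drop.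
  by congr (_ ++ drop _ _); lia.
have z12 : drop (n - s) (word (l d)) = drop (n - s) (word (l d')).
  apply: (@eq_from_nth _ a0); rewrite !size_drop !size_l // => i ins.
  rewrite !nth_drop !nth_label; try lia.
  by congr letterV; apply: (@before_common r n Y O); rewrite -/s; lia.
have armE : arm n O d d' (N - s) = p d ++ wordV (p d').
  have sp x : size (p x) = (N - s)%N.
    by rewrite /p size_take_min size_drop size_l; lia.
  congr (_ ++ _).
    apply: (@eq_from_nth _ a0); rewrite size_rev size_map size_iota ?sp // => i iN.
    rewrite nth_rev size_map size_iota // (nth_map 0%N) ?size_iota; last by lia.
    rewrite nth_iota; last by lia.
    rewrite /p nth_take // nth_drop nth_label; last by lia.
    by congr (letterV (O _ _)); rewrite -/s; lia.
  apply: (@eq_from_nth _ a0); rewrite size_map size_iota ?(size_wordV) ?sp // => i iN.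
  rewrite (nth_map 0%N) ?size_iota // nth_iota // nth_wordV ?sp //.
  rewrite /p nth_take; last by lia.
  rewrite nth_drop nth_label; last by lia.
  by rewrite letterVK; congr O; rewrite -/s; lia.
rewrite !tail -z12 wordV_cat armE reduce_cancel // -armE.
apply: (arm_reduced a0 outward_reduced L0 LN Nn dd); rewrite -/s; lia.
Qed.

Hypotheses (eps0 : 0 < eps) (eps1 : eps < 1).
Local Notation om := (@corner_weight R Y).

Lemma stack_turn d d' (g : freegrp r) : d != d' -> fconnect rot d d' ->
  stack eps (end_arc l N d * (end_arc l N d')^-1)%g g =
  \sum_(f < N - common d d') stack_weight eps (N - common d d') f *
     (match_count n N O a0 d d' (word g) (N - common d d' - f))%:R.
Proof.
move=> dd cdd; have sL := common_lt small_cancel L0 LN Nn dd.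
rewrite (@stackE _ _ eps0 eps1 _ _ _ (N - common d d')%N); last 2 first.
- by lia.
- by rewrite word_turn // size_arm.
apply: eq_bigr => f _; have fh := ltn_ord f; congr (_ * _%:R).
rewrite word_turn // (arm_central O a0 L0 LN Nn) //; last exact: ltnW.
rewrite (copies_arm a0 L0 LN Nn) //; lia.
Qed.

(** The pairs [i < j] of a vertex, with two turns each, are the ordered pairs of distinct darts
    there; all other pairs have coefficient zero. *)
Lemma H_Y_stack_sum (g : freegrp r) :
  H_Y l N eps g = stack_sum eps n N O a0 om (word g).
Proof.
pose S x y := stack eps (end_arc l N x * (end_arc l N y)^-1)%g g.
have -> : stack_sum eps n N O a0 om (word g) = \sum_x \sum_y om x y * S x y.
  apply: eq_bigr => x _; apply: eq_bigr => y _; rewrite /corner_weight.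
  case: ifP => [/andP[cxy xy]|_]; last by rewrite !mul0r.
  by rewrite /S stack_turn.
rewrite (@big_froots _ _ (@vertex_rot_inj Y) R 0 +%R) /=.
apply: eq_bigr => d rd; rewrite /vertex_term.
transitivity (\sum_(x <- fingraph.orbit rot d) \sum_(y <- fingraph.orbit rot d) om x y * S x y).
  rewrite big_orbit; under [RHS]eq_bigr => i _ do rewrite big_orbit.
  rewrite -/(valence d) (sum_square (fun i j => om (iter i rot d) (iter j rot d) *
     S (iter i rot d) (iter j rot d))).
  apply: eq_bigr => j _.
  rewrite {1}/corner_weight eqxx andbF mul0r add0r; apply: eq_bigr => i _.
  have ij : (i <= j < fingraph.order rot d)%N by rewrite ltnW ?ltn_ord.
  have fij := findex_iter_iter (@vertex_rot_inj Y) ij.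
  have vi : valence (iter i rot d) = valence d.
    exact: order_fconnect (@vertex_rot_inj Y) (fconnect_iter rot i d).
  have cij : fconnect rot (iter i rot d) (iter j rot d).
    have <- : iter (j - i) rot (iter i rot d) = iter j rot d.
      by rewrite -iterD subnK // ltnW.
    exact: fconnect_iter.
  have nij : iter i rot d != iter j rot d.
    by rewrite -(findex_eq0 rot) fij subn_eq0 -ltnNge ltn_ord.
  have -> : om (iter j rot d) (iter i rot d) = - om (iter i rot d) (iter j rot d).
    exact: corner_weightC.
  rewrite /corner_weight cij nij /= fij vi -/(S _ _) -/(S _ _).
  by rewrite mulrBr mulNr.
apply: eq_big_seq => x; rewrite -fconnect_orbit => cdx.
rewrite big_uniq ?orbit_uniq //= big_mkcond; apply: eq_bigr => y _.
rewrite -fconnect_orbit; case: ifP => // cdy; rewrite /corner_weight ifF ?mul0r //.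
by apply/negP => /andP[cxy _]; move: cdy; rewrite (connect_trans cdx cxy).
Qed.

Hypothesis corner : forall x, O x 0 != O (rot x) 0.
Hypotheses (eps2 : eps <= 2^-1) (epsN : (5 * L)%:R <= eps * (N - L)%N%:R).
Variable V : R.
Hypotheses (V3 : 3 <= V) (VN : 12 * V * L%:R <= (N - L)%N%:R).
Hypothesis valV : forall x : Y, (valence x)%:R <= V.
Local Notation phi := (stack_sum eps n N O a0 om).
Local Notation bn := (@bnext Y).

Definition path_word d j : seq (letter r) := flatten [seq word (l x) | x <- traject bn d j].

Lemma path_wordS d j : path_word d j.+1 = path_word d j ++ word (l (iter j bn d)).
Proof. by rewrite /path_word trajectSr map_rcons flatten_rcons. Qed.

Lemma size_path_word d j : size (path_word d j) = (j * n)%N.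
Proof. by elim: j => // j IH; rewrite path_wordS size_cat IH size_l mulSn addnC. Qed.

Lemma path_word_end d j k : (k < n)%N ->
  letterV (nth a0 (path_word d j.+1) (size (path_word d j.+1) - k.+1)) = O (iter j bn d) k.
Proof.
move=> kn; rewrite size_path_word path_wordS nth_cat size_path_word mulSn ifN; last first.
  by rewrite -leqNgt; lia.
rewrite outwardE //; congr (letterV (nth _ _ _)); lia.
Qed.

Lemma path_word_reduced d j : reduced (path_word d j).
Proof.
elim: j => // -[|j] IH; rewrite path_wordS; first exact: word_reduced.
have := word_reduced (l (iter j.+1 bn d)); have := IH.
have n0 : (0 < n)%N by nat_lia.
have := path_word_end d j n0; rewrite subn1.
have := corner (iter j bn d); rewrite /O -[edge_rev (rot _)]/(bn (iter j bn d)) -iterS.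
case/lastP: (path_word d j.+1) => [|u x]; first by [].
rewrite size_rcons nth_rcons ltnn eqxx => cn eqx.
case: (word (l (iter j.+1 bn d))) cn => [|y v] /= cn; first by rewrite cats0.
rewrite -{}eqx in cn.
rewrite /reduced; case: u => [|w u] /= ru rv.
  by rewrite rv andbT /no_cancel eq_sym.
by rewrite cat_path ru last_rcons /= rv andbT /no_cancel eq_sym.
Qed.

Lemma word_path_prod d j : word (\prod_(x <- traject bn d j) l x)%g = path_word d j.
Proof.
elim: j => [|j IH]; first by rewrite /= big_nil.
rewrite trajectSr -cats1 big_cat big_seq1 word_mul IH -path_wordS.
by rewrite reduce_id // path_word_reduced.
Qed.

(** At each junction the crossing is the coefficient of the corner passed there, by
    [crossing_corner]; [j + 1] arcs have [j] junctions. *)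
Lemma stack_sum_path d j : phi (path_word d j.+1) =
  \sum_(x <- traject bn d j.+1) phi (word (l x)) + \sum_(x <- traject bn d j) om x (rot x).
Proof.
elim: j => [|j IH].
  by rewrite big_seq1 big_nil addr0 path_wordS.
rewrite path_wordS (stack_sum_cat eps O a0 L0 LN Nn) IH.
have n0 : (0 < n)%N by nat_lia.
have Nn' : (N <= n)%N by nat_lia.
set y := iter j bn d.
have -> : crossing eps n N O a0 om (wordV (path_word d j.+1)) (word (l (iter j.+1 bn d))) =
    om y (rot y).
  apply: (crossing_corner outward_rev small_cancel L0 LN Nn eps0 eps2 epsN).
  - have := valence_ge3 y; apply: contraTneq => yr.
    have cy : fcycle rot [:: y] by rewrite /= -yr eqxx.
    by rewrite (order_cycle cy) ?mem_head.
  - exact: fconnect1.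
  - by apply: common_eq => //; apply: corner.
  - by rewrite size_wordV size_path_word mulSn; nat_lia.
  - by rewrite size_l.
  - move=> k kN; have kn : (k < n)%N := leq_trans kN Nn'.
    rewrite nth_wordV ?path_word_end //.
    by rewrite size_path_word mulSn; nat_lia.
  - by move=> k kN; rewrite /O iterS.
have trS (F : Y -> R) i :
    \sum_(x <- traject bn d i.+1) F x = \sum_(x <- traject bn d i) F x + F (iter i bn d).
  by rewrite trajectSr -cats1 big_cat big_seq1.
rewrite (trS (fun x => phi (word (l x))) j.+1) (trS (fun x => om x (rot x)) j) -/y.
by ring.
Qed.

Lemma sum_traject_period (F : Y -> R) d k :
  \sum_(x <- traject bn d (k * fingraph.order bn d)) F x =
  k%:R * \sum_(x <- fingraph.orbit bn d) F x.
Proof.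
elim: k => [|k IH]; first by rewrite mul0n big_nil mul0r.
by rewrite mulSn trajectD iter_order ?big_cat ?IH -?natr1 /=; [ring | apply: bnext_inj].
Qed.

Lemma prod_traject_period d k :
  (\prod_(x <- traject bn d (k * fingraph.order bn d)) l x =
   (\prod_(x <- fingraph.orbit bn d) l x) ^+ k)%g.
Proof.
elim: k => [|k IH]; first by rewrite mul0n big_nil.
by rewrite mulSn trajectD iter_order ?big_cat ?IH ?expgS //; apply: bnext_inj.
Qed.

Let phi_nil : phi [::] = 0.
Proof.
have := stack_sum_rev eps O a0 L0 LN Nn (@corner_weightC R Y) [::].
by rewrite /wordV /=; lra.
Qed.

(** A power of the boundary word is the word of a path that goes around several times and misses
    only the closing corner; the error is thus at most [3]. *)
Lemma homogenization_boundary d :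
  homogenization (fun g : freegrp r => phi (word g)) (\prod_(x <- fingraph.orbit bn d) l x)%g =
  \sum_(x <- fingraph.orbit bn d) (phi (word (l x)) + om x (rot x)).
Proof.
apply: (@homogenizationE _ _ _ _ _ 3) => -[|k].
  by rewrite expg0 phi_nil mul0r subr0 normr0.
rewrite -prod_traject_period word_path_prod.
have m0 : (0 < k.+1 * fingraph.order bn d)%N by rewrite muln_gt0 fingraph.order_gt0.
rewrite -sum_traject_period; case: (_ * _)%N m0 => // j _.
rewrite stack_sum_path big_split /= [X in _ - (_ + X)](_ : _ =
  \sum_(x <- traject bn d j) om x (rot x) + om (iter j bn d) (rot (iter j bn d))).
  rewrite [X in `|X|](_ : _ = - om (iter j bn d) (rot (iter j bn d))); last by ring.
  rewrite normrN; apply: le_trans (corner_weight_le _ V3 (valV _)) _.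
  by rewrite gerBl divr_ge0 // (le_trans _ V3).
by rewrite -[d :: _]/(traject bn d j.+1) trajectSr -cats1 big_cat big_seq1.
Qed.

(** [phi] takes opposite values on the inverse labels of paired arcs, so only the corners remain. *)
Lemma on_chain_boundary :
  on_chain (homogenization (fun g : freegrp r => phi (word g))) (boundary l) =
  - 6 * (euler_char Y)%:~R.
Proof.
rewrite /on_chain /boundary big_map big_enum /=.
under eq_bigr => d _ do rewrite homogenization_boundary.
rewrite -(@big_froots _ _ (@bnext_inj Y) R 0 +%R) big_split /= sum_corner_weight.
have S0 : \sum_x phi (word (l x)) = - \sum_x phi (word (l x)).
  rewrite -sumrN (reindex_inj (inv_inj (@edge_revK Y))) /=; apply: eq_bigr => x _.
  by rewrite lV (stack_sum_inv eps O a0 L0 LN Nn (@corner_weightC R Y)).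
by rewrite (_ : \sum_x phi (word (l x)) = 0) ?add0r //; lra.
Qed.

Lemma labeled_fatgraph_extremal (d0 : Y) :
  extremal_surface R l /\ certified_by l (H_Y l N eps).
Proof.
have [m bm eqm] := boundary_chi_bound lV.
pose psi (g : freegrp r) := phi (word g).
have eH : H_Y l N eps = psi by apply/funext => g; apply: H_Y_stack_sum.
have chi_m : - (euler_char Y)%:~R = m%:R :> R by rewrite -mulrNz -eqm -pmulrn.
have val : on_chain (homogenization psi) (boundary l) = 6 * m%:R.
  by rewrite on_chain_boundary -chi_m; ring.
(* Each corner contributes [3 - 6 / |v| > 0], since valences are at least [3]. *)
have m0 : (0 < m)%N.
  rewrite -(ltr0n R) -(pmulr_rgt0 _ (_ : 0 < 6)) // -chi_m mulrN -mulNr -sum_corner_weight.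
  rewrite (bigD1 d0) //= ltr_pwDl //.
    rewrite corner_weight_rot; have v3 : 3 <= (valence d0)%:R :> R.
      by rewrite ler_nat; apply: valence_ge3.
    have v0 : 0 < (valence d0)%:R :> R by apply: lt_le_trans v3.
    by rewrite subr_gt0 ltr_pdivrMr //; lra.
  apply: sumr_ge0 => x _; rewrite corner_weight_rot.
  have v3 : 3 <= (valence x)%:R :> R by rewrite ler_nat; apply: valence_ge3.
  have v0 : 0 < (valence x)%:R :> R by apply: lt_le_trans v3.
  by rewrite subr_ge0 ler_pdivrMr //; lra.
have def : defect_bound psi 3.
  exact: (stack_sum_defect a0 outward_rev outward_reduced small_cancel L0 LN Nn eps0 eps2
    epsN V3 VN (@corner_weightC R Y)
    (fun x y => corner_weight_le y V3 (valV x)) (@corner_weight_sum R Y)).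
have inv g : psi g^-1%g = - psi g.
  exact: (stack_sum_inv eps O a0 L0 LN Nn (@corner_weightC R Y) g).
have [sclE dE] := certificate bm m0 def inv val.
split; first by rewrite /extremal_surface sclE chi_m.
rewrite eH; split; first by exists 3.
by rewrite sclE val dE; congr _%:E; field.
Qed.

End LabeledFatgraph.

(** * Counting labelings *)

Section CountReducedWords.
Variable r : nat.
Hypothesis r0 : (0 < r)%N.
Local Notation k := (r.*2.-1).

Lemma card_letter : #|letter r| = r.*2.
Proof. by rewrite card_prod card_ord card_bool muln2. Qed.

Lemma big_tuple_cons (A : finType) n (F : n.+1.-tuple A -> nat) :
  (\sum_t F t = \sum_a \sum_(t : n.-tuple A) F (cons_tuple a t))%N.
Proof.
rewrite pair_bigA (reindex (fun p : A * n.-tuple A => cons_tuple p.1 p.2)) //=.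
exists (fun t => (thead t, behead_tuple t)) => [[a t] _|t _] /=.
  by congr (_, _); apply: val_inj.
by apply: val_inj; case/tupleP: t.
Qed.

Lemma count_paths a n :
  (\sum_(t : n.-tuple (letter r)) path (@no_cancel r) a t = k ^ n)%N.
Proof.
elim: n a => [|n IHn] a.
  rewrite (bigD1 [tuple]) //= big1 // => t; by rewrite (tuple0 t).
rewrite big_tuple_cons /=.
have step b : (\sum_(t : n.-tuple (letter r)) (no_cancel a b && path (@no_cancel r) b t) =
    no_cancel a b * k ^ n)%N.
  by case: (no_cancel a b); rewrite /= ?mul1n ?IHn // big1.
rewrite (eq_bigr _ (fun b _ => step b)) -big_distrl /= expnS; congr (_ * _)%N.
rewrite -(@big_mkcond _ 0%N addn) /= sum1_card.
by rewrite -card_letter -(cardC1 (letterV a)); apply: eq_card.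
Qed.

Lemma count_reduced n :
  (\sum_(t : n.+1.-tuple (letter r)) reduced t = r.*2 * k ^ n)%N.
Proof.
rewrite big_tuple_cons /= (eq_bigr _ (fun a _ => count_paths a n)).
by rewrite sum_nat_const card_letter.
Qed.

Lemma card_reduced_word n : (k ^ n <= #|reduced_word r n| <= 2 * k ^ n)%N.
Proof.
rewrite card_sig -sum1_card big_mkcond /=; case: n => [|n].
  by rewrite (bigD1 [tuple]) //= big1 // => t; rewrite (tuple0 t).
rewrite (eq_bigr (fun t : n.+1.-tuple (letter r) => nat_of_bool (reduced t))); last first.
  by move=> t _; rewrite inE; case: reduced.
by rewrite count_reduced expnS mulnA !leq_mul2r; apply/andP; split; apply/orP; right; nat_lia.
Qed.

End CountReducedWords.

Section CycleFlatten.
Variables (T : eqType) (e : rel T) (x0 : T).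
Local Notation joint := (fun u v : seq T => e (last x0 u) (head x0 v)).

Lemma path_flatten u ss : [::] \notin ss ->
  path e (last x0 u) (flatten ss) = all (sorted e) ss && path joint u ss.
Proof.
elim: ss u => //= -[|b v] ss IH u; rewrite inE //= => /IH IHv.
rewrite cat_path -[last b v]/(last x0 (b :: v)) IHv /=.
by case: (e _ _) (path e b v) (all _ _) => [] [] [].
Qed.

Lemma cycle_flatten ss : [::] \notin ss ->
  path.cycle e (flatten ss) = all (sorted e) ss && path.cycle joint ss.
Proof.
case: ss => [|[|a u] ss] //=; rewrite inE /= => ss0.
have -> : rcons (u ++ flatten ss) a = u ++ flatten (rcons ss [:: a]).
  by rewrite flatten_rcons catA cats1.
rewrite cat_path -[last a u]/(last x0 (a :: u)) path_flatten; last first.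
  by rewrite mem_rcons inE.
by rewrite all_rcons !rcons_path /= andbA.
Qed.

End CycleFlatten.

Section FatgraphOver.
Variables (r n : nat) (Y : fatgraph) (l : Y -> freegrp r) (a0 : letter r).
Hypothesis size_l : forall d, size (word (l d)) = n.
Hypothesis n0 : (0 < n)%N.

(** The labels being reduced, cyclic reduction is a condition at the corners alone. *)
Lemma fatgraph_overE : fatgraph_over l =
  [forall d, l (edge_rev d) == (l d)^-1%g] &&
  [forall d, outward l a0 d 0 != outward l a0 (vertex_rot d) 0].
Proof.
rewrite /fatgraph_over.
have -> : [forall d, l d != 1%g].
  apply/forallP => d; apply/eqP => ld; have := size_l d; rewrite ld /=; lia.
case: (boolP [forall d, _ == _]) => //= /forallP/(_ _)/eqP lV.
have joint d : no_cancel (last a0 (word (l d))) (head a0 (word (l (bnext d)))) =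
    (outward l a0 d 0 != outward l a0 (vertex_rot d) 0).
  rewrite /no_cancel eq_sym /outward -nth0; congr (_ != _).
  rewrite -/(outward l a0 d 0) (outwardE a0 size_l lV) // subn0 -(size_l d) nth_last.
  by case: (word (l d)) (size_l d) => [|b s] //= *; lia.
have nil d : [::] \notin [seq word (l x) | x <- fingraph.orbit (@bnext Y) d].
  by apply/mapP => -[x _ lx]; have := size_l x; rewrite -lx /=; lia.
apply/forallP/forallP => H d.
  have := H d; rewrite /cyc_reduced (cycle_flatten _ a0) // => /andP[_].
  rewrite cycle_map => /next_cycle/(_ (in_orbit _ d))/=.
  have /next_cycle/(_ (in_orbit _ d))/eqP <- := cycle_orbit (@bnext_inj Y) d.
  by rewrite joint.
rewrite /cyc_reduced (cycle_flatten _ a0) //; apply/andP; split.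
  by apply/allP => _ /mapP[x _ ->]; apply: word_reduced.
rewrite cycle_map; apply: sub_cycle (cycle_orbit (@bnext_inj Y) d) => x _ /eqP <-.
by rewrite /= joint.
Qed.

End FatgraphOver.

(** The window may overlap its source, but the source comes earlier, so the letters are recovered
    from left to right. *)
Lemma recover_shift (A : Type) (u1 u2 : nat -> A) i i' L n : (i < i')%N ->
  (forall k, (k < L)%N -> u1 (i + k)%N = u1 (i' + k)%N) ->
  (forall k, (k < L)%N -> u2 (i + k)%N = u2 (i' + k)%N) ->
  (forall p, (p < n)%N -> (p < i')%N || (i' + L <= p)%N -> u1 p = u2 p) ->
  forall p, (p < n)%N -> u1 p = u2 p.
Proof.
move=> ii h1 h2 out; elim/ltn_ind => p IH pn.
case: (boolP ((p < i')%N || (i' + L <= p)%N)) => [/(out _ pn)//|pin].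
have pk : p = (i' + (p - i'))%N by lia.
have kL : (p - i' < L)%N by lia.
rewrite pk -h1 // -h2 //; apply: IH; lia.
Qed.

(** A window meeting its mirror image would contain the center of the reflection: a letter equal to
    its own inverse, or two adjacent inverse letters, according to the parity of [s]. *)
Lemma reflected_window_disjoint r (u : nat -> letter r) i i' L n :
  (i + L <= n)%N -> (i' + L <= n)%N ->
  (forall p, (p.+1 < n)%N -> u p.+1 != letterV (u p)) ->
  (forall k, (k < L)%N -> u (i' + k)%N = letterV (u (n.-1 - (i + k)))%N) ->
  forall k, (k < L)%N -> (n.-1 - (i + k) < i')%N || (i' + L <= n.-1 - (i + k))%N.
Proof.
move=> iL i'L red refl k kL; apply/negPn/negP => over.
have [s sE] : {s | s = (n.-1 - i + i')%N} by exists (n.-1 - i + i')%N.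
have := odd_double_half s; set h := s./2; move: h => h sh.
have b1 : (odd s <= 1)%N by case: odd.
have [hi hL] : (i' <= h)%N /\ (h - i' < L)%N by move: over; rewrite negb_or; lia.
have := refl _ hL; rewrite (_ : (i' + (h - i'))%N = h); last by lia.
rewrite (_ : (n.-1 - (i + (h - i')))%N = (h + odd s)%N); last by lia.
case: (odd s) sh b1 => sh _; last first.
  by rewrite addn0; case: (u h) => x b [] /esym; case: b.
rewrite addn1 => uh; have hn : (h.+1 < n)%N by move: sh => /=; lia.
by have := red h hn; rewrite uh letterVK eqxx.
Qed.

Lemma subword_map r n a b : (a + b <= n)%N ->
  {g : reduced_word r n -> reduced_word r b |
    forall w x0 i, (i < b)%N -> nth x0 (val (g w)) i = nth x0 (val w) (a + i)}.
Proof.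
move=> abn.
have sz (w : reduced_word r n) : size (take b (drop a (val w))) == b.
  by rewrite size_takel // size_drop size_tuple; lia.
have red (w : reduced_word r n) : reduced (Tuple (sz w)).
  by apply: take_sorted; apply: drop_sorted; apply: (valP w).
exists (fun w => Sub (Tuple (sz w)) (red w)) => w x0 i ib.
by rewrite /= nth_take // nth_drop.
Qed.

Lemma edge_orbitP (Y : fatgraph) (x y : Y) :
  fconnect edge_rev x y -> y = x \/ y = edge_rev x.
Proof.
move/iter_findex <-; elim: (findex _ x y) => [|j [] /= ->]; first by left.
  by right.
by left; apply: edge_revK.
Qed.

Section Overlaps.
Variables (r n L : nat) (Y : fatgraph) (a0 : letter r).
Hypothesis L0 : (0 < L)%N.
Local Notation e := (@edge_rev Y).
Local Notation labels := {ffun Y -> reduced_word r n}.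

Lemma label_inverse (l : labels) d : l \in labelings Y r n ->
  tval (val (l (e d))) = wordV (val (l d)).
Proof.
rewrite inE /fatgraph_over => /and3P[_ /forallP/(_ d)/eqP/(congr1 (@word r)) + _].
by rewrite word_inv.
Qed.

Lemma nth_label_inverse (l : labels) d k : l \in labelings Y r n -> (k < n)%N ->
  nth a0 (val (l (e d))) k = letterV (nth a0 (val (l d)) (n.-1 - k)).
Proof.
move=> lab kn; rewrite label_inverse // nth_wordV size_tuple //.
by congr (letterV (nth _ _ _)); lia.
Qed.

Definition overlap (x : Y) i x' i' (l : labels) :=
  [forall k : 'I_L, nth a0 (val (l x)) (i + k) == nth a0 (val (l x')) (i' + k)].

(* A label is determined by its letters outside of [i', i' + L): inside, they are
   copied from another label, from earlier letters, or from the mirror image. *)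
Lemma recover_label x i x' i' (l1 l2 : labels) :
  (i + L <= n)%N -> (i' + L <= n)%N -> (x == x' -> (i < i')%N) ->
  l1 \in labelings Y r n -> l2 \in labelings Y r n ->
  overlap x i x' i' l1 -> overlap x i x' i' l2 ->
  (forall d, froot e d != froot e x' -> l1 d = l2 d) ->
  (forall p, (p < n)%N -> (p < i')%N || (i' + L <= p)%N ->
    nth a0 (val (l1 x')) p = nth a0 (val (l2 x')) p) ->
  l1 = l2.
Proof.
move=> iL i'L xx' lab1 lab2 /forallP o1 /forallP o2 off out.
have {}o1 k : (k < L)%N -> nth a0 (val (l1 x)) (i + k) = nth a0 (val (l1 x')) (i' + k).
  by move=> kL; apply/eqP: (o1 (Ordinal kL)).
have {}o2 k : (k < L)%N -> nth a0 (val (l2 x)) (i + k) = nth a0 (val (l2 x')) (i' + k).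
  by move=> kL; apply/eqP: (o2 (Ordinal kL)).
have esym_conn : connect_sym (frel e) := fconnect_sym (inv_inj (@edge_revK Y)).
suff eqx' p : (p < n)%N -> nth a0 (val (l1 x')) p = nth a0 (val (l2 x')) p.
  have lx' : l1 x' = l2 x'.
    apply: val_inj; apply: val_inj; apply: (@eq_from_nth _ a0); rewrite !size_tuple //.
  apply/ffunP => d; have [same|/off//] := eqVneq (froot e d) (froot e x').
  have : fconnect e x' d by rewrite -(root_connect esym_conn) same.
  case/edge_orbitP => -> //; apply: val_inj; apply: val_inj.
  by rewrite /= !label_inverse // lx'.
move=> pn.
have window q : (q < i')%N || (i' + L <= q)%N \/ exists2 k, (k < L)%N & q = (i' + k)%N.
  case: (boolP (_ || _)) => [|qin]; [by left | right].
  by exists (q - i')%N; lia.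
have [/esym same|diff] := eqVneq (froot e x) (froot e x'); last first.
  case: (window p) => [|[k kL ->]]; first exact: out pn.
  by rewrite -o1 // -o2 // off.
have : fconnect e x' x by rewrite -(root_connect esym_conn) same.
case/edge_orbitP => ex; subst x.
  by apply: (recover_shift (xx' (eqxx _)) o1 o2 out).
case: (window p) => [|[k kL ->]]; first exact: out pn.
have refl (l : labels) : l \in labelings Y r n ->
    (forall k, (k < L)%N -> nth a0 (val (l (e x'))) (i + k) = nth a0 (val (l x')) (i' + k)) ->
    forall k, (k < L)%N ->
    nth a0 (val (l x')) (i' + k) = letterV (nth a0 (val (l x')) (n.-1 - (i + k))).
  by move=> lab o j jL; rewrite -o // nth_label_inverse //; lia.
rewrite (refl _ lab1 o1) // (refl _ lab2 o2) //; congr letterV.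
apply: out; first by lia.
apply: (reflected_window_disjoint iL i'L _ (refl _ lab1 o1)) => // q qn.
have := valP (l1 x'); rewrite /reduced => /(sortedP a0)/(_ q); apply.
by rewrite size_tuple.
Qed.

Lemma overlapC x i x' i' l : overlap x i x' i' l = overlap x' i' x i l.
Proof. by apply: eq_forallb => k; rewrite eq_sym. Qed.

Lemma card_other_edges (x' : Y) :
  #|{: {d : Y | froots e d && (froot e d != froot e x')}}| = (fcard e Y).-1.
Proof.
have esym_conn : connect_sym (frel e) := fconnect_sym (inv_inj (@edge_revK Y)).
rewrite card_sig /n_comp_mem [in RHS](cardD1 (froot e x')) inE /= !inE roots_root //=.
apply: eq_card => d; rewrite !inE andbT; case: (boolP (froots e d)) => /=; last by rewrite andbF.
by rewrite andbT => /eqP ->.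
Qed.

(** By [recover_label], a labeling is encoded by the labels of the other edges and the two pieces of
    the label of [x'] outside the window. *)
Lemma card_overlap x i x' i' :
  (i + L <= n)%N -> (i' + L <= n)%N -> (x == x' -> (i < i')%N) ->
  (#|[set l in labelings Y r n | overlap x i x' i' l]| <=
   #|reduced_word r n| ^ (fcard e Y).-1 *
   (#|reduced_word r i'| * #|reduced_word r (n - (i' + L))|))%N.
Proof.
move=> iL i'L xx'.
have [g1 g1E] := @subword_map r n 0 i' ltac:(lia).
have [g2 g2E] := @subword_map r n (i' + L) (n - (i' + L)) ltac:(lia).
pose other := {d : Y | froots e d && (froot e d != froot e x')}.
pose restr (l : labels) := ([ffun d : other => l (val d)], (g1 (l x'), g2 (l x'))).
have esym_conn : connect_sym (frel e) := fconnect_sym (inv_inj (@edge_revK Y)).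
rewrite -(card_other_edges x') -card_ffun -!card_prod.
rewrite -(@card_in_imset _ _ restr) ?max_card // => l1 l2.
rewrite !inE => /andP[lab1 o1] /andP[lab2 o2] [eoth eg1 eg2].
apply: (recover_label iL i'L xx' _ _ o1 o2); rewrite ?inE //.
  have root d : froots e d -> froot e d != froot e x' -> l1 d = l2 d.
    move=> fd dx; have h : froots e d && (froot e d != froot e x') by rewrite fd.
    by have /ffunP/(_ (Sub d h : other)) := eoth; rewrite !ffunE.
  move=> d dx; have eqr : l1 (froot e d) = l2 (froot e d).
    by apply: root; rewrite ?roots_root // (root_root esym_conn).
  case: (edge_orbitP (connect_root (frel e) d)) => er; rewrite er in eqr => //.
  rewrite -[d]edge_revK; apply: val_inj; apply: val_inj.
  by rewrite /= !(label_inverse (e d)) ?inE // eqr.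
move=> p pn /orP[pi|pi].
  by rewrite -[p]add0n -!g1E // eg1.
have -> : p = (i' + L + (p - (i' + L)))%N by lia.
by rewrite -!g2E ?eg2 //; lia.
Qed.

End Overlaps.

(** * Lower bound for the number of labelings *)

Section LowerBound.
Variables (r n : nat) (Y : fatgraph).
Hypotheses (r1 : (1 < r)%N) (n4 : (4 < n)%N).
Local Notation e := (@edge_rev Y).
Local Notation rot := (@vertex_rot Y).
Local Notation labels := {ffun Y -> reduced_word r n}.
Local Notation middle := (reduced_word r (n - 4)).

(** Two letters alternate around each vertex, and a third at the last dart takes care of odd
    valence. *)
Lemma vertex_coloring : {chi : Y -> letter r | forall x, chi x != chi (rot x)}.
Proof.
pose i0 : 'I_r := Ordinal (ltnW r1); pose i1 : 'I_r := Ordinal r1.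
pose pos x := findex rot (froot rot x) x.
pose last_pos x := (fingraph.order rot (froot rot x)).-1.
exists (fun x => if pos x == last_pos x then (i1, true) else (i0, odd (pos x))) => x.
have inj := @vertex_rot_inj Y; have v3 := valence_ge3 (froot rot x).
have cx : fconnect rot (froot rot x) x by rewrite (fconnect_sym inj) connect_root.
have px : iter (pos x) rot (froot rot x) = x by apply: iter_findex.
have lt_px : (pos x < fingraph.order rot (froot rot x))%N by apply: findex_max.
have root_eq : froot rot (rot x) = froot rot x.
  by apply/esym/eqP; rewrite (root_connect (fconnect_sym inj)) fconnect1.
have pos_rot : pos (rot x) = findex rot (froot rot x) (iter (pos x).+1 rot (froot rot x)).
  by rewrite /pos root_eq iterS -/(pos x) px.
rewrite {1 2}/last_pos root_eq pos_rot.
have [p_last|p_last] := eqVneq (pos x) _.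
  rewrite p_last prednK ?fingraph.order_gt0 // iter_order // findex0.
  by rewrite (_ : (0 == _.-1)%N = false) //; lia.
rewrite findex_iter; last by lia.
by case: (_.+1 =P _) => _; apply/eqP => -[] //=; case: odd.
Qed.

Lemma avoid_two (a b : letter r) : {c | c != a & c != b}.
Proof.
have [c /andP[ca cb]|none] := pickP [pred c | (c != a) && (c != b)]; first by exists c.
have := cardC (pred2 a b); rewrite card2 card_letter.
rewrite (_ : #|_| = 0%N); first by case: (a != b); lia.
by apply: eq_card0 => c; have := none c; rewrite !inE negb_or.
Qed.

Lemma reduced_word_of (m : nat) (s : seq (letter r)) : size s = m -> reduced s ->
  {w : reduced_word r m | tval (val w) = s}.
Proof. by move=> /eqP sm rs; exists (Sub (Tuple sm) rs). Qed.

(** The outer letters are prescribed; the inner ones [c] and [d] prevent cancellation and exist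
    because there are at least four letters. *)
Lemma padded_word (a b : letter r) (m : middle) :
  {w : reduced_word r n | exists c d, tval (val w) = a :: c :: val m ++ [:: d; b]}.
Proof.
move: (valP m) (size_tuple (val m)); case: m => -[m _] _ /= rm sm.
case: m sm rm => [|m0 m] sm rm; first by move: sm => /=; lia.
have [c ca cm] := avoid_two (letterV a) (letterV m0).
have [d dm db] := avoid_two (letterV (last m0 m)) (letterV b).
have sz : size [:: a, c, m0 & m ++ [:: d; b]] = n.
  by rewrite /= size_cat /=; move: sm => /=; lia.
have [] := reduced_word_of sz; last by move=> w wE; exists w, c, d.
rewrite /reduced /= cat_path; apply/and3P; split=> //=.
  by rewrite /no_cancel; apply: contraNneq cm => ->; rewrite letterVK.
rewrite (rm : path _ _ _) /= /no_cancel dm andbT /=.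
by apply: contraNneq db => ->; rewrite letterVK.
Qed.

Lemma inverse_word (w : reduced_word r n) :
  {w' : reduced_word r n | tval (val w') = wordV (val w)}.
Proof.
by apply: reduced_word_of; [rewrite size_wordV size_tuple | apply/wordV_reduced/(valP w)].
Qed.

(* Prescribing the first and the last letter of each label by a coloring of the darts
   that separates neighbours leaves [n - 4] letters free. *)
Lemma labelings_lower_bound :
  (#|{: middle}| ^ fcard e Y <= #|labelings Y r n|)%N.
Proof.
have [chi chiP] := vertex_coloring.
have esym_conn : connect_sym (frel e) := fconnect_sym (inv_inj (@edge_revK Y)).
pose root d : {d : Y | froots e d} := Sub (froot e d) (roots_root esym_conn d).
pose pad d m := sval (padded_word (chi (e d)) (letterV (chi d)) m).
have padE d m : exists a b, tval (val (pad d m)) =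
    chi (e d) :: a :: val m ++ [:: b; letterV (chi d)].
  exact: (svalP (padded_word (chi (e d)) (letterV (chi d)) m)).
pose inv w := sval (inverse_word w).
have invE w : tval (val (inv w)) = wordV (val w) by exact: (svalP (inverse_word w)).
pose lab (f : {ffun {d : Y | froots e d} -> middle}) : labels :=
  [ffun d => if froots e d then pad d (f (root d)) else inv (pad (e d) (f (root d)))].
have root_rev d : root (e d) = root d.
  by apply/val_inj/esym/eqP; rewrite (root_connect esym_conn) fconnect1.
have roots_rev d : froots e (e d) = ~~ froots e d.
  have er : froot e (e d) = froot e d := congr1 val (root_rev d).
  rewrite /roots /= er; case: (edge_orbitP (connect_root (frel e) d)) => ->.
    by rewrite eqxx eq_sym (negbTE (edge_rev_neq d)).
  by rewrite eqxx edge_rev_neq.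
have -> : fcard e Y = #|{: {d : Y | froots e d}}|.
  by rewrite card_sig /n_comp_mem; apply: eq_card => d; rewrite !inE andbT.
rewrite -card_ffun -cardsT -(@card_in_imset _ _ lab) => [|f f' _ _ eqf].
  apply: subset_leq_card; apply/fintype.subsetP => _ /imsetP[f _ ->]; rewrite inE.
  have size_lab d : size (word (word_label (lab f) d)) = n by apply: size_tuple.
  rewrite (fatgraph_overE (Ordinal (ltnW r1), true) size_lab); last by lia.
  have head_lab d a0 : nth a0 (val (lab f d)) 0 = chi (e d).
    rewrite ffunE; case: (boolP (froots e d)) => rd; last rewrite invE.
      by have [a [b ->]] := padE d (f (root d)).
    have [a [b ->]] := padE (e d) (f (root d)).
    by rewrite -(cat1s b) catA -!cat_cons wordV_cat /= letterVK.
  apply/andP; split; apply/forallP => d; last first.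
    by rewrite /outward /= !head_lab !edge_revK chiP.
  apply/eqP; apply: val_inj; apply: etrans (esym (word_inv _)); rewrite /= !ffunE roots_rev root_rev.
  by case: (froots e d) => /=; rewrite ?edge_revK invE // wordVK.
apply/ffunP => u; have uroot : froots e (val u) := valP u.
have ru : root (val u) = u by apply: val_inj; apply/eqP.
have := congr1 (fun l : labels => l (val u)) eqf; rewrite !ffunE uroot ru => eqw.
have [a [b wE]] := padE (val u) (f u); have [a' [b' wE']] := padE (val u) (f' u).
apply: val_inj; apply: val_inj; have := wE; rewrite eqw wE' => -[_ /eqP].
by rewrite eqseq_cat ?size_tuple // => /andP[/eqP].
Qed.

End LowerBound.

(** * Labelings with a repeated subword *)

Section Repetitions.
Variables (r n L : nat) (Y : fatgraph) (a0 : letter r).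
Hypotheses (r1 : (1 < r)%N) (L0 : (0 < L)%N).
Local Notation k := (r.*2.-1).
Local Notation E := (fcard (@edge_rev Y) Y).
Local Notation labels := {ffun Y -> reduced_word r n}.

Lemma card_overlap_le (x x' : Y) i i' :
  (i + L <= n)%N -> (i' + L <= n)%N -> (x, i) != (x', i') ->
  (k ^ L * #|[set l in labelings Y r n | overlap L a0 x i x' i' l]| <=
   2 ^ E.+1 * k ^ (n * E))%N.
Proof.
(* When both windows lie in one label, the later one is taken as the window to forget. *)
wlog ii : x x' i i' / x == x' -> (i < i')%N => [hw iL i'L neq|iL i'L _].
  have [xx'|] := eqVneq x x'; last by move=> xx'; apply: hw => //; rewrite (negbTE xx').
  have [lt|gt|eq_i] := ltngtP i i'; last by rewrite xx' eq_i eqxx in neq.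
    by apply: hw.
  under eq_finset => l do rewrite overlapC.
  by apply: hw => //; rewrite eq_sym.
have E0 : (0 < E)%N by have := card_edges Y; rewrite (cardD1 x) inE; lia.
apply: leq_trans (leq_mul (leqnn _) (card_overlap a0 L0 iL i'L ii)) _.
have expn_le2 a b j : (a <= b -> a ^ j <= b ^ j)%N by case: j => // j; rewrite leq_exp2r.
have bound m : (#|{: reduced_word r m}| <= 2 * k ^ m)%N.
  by have /andP[] := card_reduced_word (ltnW r1) m.
case: E E0 => // E' _; rewrite [E'.+1.-1]/=.
apply: leq_trans (leq_mul (leqnn _) (leq_mul (expn_le2 _ _ _ (bound n))
  (leq_mul (bound i') (bound (n - (i' + L))%N)))) _.
rewrite mulnS expnD !expnMn -expnM !expnS.
have -> : (k ^ n = k ^ L * k ^ i' * k ^ (n - (i' + L)))%N.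
  by rewrite -!expnD; congr (k ^ _)%N; lia.
by apply: eq_leq; ring.
Qed.

Definition repeats (l : labels) := [exists q : (Y * Y) * ('I_n.+1 * 'I_n.+1),
  [&& (q.2.1 + L <= n)%N, (q.2.2 + L <= n)%N, (q.1.1, q.2.1) != (q.1.2, q.2.2) &
    overlap L a0 q.1.1 q.2.1 q.1.2 q.2.2 l]].

Lemma card_repeats :
  (k ^ L * #|[set l in labelings Y r n | repeats l]| <=
   #|Y| ^ 2 * n.+1 ^ 2 * (2 ^ E.+1 * k ^ (n * E)))%N.
Proof.
pose cond (q : (Y * Y) * ('I_n.+1 * 'I_n.+1)) := [&& (q.2.1 + L <= n)%N,
  (q.2.2 + L <= n)%N & (q.1.1, q.2.1) != (q.1.2, q.2.2)].
pose B (q : (Y * Y) * ('I_n.+1 * 'I_n.+1)) :=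
  [set l in labelings Y r n | overlap L a0 q.1.1 q.2.1 q.1.2 q.2.2 l].
have sub : (#|[set l in labelings Y r n | repeats l]| <= \sum_(q | cond q) #|B q|)%N.
  under eq_bigr do rewrite -sum1_card.
  rewrite (exchange_big_dep (mem [set l in labelings Y r n | repeats l])) /=.
    rewrite -sum1_card; apply: leq_sum => l; rewrite inE => /andP[lab /existsP[q]].
    rewrite !andbA => /andP[cq o]; rewrite (bigD1 q) //=.
    by rewrite inE lab o /cond !andbA cq.
  move=> q l cq; rewrite !inE => /andP[-> o] /=; apply/existsP; exists q.
  by rewrite o !andbT.
apply: leq_trans (leq_mul (leqnn _) sub) _; rewrite big_distrr /=.
have le q : cond q -> (k ^ L * #|B q| <= 2 ^ E.+1 * k ^ (n * E))%N.
  by case: q => [[x x'] [i i']] /and3P[/= iL i'L neq]; apply: card_overlap_le.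
apply: leq_trans (leq_sum _ le) _.
rewrite sum_nat_const leq_mul2r; apply/orP; right.
by apply: leq_trans (max_card _) _; rewrite !card_prod !card_ord !mulnn.
Qed.

End Repetitions.

(** The factor with exponent [4 * fcard] is what the padding letters lose in
    [labelings_lower_bound]. *)
Lemma card_repeats_labelings r n L (Y : fatgraph) (a0 : letter r) :
  (1 < r)%N -> (0 < L)%N -> (4 < n)%N ->
  (r.*2.-1 ^ L * #|[set l in labelings Y r n | repeats L a0 l]| <=
   #|Y| ^ 2 * 2 ^ (fcard (@edge_rev Y) Y).+1 * r.*2.-1 ^ (4 * fcard (@edge_rev Y) Y) *
   n.+1 ^ 2 * #|labelings Y r n|)%N.
Proof.
move=> r1 L0 n4; apply: leq_trans (card_repeats n Y a0 r1 L0) _.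
set E := fcard _ _; set k := r.*2.-1.
have -> : (k ^ (n * E) = k ^ (4 * E) * (k ^ (n - 4)) ^ E)%N.
  by rewrite -expnM -expnD -mulnDl subnKC // ltnW.
have low : ((k ^ (n - 4)) ^ E <= #|labelings Y r n|)%N.
  apply: leq_trans (labelings_lower_bound Y r1 n4).
  have /andP[lk _] := card_reduced_word (ltnW r1) (n - 4).
  by rewrite -/E; case: (E) => // E'; rewrite leq_exp2r.
have := leq_mul (leqnn (#|Y| ^ 2 * 2 ^ E.+1 * k ^ (4 * E) * n.+1 ^ 2)%N) low.
by congr (_ <= _)%N; ring.
Qed.

(** * The probability estimate *)

Lemma nonrepeating_extremal (R : realType) r n L (Y : fatgraph) (a0 : letter r) (eps V : R)
    (l : {ffun Y -> reduced_word r n}) (d0 : Y) :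
  (0 < L)%N -> (3 * L <= n./2)%N -> 0 < eps -> eps <= 2^-1 ->
  (5 * L)%:R <= eps * (n./2 - L)%N%:R -> 3 <= V -> 12 * V * L%:R <= (n./2 - L)%N%:R ->
  (forall x : Y, (valence x)%:R <= V) ->
  l \in labelings Y r n -> ~~ repeats L a0 l ->
  extremal_surface R (word_label l) /\
  certified_by (word_label l) (H_Y (word_label l) n./2 eps).
Proof.
move=> L0 LN eps0 eps2 epsN V3 VN valV lab norep.
have n0 : (0 < n)%N by nat_lia.
have size_l d : size (word (word_label l d)) = n by apply: size_tuple.
have := lab; rewrite inE (fatgraph_overE a0 size_l n0) => /andP[/forallP lV /forallP corner].
apply: (labeled_fatgraph_extremal size_l _ L0 LN _ _ eps0 _ corner eps2 epsN V3 VN valV) => //.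
- by move=> d; apply/eqP/lV.
- by nat_lia.
- move=> d d' i i' iL i'L same.
  have [/eqP/=|neq] := boolP ((edge_rev d, i) == (edge_rev d', i')).
    by move=> [/(inv_inj (@edge_revK Y)) -> ->].
  have [ni ni'] : (i < n.+1)%N /\ (i' < n.+1)%N by nat_lia.
  case/negP: norep; apply/existsP.
  exists ((edge_rev d, edge_rev d'), (Ordinal ni, Ordinal ni')) => /=.
  by rewrite iL i'L neq; apply/forallP => k; rewrite [X in X == _]same.
- lra.
Qed.

Lemma labeling_prob_compl (R : realType) r n (Y : fatgraph)
    (P : (Y -> freegrp r) -> Prop) (B : pred {ffun Y -> reduced_word r n}) :
  (0 < #|labelings Y r n|)%N ->
  (forall l, l \in labelings Y r n -> ~~ B l -> P (word_label l)) ->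
  `|1 - labeling_prob R n P| <=
  #|[set l in labelings Y r n | B l]|%:R / #|labelings Y r n|%:R.
Proof.
move=> lab0 BP; have lab0' : 0 < #|labelings Y r n|%:R :> R by rewrite ltr0n.
pose A := [set l in labelings Y r n | `[< P (word_label l) >]].
have sub : A \subset labelings Y r n by apply/fintype.subsetP => l; rewrite inE => /andP[].
rewrite /labeling_prob -/A ger0_norm; last first.
  by rewrite subr_ge0 ler_pdivrMr // mul1r ler_nat subset_leq_card.
rewrite -{1}[1](divff (lt0r_neq0 lab0')) -mulrBl ler_wpM2r ?invr_ge0 //.
rewrite -natrB ?subset_leq_card // ler_nat -cardsDS // subset_leq_card //.
apply/fintype.subsetP => l; rewrite !inE => /andP[nP lab]; rewrite lab /=.
apply: contraR nP => /(BP l) Pl; rewrite lab; apply/asboolP; apply: Pl.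
by rewrite inE.
Qed.

Lemma exprD1_le (R : realFieldType) (x : R) j : 0 <= x -> 2 * j%:R * x <= 1 ->
  (1 + x) ^+ j <= 1 + 2 * j%:R * x.
Proof.
move=> x0; elim: j => [|j IH]; first by rewrite mulr0 mul0r addr0.
rewrite -natr1 exprSr => jx; have j0 : 0 <= j%:R :> R by rewrite ler0n.
have jx0 : 0 <= j%:R * x by rewrite mulr_ge0.
apply: le_trans (ler_wpM2r (addr_ge0 ler01 x0) (IH _)) _; nra.
Qed.

Lemma sqr_le_exp2 L : (L.+1 ^ 2 <= 4 * 2 ^ L)%N.
Proof.
case: L => // -[|L] //; elim: L => // L IH.
by rewrite expnS; move: IH; rewrite !expnS expn0; nia.
Qed.

(** For [C = 1 + 1 / (4 M)] one has [C ^ M <= 3 / 2], and [(n + 1) ^ 2] is at most a constant times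
    [2 ^ (n / M)]. The product [2 * 3 / 2 = 3] is the least value of [2 r - 1] for [r >= 2]. *)
Lemma sqr_geometric_bound (R : realFieldType) M n : (0 < M)%N ->
  (n.+1 ^ 2)%:R * (1 + (4 * M%:R)^-1) ^+ n <= 6 * M%:R ^+ 2 * 3 ^+ (n %/ M) :> R.
Proof.
move=> M0; set L := (n %/ M)%N; set C := 1 + _.
have MR : 0 < M%:R :> R by rewrite ltr0n.
have x0 : 0 < (4 * M%:R)^-1 :> R by rewrite invr_gt0 mulr_gt0.
have CM : C ^+ M <= 3 / 2.
  have Mx : M%:R * (4 * M%:R)^-1 = 4^-1 :> R by field; rewrite lt0r_neq0.
  have := @exprD1_le R (4 * M%:R)^-1 M (ltW x0); rewrite -/C -mulrA Mx => /(_ _); lra.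
have C1 : 1 <= C by rewrite lerDl ltW.
have nL : (n < L.+1 * M)%N by rewrite ltn_ceil.
have sq : ((n.+1 ^ 2)%:R : R) <= M%:R ^+ 2 * 4 * 2 ^+ L.
  rewrite -!natrX -!natrM ler_nat -mulnA.
  apply: leq_trans (leq_mul (leqnn _) (sqr_le_exp2 L)).
  by rewrite -expnMn mulnC leq_exp2r.
have Cn : C ^+ n <= (3 / 2) ^+ L.+1.
  apply: le_trans (_ : C ^+ (M * L.+1) <= _).
    by rewrite ler_weXn2l // mulnC ltnW.
  rewrite exprM lerXn2r ?nnegrE // ?exprn_ge0 //; lra.
apply: le_trans (ler_pM _ _ sq Cn) _ => //; first by rewrite exprn_ge0 //; lra.
rewrite [_ ^+ L.+1]exprS; have -> : 3 ^+ L = 2 ^+ L * (3 / 2) ^+ L :> R.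
  by rewrite -exprMn; congr (_ ^+ _); lra.
by rewrite le_eqVlt; apply/orP; left; apply/eqP; field.
Qed.

Theorem theorem5p10 (R : realType) :
  exists2 c : R, 0 < c &
  forall (r : nat) (hr : (1 < r)%N) (Y : fatgraph) (eps : R)
    (heps0 : 0 < eps) (heps : eps <= c / (max_valence Y)%:R),
  exists2 C : R, 1 < C &
    (fun n : nat => 1 - labeling_prob R n
       (fun l : Y -> freegrp r =>
          extremal_surface R l /\ certified_by l (H_Y l n./2 eps)))
    =O_\oo (fun n : nat => C ^- n).
Proof.
exists 1 => // r r1 Y eps eps0 epsV.
have [d0 _|noY] := pickP (xpredT : pred Y); last first.
  (* Without darts the maximal valence is [0], and division by zero gives [0], against [0 < eps]. *)
  have : max_valence Y = 0%N by apply: big1 => d; have := noY d.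
  by move: epsV => /[swap] ->; rewrite invr0 mulr0 leNgt eps0.
pose V : R := (max_valence Y)%:R.
have valV (x : Y) : (valence x)%:R <= V.
  by rewrite ler_nat; apply: (leq_bigmax (F := @valence Y)).
have V3 : 3 <= V by apply: le_trans (valV d0); rewrite ler_nat; apply: valence_ge3.
have V0 : 0 < V by apply: lt_le_trans V3.
have eps2 : eps <= 2^-1.
  apply: le_trans epsV _; rewrite ler_pdivrMr // -/V; lra.
(* [K - 1 >= 5 / eps + 12 V] yields both [epsN] and [VN], as [(K - 1) L <= N - L]; the added [3]
   ensures [3 L <= N]. The factor [2] in [M] is that of [N = n / 2], with [L = n / M]. *)
pose K := (Num.bound (5 / eps + 12 * V)).+3; pose M := (2 * K)%N.
have bK : 5 / eps + 12 * V <= K.-1%:R.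
  have /archi_boundP/ltW b : 0 <= 5 / eps + 12 * V.
    by rewrite addr_ge0 ?divr_ge0 ?mulr_ge0 ?ltW.
  by apply: le_trans b _; rewrite ler_nat /K /=; lia.
have M0 : (0 < M)%N by [].
have e5 : 0 <= 5 / eps by rewrite divr_ge0 // ltW.
exists (1 + (4 * M%:R)^-1); first by rewrite ltrDl invr_gt0 mulr_gt0 // ltr0n.
pose E := fcard (@edge_rev Y) Y; pose k := r.*2.-1.
pose A := (#|Y| ^ 2 * 2 ^ E.+1 * k ^ (4 * E))%N.
pose a0 : letter r := (Ordinal (ltnW r1), true).
have k3 : (3 <= k)%N by rewrite /k; lia.
have A0 : (0 < A)%N.
  have Y0 : (0 < #|Y|)%N by rewrite (cardD1 d0).
  by rewrite !muln_gt0 !expn_gt0 Y0 (ltnW (ltnW k3)).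
apply/eqO_exP; exists (A%:R * (6 * M%:R ^+ 2)).
  by rewrite !mulr_gt0 ?exprn_gt0 ?ltr0n.
(* From here on [L] is positive and the four padding letters fit. *)
exists (M + 5)%N => // n /= n_ge.
pose L := (n %/ M)%N.
have L0 : (0 < L)%N by rewrite divn_gt0 //; lia.
have ML : (M * L <= n)%N by rewrite mulnC leq_divM.
have KL : (K * L <= n./2)%N by rewrite geq_half_double; move: ML; rewrite /M -mulnA; lia.
have NL : (K.-1 * L <= n./2 - L)%N by move: KL; rewrite -[K]/(K.-1.+1) mulSn; lia.
have NLR : K.-1%:R * L%:R <= (n./2 - L)%N%:R :> R by rewrite -natrM ler_nat.
have n4 : (4 < n)%N by lia.
have LN : (3 * L <= n./2)%N by apply: leq_trans KL; rewrite leq_mul2r orbT.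
have L0R : 0 < L%:R :> R by rewrite ltr0n.
have epsN : (5 * L)%:R <= eps * (n./2 - L)%N%:R.
  apply: le_trans (ler_wpM2l (ltW eps0) NLR); rewrite natrM mulrA ler_wpM2r ?(ltW L0R) //.
  by rewrite -ler_pdivrMl // mulrC; apply: le_trans bK; rewrite lerDl mulr_ge0 // ltW.
have VN : 12 * V * L%:R <= (n./2 - L)%N%:R.
  apply: le_trans NLR; rewrite ler_wpM2r ?(ltW L0R) //; apply: le_trans bK; lra.
have lab0 : (0 < #|labelings Y r n|)%N.
  apply: leq_trans (labelings_lower_bound Y r1 n4); rewrite expn_gt0; apply/orP; left.
  have /andP[+ _] := card_reduced_word (ltnW r1) (n - 4); apply: leq_trans.
  by rewrite expn_gt0 (leq_trans _ k3).
apply: le_trans (@labeling_prob_compl R r n Y _ (repeats L a0) lab0 _) _.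
  move=> l lab norep; exact: (nonrepeating_extremal d0 L0 LN eps0 eps2 epsN V3 VN valV lab norep).
have C0 : 0 < 1 + (4 * M%:R)^-1 :> R by rewrite ltr_pwDl // invr_ge0 mulr_ge0.
rewrite (ger0_norm (_ : 0 <= (_ ^- n))); last by rewrite invr_ge0 exprn_ge0 // ltW.
rewrite ler_pdivlMr ?exprn_gt0 //.
rewrite mulrAC ler_pdivrMr ?ltr0n //.
rewrite -(ler_pM2l (exprn_gt0 L (ltr0n R 3))) [leLHS]mulrA.
have count : 3 ^+ L * #|[set l in labelings Y r n | repeats L a0 l]|%:R <=
    A%:R * (n.+1 ^ 2)%:R * #|labelings Y r n|%:R :> R.
  rewrite -natrX -!natrM ler_nat; apply: leq_trans (card_repeats_labelings Y a0 r1 L0 n4).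
  by rewrite leq_mul2r leq_exp2r // k3 orbT.
apply: le_trans (ler_wpM2r (exprn_ge0 n (ltW C0)) count) _.
have := ler_wpM2l (mulr_ge0 (ler0n R A) (ler0n R #|labelings Y r n|)) (sqr_geometric_bound R n M0).
by congr (_ <= _); rewrite -/L; ring.
Qed.
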